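(* Let $\mu$ be a measure on $\mathbb{C}$. Then $\mu$ is the Riesz measure of some subharmonic function on $\mathbb{C}$ that is periodic with period $1$ and of at most linear growth if and only if $\mu$ is invariant under the translation $z\mapsto z+1$ and $$\mu\{z=x+iy:\ 0\le x<1,\ y\in\mathbb{R}\}<\infty.$$
   Context: A measure on $\mathbb{C}$ here is a nonnegative Borel measure finite on compact sets. Subharmonic functions take values in $[-\infty,\infty)$ and are not identically $-\infty$. The Riesz measure of a subharmonic function $v$ is $\frac1{2\pi}\Delta v$ (in the sense of distributions). Periodic with period $1$ means $v(z+1)=v(z)$ for all $z\in\mathbb{C}$. The function $v$ is of at most linear growth if $v(z)\le C(|z|+1)$ on $\mathbb{C}$ for some $C<\infty$. *)

(* Defs.v *)
From HB Require Import structures.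
From mathcomp Require Import all_boot all_order all_algebra.
From mathcomp Require Import all_classical all_reals all_analysis.
Set Implicit Arguments.
Unset Strict Implicit.
Unset Printing Implicit Defensive.
Import Order.TTheory GRing.Theory Num.Theory.
Import numFieldNormedType.Exports.
Local Open Scope classical_set_scope.
Local Open Scope ring_scope.

(* The complex plane is [R * R], with [x + iy] encoded as [(x, y)].  Its
   product sigma-algebra is the Borel sigma-algebra of the plane, since [R] is
   second countable. *)

(* The library norm on [R * R] is the sup norm, so the modulus is spelled
   out. *)
Definition cmod (R : realType) (z : R * R) : R :=
  Num.sqrt (z.1 ^+ 2 + z.2 ^+ 2).

Definition translate1 (R : realType) (z : R * R) : R * R := (z.1 + 1, z.2).

Definition finite_on_compacts (R : realType)
    (mu : {measure set (R * R) -> \bar R}) : Prop :=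
  forall K : set (R * R), compact K -> (mu K < +oo)%E.

Definition translation_invariant (R : realType)
    (mu : {measure set (R * R) -> \bar R}) : Prop :=
  forall A : set (R * R), measurable A ->
    pushforward mu (@translate1 R) A = mu A.

Definition d_x (R : realType) (phi : R * R -> R) : R * R -> R :=
  'D_((1, 0) : R * R) phi.

Definition d_y (R : realType) (phi : R * R -> R) : R * R -> R :=
  'D_((0, 1) : R * R) phi.

Fixpoint Ck (R : realType) (k : nat) (phi : R * R -> R) : Prop :=
  match k with
  | 0%N => continuous phi
  | k'.+1 =>
      [/\ forall z, derivable phi z (1, 0), forall z, derivable phi z (0, 1),
          Ck k' (d_x phi) & Ck k' (d_y phi)]
  end.

Definition test_function (R : realType) (phi : R * R -> R) : Prop :=
  (forall k, Ck k phi) /\ compact (closure [set z | phi z != 0]).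

Definition laplacian (R : realType) (phi : R * R -> R) (z : R * R) : R :=
  d_x (d_x phi) z + d_y (d_y phi) z.

(* Mean value of [v] over the circle of center [z] and radius [r].  For [v]
   upper semicontinuous with values in [-oo, +oo[ the integrand is measurable
   and bounded above, so this integral makes sense in [-oo, +oo[. *)
Definition circle_mean (R : realType) (v : R * R -> \bar R) (z : R * R)
    (r : R) : \bar R :=
  (((2 * pi)^-1)%:E * \int[@lebesgue_measure R]_(t in `[0%R, (2 * pi)%R])
     v (z.1 + r * cos t, z.2 + r * sin t)%R)%E.

(* The second condition is upper semicontinuity. *)
Definition subharmonic (R : realType) (v : R * R -> \bar R) : Prop :=
  [/\ forall z, (v z < +oo)%E,
      lower_semicontinuous (fun z => (- v z)%E),
      (forall z (r : R), 0 < r -> (v z <= circle_mean v z r)%E) &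
      exists z, v z != -oo%E].

(* [(2 pi)^-1 Delta v = mu] in the sense of distributions.  This is meant for
   subharmonic [v], which are locally integrable, so that the left-hand
   integrand is integrable for every test function. *)
Definition riesz_measure (R : realType) (v : R * R -> \bar R)
    (mu : {measure set (R * R) -> \bar R}) : Prop :=
  forall phi : R * R -> R, test_function phi ->
    (((2 * pi)^-1)%:E *
       \int[(@lebesgue_measure R \x @lebesgue_measure R)]_z
         (v z * (laplacian phi z)%:E) =
     \int[mu]_z (phi z)%:E)%E.

Definition periodic1 (R : realType) (v : R * R -> \bar R) : Prop :=
  forall z, v (translate1 z) = v z.

Definition at_most_linear_growth (R : realType) (v : R * R -> \bar R) : Prop :=
  exists C : R, forall z, (v z <= (C * (cmod z + 1))%:E)%E.

(* Main.v *)
(* If mu is invariant with finite mass on the strip 0 <= x < 1, let nu be its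
   restriction to the strip and integrate ln |sin (pi (z - w))| - ln (ch (2 pi Im w)) / 2
   against nu in w.  The kernel is periodic, grows linearly, and its laplacian
   is 2 pi times the sum of the unit masses at w + Z, so that integrating over nu
   yields mu by invariance.  To keep integrands smooth, 2 |sin|^2 is replaced by
   2 |sin|^2 + e; the resulting potentials decrease as e tends to 0.

   Conversely, if v is a periodic potential of mu, then v times the laplacian of
   a test function and of its translate have the same integral, so mu is
   invariant.  For the mass of the strip, test against a (x) t (y) where a is a
   plateau equal to 1 on [0, 1] and t is a smoothed tent of height and half-width r.
   The term with a'' vanishes by periodicity, a'' being the difference of two
   integer translates of one function.  In the other one t'' consists of positive bumps
   near y = r and y = - r, where v is at most O(r), and of a fixed negative bump
   near 0.  So the integral against mu is O(r), while t >= r / 2 - 3 for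
   |y| <= r / 2. *)
Require Import Defs.
From HB Require Import structures.
From mathcomp Require Import all_boot all_order all_algebra.
From mathcomp Require Import all_classical all_reals all_analysis.
From mathcomp Require Import measurable_realfun ring lra.
Import Order.TTheory GRing.Theory Num.Theory.
Import numFieldNormedType.Exports.
Local Open Scope classical_set_scope.
Local Open Scope ring_scope.
Set Implicit Arguments.
Unset Strict Implicit.
Unset Printing Implicit Defensive.

(** * Integrals over segments, rectangles and the plane *)

(** In the existence half the obstacle is the loss of control as e tends to 0: the kernel is bounded
    above uniformly in the pole and in e, but below only by a multiple of ln e. What survives is an
    average. The gap between the regularisations with parameters 1 and e is largest at the height of
    the pole, and its mean over a period is at most pi + 7 whatever e is ([L_diff_mean]); so the
    limit is locally integrable and not identically -oo. Upper semicontinuity and the mean value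
    inequality pass to the limit from the continuity of the potentials and from [P e >= 0]. That
    [P e] concentrates a mass 2 pi at each pole is read off from a flux: [Ly e] tends to pi and - pi
    at the two ends of the period strip.

    In the converse half, local integrability of [v] is extracted from the Riesz identity itself,
    tested on a function whose laplacian is 1 on a given square: the side with [mu] is finite, and
    this forces integrability. Only then do integrals against [v] become linear and translatable.
    Growth bounds [v] from above only, so it controls nonnegative weights; a weight of the other
    sign is harmless if it does not depend on r. *)

Section Integrals.
Context {R : realType}.
Implicit Types (f g : R -> R) (a b c d : R).

(** Unoriented: for [b < a] the segment is empty and the value is 0, hence the order hypotheses in
    many of the lemmas below. *)
Definition itg a b f : R := \int[lebesgue_measure]_(x in `[a, b]) f x.

Lemma lebesgue_segment a b : a <= b ->
  lebesgue_measure (`[a, b]%classic : set R) = (b - a)%:E.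
Proof.
rewrite le_eqVlt lebesgue_measure_itv/= lte_fin => /predU1P[->|->] //.
by rewrite ltxx subrr.
Qed.

Lemma cont_integrable f a b : continuous f ->
  lebesgue_measure.-integrable `[a, b] (EFin \o f).
Proof.
move=> cf; apply: continuous_compact_integrable; first exact: segment_compact.
exact: continuous_subspaceT.
Qed.

Lemma itg_EFin f a b : continuous f ->
  (\int[lebesgue_measure]_(x in `[a, b]) (f x)%:E)%E = (itg a b f)%:E.
Proof.
move=> cf; rewrite /itg /Rintegral fineK//.
by apply: integrable_fin_num => //; exact: cont_integrable.
Qed.

Lemma itg_ftc f (F : R -> R) a b : a <= b -> (forall x : R, is_derive x 1 F (f x)) ->
  continuous f -> itg a b f = F b - F a.
Proof.
rewrite le_eqVlt => /predU1P[<-|ab] dF cf.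
  by rewrite /itg set_itv1 Rintegral_set1 subrr.
have cF x : {for x, continuous F}.
  by apply/differentiable_continuous/derivable1_diffP; case: (dF x).
rewrite /itg /Rintegral (continuous_FTC2 ab (F := F))//.
- exact: continuous_subspaceT.
- split.
  + by move=> x _; case: (dF x).
  + by apply: cvg_at_right_filter; exact: cF.
  + by apply: cvg_at_left_filter; exact: cF.
- by move=> x _; rewrite derive1E; case: (dF x).
Qed.

Lemma eq_itg g f a b : (forall x, a <= x <= b -> f x = g x) -> itg a b f = itg a b g.
Proof. by move=> fg; apply: eq_Rintegral => x /set_mem; rewrite /= in_itv/=; exact: fg. Qed.

Lemma itgD f g a b : continuous f -> continuous g ->
  itg a b (fun x => f x + g x) = itg a b f + itg a b g.
Proof. by move=> cf cg; rewrite /itg RintegralD//; exact: cont_integrable. Qed.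

Lemma itgB f g a b : continuous f -> continuous g ->
  itg a b (fun x => f x - g x) = itg a b f - itg a b g.
Proof. by move=> cf cg; rewrite /itg RintegralB//; exact: cont_integrable. Qed.

Lemma itgZl f k a b : continuous f -> itg a b (fun x => k * f x) = k * itg a b f.
Proof. by move=> cf; rewrite /itg RintegralZl//; exact: cont_integrable. Qed.

Lemma itg_cst k a b : a <= b -> itg a b (fun=> k) = k * (b - a).
Proof.
by move=> ab; rewrite /itg Rintegral_cst//= (lebesgue_segment ab).
Qed.

Lemma itg0 a b : itg a b (fun=> 0) = 0.
Proof. by rewrite /itg Rintegral_cst// mul0r. Qed.

Lemma le_itg f g a b : continuous f -> continuous g ->
  (forall x, a <= x <= b -> f x <= g x) -> itg a b f <= itg a b g.
Proof.
move=> cf cg fg; apply: le_Rintegral => //; exact: cont_integrable.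
Qed.

Lemma itg_ge0 f a b : (forall x, a <= x <= b -> 0 <= f x) -> 0 <= itg a b f.
Proof. by move=> f0; apply: Rintegral_ge0 => x; rewrite /= in_itv/=; exact: f0. Qed.

Lemma itg_bound f a b C : a <= b -> continuous f ->
  (forall x, a <= x <= b -> `|f x| <= C) -> `|itg a b f| <= C * (b - a).
Proof.
move=> ab cf fC; rewrite ler_norml -mulNr -!itg_cst//.
by apply/andP; split; apply: le_itg => //;
  try (by move=> ?; exact: cvg_cst); move=> x /fC; rewrite ler_norml => /andP[].
Qed.

Lemma itg_split f a b c : continuous f -> a <= b -> b <= c ->
  itg a c f = itg a b f + itg b c f.
Proof.
move=> cf ab bc; apply/eqP; rewrite addrC -subr_eq; apply/eqP.
rewrite /itg Rintegral_itvB ?bnd_simp//; last exact: cont_integrable.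
apply: Rintegral_itv_obnd_cbnd.
by apply: integrableS (cont_integrable b c cf) => //; exact: subset_itv_oc_cc.
Qed.

(** Second countability: an open set is the union of the boxes with rational corners that it
    contains. *)
Lemma open_measurable_prod (A : set (R * R)) : open A -> measurable A.
Proof.
move=> oA.
pose box (q : (rat * rat) * (rat * rat)) : set (R * R) :=
  `]ratr q.1.1, ratr q.1.2[ `*` `]ratr q.2.1, ratr q.2.2[.
rewrite (_ : A = \bigcup_q (if `[< box q `<=` A >] then box q else set0)).
  apply: countable_bigcupT_measurable; first exact: countableP.
  by move=> q; case: ifP => // _; apply: measurableX.
apply/seteqP; split=> [z Az|z [q _]]; last by case: asboolP => // qA /qA.
have : nbhs z A by exact: open_nbhs_nbhs.
move=> /nbhs_ballP[e /= e0 zA].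
have ex x : exists p q : rat, [/\ x - e < ratr p, ratr p < x, x < ratr q & ratr q < x + e].
  have [p] : exists p, ratr p \in `]x - e, x[ by apply: rat_in_itvoo; rewrite ltrBlDr ltrDl.
  have [q] : exists q, ratr q \in `]x, x + e[ by apply: rat_in_itvoo; rewrite ltrDl.
  by rewrite !in_itv/= => /andP[? ?] /andP[? ?]; exists p, q.
have [p1 [q1 [a1 a2 a3 a4]]] := ex z.1.
have [p2 [q2 [b1 b2 b3 b4]]] := ex z.2.
exists ((p1, q1), (p2, q2)) => //.
have -> : `[< box ((p1, q1), (p2, q2)) `<=` A >] = true.
  apply/asboolP => w [] /=; rewrite !in_itv/= => /andP[c1 c2] /andP[d1 d2].
  by apply: zA; split; rewrite /ball/= ltr_norml; apply/andP; split; lra.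
by split=> /=; rewrite in_itv/=; apply/andP; split.
Qed.

Lemma continuous_measurable_prod (f : R * R -> R) :
  continuous f -> measurable_fun setT f.
Proof.
move=> /continuousP cf; apply: (measurability _ (RGenOpens.measurableE R)).
move=> _ [_ [a [b ->] <-]]; rewrite setTI; apply: open_measurable_prod.
exact/cf/interval_open.
Qed.

Lemma lsc_measurable_prod (f : R * R -> \bar R) :
  lower_semicontinuous f -> measurable_fun [set: R * R] f.
Proof.
move=> scif; apply: (measurability _ (ErealGenOInfty.measurableE R)).
move=> /= _ [_ [a ->]] <-; apply: measurableI => //; apply: open_measurable_prod.
by rewrite preimage_itvoy; move/lower_semicontinuousP : scif; exact.
Qed.

Lemma continuous_sectionl (f : R * R -> R) y : continuous f -> continuous (fun x => f (x, y)).
Proof.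
move=> cf x; apply: (@cvg_comp _ _ _ (fun x => (x, y)) f _ (nbhs (x, y))); last exact: cf.
by apply: (@cvg_pair _ _ _ _ (nbhs x) (nbhs y)); [exact: cvg_id|exact: cvg_cst].
Qed.

Lemma continuous_sectionr (f : R * R -> R) x : continuous f -> continuous (fun y => f (x, y)).
Proof.
move=> cf y; apply: (@cvg_comp _ _ _ (fun y => (x, y)) f _ (nbhs (x, y))); last exact: cf.
by apply: (@cvg_pair _ _ _ _ (nbhs x) (nbhs y)); [exact: cvg_cst|exact: cvg_id].
Qed.

Lemma cont_swap (f : R * R -> R) : continuous f -> continuous (fun z => f (z.2, z.1)).
Proof. by move=> cf z; apply: (continuous_comp (@swap_continuous _ _ z) (cf _)). Qed.

Lemma continuous_bounded_box (f : R * R -> R) a b c d : continuous f ->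
  exists2 C, 0 <= C & forall x y, a <= x <= b -> c <= y <= d -> `|f (x, y)| <= C.
Proof.
move=> cf.
have : compact (f @` (`[a, b] `*` `[c, d])).
  apply: continuous_compact; first exact: continuous_subspaceT.
  by apply: compact_setX; exact: segment_compact.
move=> /compact_bounded[M [_ fM]].
exists (Num.max 0 M + 1); first by rewrite addr_ge0// le_max lexx.
move=> x y xab ycd; apply: fM; first by rewrite ltr_pwDr// le_max lexx orbT.
by exists (x, y) => //; split; rewrite /= in_itv.
Qed.

End Integrals.

(** * Fubini for functions bounded on a rectangle of finite measure *)

Section Fubini.
Context d1 d2 (T1 : measurableType d1) (T2 : measurableType d2) (R : realType).
Variables (m1 : {sigma_finite_measure set T1 -> \bar R})
  (m2 : {sigma_finite_measure set T2 -> \bar R}).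
Variables (A : set T1) (B : set T2) (f : T1 * T2 -> R) (C : R).
Hypotheses (mA : measurable A) (mB : measurable B)
  (m1A : (m1 A < +oo)%E) (m2B : (m2 B < +oo)%E).
Hypothesis mf : measurable_fun setT f.
Hypothesis fC : forall x y, A x -> B y -> `|f (x, y)| <= C.

Lemma bounded_integrable_prod :
  (m1 \x m2)%E.-integrable (A `*` B) (EFin \o f).
Proof.
apply: measurable_bounded_integrable; first exact: measurableX.
- by rewrite /= product_measure1E// lte_mul_pinfty// ge0_fin_numE.
- exact: measurable_funTS.
- exists C; split; first exact: num_real.
  by move=> M CM [x y] /= [Ax By]; exact: le_trans (fC Ax By) (ltW CM).
Qed.

Lemma bounded_integrable_sectionr x : A x -> m2.-integrable B (fun y => (f (x, y))%:E).
Proof.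
move=> Ax; apply: (measurable_bounded_integrable (f := fun y => f (x, y))) => //.
- by apply: measurable_funTS; apply: measurableT_comp => //; exact: measurable_pair1.
- exists C; split; first exact: num_real.
  by move=> M CM y By; exact: le_trans (fC Ax By) (ltW CM).
Qed.

Lemma bounded_integrable_sectionl y : B y -> m1.-integrable A (fun x => (f (x, y))%:E).
Proof.
move=> By; apply: (measurable_bounded_integrable (f := fun x => f (x, y))) => //.
- by apply: measurable_funTS; apply: measurableT_comp => //; exact: measurable_pair2.
- exists C; split; first exact: num_real.
  by move=> M CM x Ax; exact: le_trans (fC Ax By) (ltW CM).
Qed.

(** Extension by zero, so that Fubini on the whole product applies to a function bounded only on [A]
    times [B]. *)
Let F : T1 * T2 -> \bar R := (EFin \o f) \_ (A `*` B).

Let iF : (m1 \x m2)%E.-integrable setT F.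
Proof. by apply/(integrable_mkcond _ (measurableX mA mB)); exact: bounded_integrable_prod. Qed.

Let mF : measurable_fun [set: T1 * T2] F.
Proof. exact: measurable_int iF. Qed.

Lemma integral_prod_iter1 :
  (\int[m1 \x m2]_(z in A `*` B) (f z)%:E)%E =
  (\int[m1]_(x in A) (\int[m2]_(y in B) f (x, y))%:E)%E.
Proof.
rewrite [LHS]integral_mkcond -integral12_prod_meas1// [RHS]integral_mkcond.
apply: eq_integral => x _; rewrite /fubini_F /patch; case: ifPn => xA.
  rewrite /Rintegral fineK; last first.
    by apply: integrable_fin_num => //; apply: bounded_integrable_sectionr; exact/set_mem.
  rewrite [RHS]integral_mkcond; apply: eq_integral => y _; rewrite /F /patch.
  by rewrite in_setX xA/=.
by apply: integral0_eq => y _; rewrite /F in_setX/= (negbTE xA).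
Qed.

Lemma integral_prod_iter2 :
  (\int[m1 \x m2]_(z in A `*` B) (f z)%:E)%E =
  (\int[m2]_(y in B) (\int[m1]_(x in A) f (x, y))%:E)%E.
Proof.
rewrite [LHS]integral_mkcond -integral21_prod_meas1// [RHS]integral_mkcond.
apply: eq_integral => y _; rewrite /fubini_G /patch; case: ifPn => yB.
  rewrite /Rintegral fineK; last first.
    by apply: integrable_fin_num => //; apply: bounded_integrable_sectionl; exact/set_mem.
  rewrite [RHS]integral_mkcond; apply: eq_integral => x _; rewrite /F /patch.
  by rewrite in_setX yB/= andbT.
by apply: integral0_eq => x _; rewrite /F in_setX/= (negbTE yB) andbF.
Qed.

Lemma bounded_integrable_iter1 :
  m1.-integrable A (fun x => (\int[m2]_(y in B) f (x, y))%:E).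
Proof.
apply/(integrable_mkcond _ mA).
rewrite (_ : _ \_ _ = fubini_F m2 F); first exact: integrable_fubini_F.
apply/funext => x; rewrite /fubini_F /patch; case: ifPn => xA.
  rewrite /Rintegral fineK; last first.
    by apply: integrable_fin_num => //; apply: bounded_integrable_sectionr; exact/set_mem.
  rewrite [LHS]integral_mkcond; apply: eq_integral => y _; rewrite /F /patch.
  by rewrite in_setX xA/=.
by apply/esym; apply: integral0_eq => y _; rewrite /F /patch in_setX/= (negbTE xA).
Qed.

Lemma Rintegral_swap :
  \int[m1]_(x in A) \int[m2]_(y in B) f (x, y) =
  \int[m2]_(y in B) \int[m1]_(x in A) f (x, y).
Proof. by rewrite /Rintegral; congr fine; rewrite -integral_prod_iter1 integral_prod_iter2. Qed.

End Fubini.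

Section Planar.
Context {R : realType}.
Implicit Types (f : R * R -> R) (a b c d : R).
Notation leb := (@lebesgue_measure R).

Lemma lebesgue_itv_fin a b : (leb `[a, b] < +oo)%E.
Proof. by rewrite lebesgue_measure_itv/=; case: ifP => _; rewrite ltry. Qed.

Lemma itg_swap f a b c d : continuous f ->
  itg a b (fun x => itg c d (fun y => f (x, y))) =
  itg c d (fun y => itg a b (fun x => f (x, y))).
Proof.
move=> cf; have [C _ fC] := continuous_bounded_box a b c d cf.
apply: (Rintegral_swap (C := C)) => //; try exact: lebesgue_itv_fin.
exact: continuous_measurable_prod.
Qed.

(** Dominated convergence with a constant: [f] is bounded on the compact box lying over
    [[y - 1, y + 1]]. *)
Lemma continuous_itg_param f a b : a <= b -> continuous f ->
  continuous (fun y => itg a b (fun x => f (x, y))).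
Proof.
move=> ab cf y.
have [C _ fC] := continuous_bounded_box a b (y - 1) (y + 1) cf.
have yy : y \in `]y - 1, y + 1[%classic by rewrite inE/= in_itv/=; apply/andP; split; lra.
apply: (@continuity_under_integral _ _ _ leb (fun l x => f (x, l)) `[a, b] _
  (y - 1) (y + 1) _ _ (fun=> C) _ _ y yy) => //.
- by move=> l _; apply: cont_integrable; exact: continuous_sectionl.
- by apply: aeW => x _ l _; exact: continuous_sectionr.
- by apply: cont_integrable; exact: cst_continuous.
- move=> l; rewrite /= in_itv/= => /andP[l1 l2]; apply: aeW => x; rewrite /= in_itv/= => xab.
  by apply: fC => //; rewrite !ltW.
Qed.

Lemma continuous_itg_param2 f c d : c <= d -> continuous f ->
  continuous (fun x => itg c d (fun y => f (x, y))).
Proof.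
move=> cd cf; apply: (@continuous_itg_param (fun z => f (z.2, z.1))) => //.
exact: cont_swap.
Qed.

Lemma integral_plane_box f a b c d : continuous f ->
  (forall z, ~ (a <= z.1 <= b /\ c <= z.2 <= d) -> f z = 0) -> a <= b -> c <= d ->
  (\int[leb \x leb]_z (f z)%:E)%E = (itg a b (fun x => itg c d (fun y => f (x, y))))%:E.
Proof.
move=> cf f0 ab cd; have [C _ fC] := continuous_bounded_box a b c d cf.
rewrite -itg_EFin; last exact: continuous_itg_param2.
have E := @integral_prod_iter1 _ _ _ _ _ leb leb `[a, b]%classic `[c, d]%classic f C
  (measurable_itv _) (measurable_itv _) (lebesgue_itv_fin a b) (lebesgue_itv_fin c d)
  (continuous_measurable_prod cf).
rewrite /itg -E; last by move=> x y; rewrite /= !in_itv/=; exact: fC.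
rewrite [RHS]integral_mkcond; apply: eq_integral => z _; rewrite patchE.
case: ifPn => //; by rewrite notin_setE => zn; rewrite f0.
Qed.

End Planar.

(** * One-variable calculus *)

Section Calculus.
Context {R : realType}.

Section ContinuousCombinators.
Context {T : topologicalType}.
Implicit Types f g : T -> R.

Lemma cont_cst (c : R) : continuous (fun _ : T => c).
Proof. by move=> z; exact: cvg_cst. Qed.

Lemma cont_add f g : continuous f -> continuous g -> continuous (fun z => f z + g z).
Proof. by move=> cf cg z; apply: cvgD; [exact: cf|exact: cg]. Qed.

Lemma cont_opp f : continuous f -> continuous (fun z => - f z).
Proof. by move=> cf z; apply: cvgN; exact: cf. Qed.

Lemma cont_mul f g : continuous f -> continuous g -> continuous (fun z => f z * g z).
Proof. by move=> cf cg z; apply: cvgM; [exact: cf|exact: cg]. Qed.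

Lemma cont_inv f : (forall z, f z != 0) -> continuous f -> continuous (fun z => (f z)^-1).
Proof. by move=> f0 cf z; apply: cvgV => //; exact: cf. Qed.

Lemma cont_comp (h : R -> R) f : continuous h -> continuous f ->
  continuous (fun z => h (f z)).
Proof. by move=> ch cf z; apply: (continuous_comp (cf z) (ch _)). Qed.

Lemma cont_ln f : (forall z, 0 < f z) -> continuous f -> continuous (fun z => ln (f z)).
Proof. by move=> f0 cf z; apply: (continuous_comp (cf z) (continuous_ln (f0 z))). Qed.

End ContinuousCombinators.

Lemma cont_fst : continuous (fst : R * R -> R).
Proof. by move=> z; exact: cvg_fst. Qed.

Lemma cont_snd : continuous (snd : R * R -> R).
Proof. by move=> z; exact: cvg_snd. Qed.

Lemma cont_id : continuous (fun x : R => x).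
Proof. by move=> z; exact: cvg_id. Qed.

(** The derivative is an explicit second function, so that the fundamental theorem and second
    derivatives come with formulas; [der_eq] swaps the derivative produced by the rules for a chosen
    closed form. *)
Definition der (f f' : R -> R) := forall x : R, is_derive x 1 f (f' x).

Lemma der_eq (f f' g' : R -> R) : der f g' -> f' =1 g' -> der f f'.
Proof. by move=> df e x; rewrite e. Qed.

Lemma der_cst (c : R) : der (fun=> c) (fun=> 0).
Proof. by move=> x; exact: is_derive_cst. Qed.

Lemma der_id : der (fun x => x) (fun=> 1).
Proof. by move=> x; exact: is_derive_id. Qed.

Lemma der_add (f f' g g' : R -> R) : der f f' -> der g g' ->
  der (fun x => f x + g x) (fun x => f' x + g' x).
Proof. by move=> df dg x; exact: is_deriveD. Qed.

Lemma der_opp (f f' : R -> R) : der f f' -> der (fun x => - f x) (fun x => - f' x).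
Proof. by move=> df x; exact: is_deriveN. Qed.

Lemma der_mul (f f' g g' : R -> R) : der f f' -> der g g' ->
  der (fun x => f x * g x) (fun x => f' x * g x + f x * g' x).
Proof.
move=> df dg x; have := is_deriveM (df x) (dg x).
by move=> h; apply: is_derive_eq; rewrite addrC [g x *: _]mulrC.
Qed.

Lemma der_comp (h h' f f' : R -> R) : der h h' -> der f f' ->
  der (fun x => h (f x)) (fun x => h' (f x) * f' x).
Proof. by move=> dh df x; exact: is_derive1_comp. Qed.

Lemma der_inv (f f' : R -> R) : (forall x, f x != 0) -> der f f' ->
  der (fun x => (f x)^-1) (fun x => - (f' x / f x ^+ 2)).
Proof.
move=> f0 df x; have := is_deriveV (f0 x) (df x).
by move=> h; apply: is_derive_eq; rewrite scaleNr mulrC.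
Qed.

Lemma der_ln (f f' : R -> R) : (forall x, 0 < f x) -> der f f' ->
  der (fun x => ln (f x)) (fun x => f' x / f x).
Proof.
move=> f0 df x; have := is_derive1_comp (is_derive1_ln (f0 x)) (df x).
by move=> h; apply: is_derive_eq; rewrite mulrC.
Qed.

Lemma der_cos : der cos (fun x => - sin x).
Proof. by move=> x; exact: is_derive_cos. Qed.

Lemma der_sin : der sin cos.
Proof. by move=> x; exact: is_derive_sin. Qed.

Lemma der_expR : der expR expR.
Proof. by move=> x; exact: is_derive_expR. Qed.

Lemma der_cont (f f' : R -> R) : der f f' -> continuous f.
Proof.
by move=> df x; apply/differentiable_continuous/derivable1_diffP; case: (df x).
Qed.

Definition ch (u : R) : R := (expR u + expR (- u)) / 2.
Definition sh (u : R) : R := (expR u - expR (- u)) / 2.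

Lemma der_ch : der ch sh.
Proof.
apply: der_eq; first by apply: der_mul (der_cst _); apply: der_add der_expR _;
  apply: der_comp der_expR _; apply: der_opp der_id.
by move=> x; rewrite /sh; ring.
Qed.

Lemma der_sh : der sh ch.
Proof.
apply: der_eq; first by apply: der_mul (der_cst _); apply: der_add der_expR _;
  apply: der_opp; apply: der_comp der_expR _; apply: der_opp der_id.
by move=> x; rewrite /ch; ring.
Qed.

Lemma ch2Bsh2 u : ch u ^+ 2 - sh u ^+ 2 = 1.
Proof.
by rewrite /ch /sh -[RHS](expRxMexpNx_1 u); field.
Qed.

Lemma chN u : ch (- u) = ch u.
Proof. by rewrite /ch opprK addrC. Qed.

Lemma shN u : sh (- u) = - sh u.
Proof. by rewrite /sh opprK -mulNr opprB. Qed.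

Lemma ch_gt0 u : 0 < ch u.
Proof. by rewrite /ch divr_gt0// addr_gt0// expR_gt0. Qed.

Lemma ch_ge1 u : 1 <= ch u.
Proof.
have := ch2Bsh2 u; have := ch_gt0 u; have := sqr_ge0 (sh u).
set a := ch u; set b := sh u; nra.
Qed.

Lemma sh_le_ch u : `|sh u| <= ch u.
Proof.
have := expR_gt0 u; have := expR_gt0 (- u).
by rewrite /sh /ch ler_norml; move=> ? ?; apply/andP; split; lra.
Qed.

Lemma ch_le_expR u : ch u <= expR `|u|.
Proof.
have h : expR u <= expR `|u| by rewrite ler_expR ler_norm.
have h' : expR (- u) <= expR `|u| by rewrite ler_expR -normrN ler_norm.
by rewrite /ch; lra.
Qed.

(** Applied with [u = 2 pi y] and [v = 2 pi Im w]: the ratio of the two hyperbolic cosines is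
    bounded independently of [w], which is what the normalisation of the kernel rests on. *)
Lemma chB_le u v : ch (u - v) <= expR `|u| * ch v.
Proof.
have h : expR u <= expR `|u| by rewrite ler_expR ler_norm.
have h' : expR (- u) <= expR `|u| by rewrite ler_expR -normrN ler_norm.
rewrite /ch opprB expRD addrC [v - u]addrC expRD.
have := expR_gt0 v; have := expR_gt0 (- v).
move: (expR v) (expR (- v)) (expR u) (expR (-u)) (expR `|u|) h h' => a b c d e; nra.
Qed.

Lemma chB_ge u v : expR (- `|u|) * ch v <= ch (u - v).
Proof.
have h : expR (- `|u|) <= expR u by rewrite ler_expR lerNl -normrN ler_norm.
have h' : expR (- `|u|) <= expR (- u) by rewrite ler_expR lerN2 ler_norm.
rewrite /ch opprB expRD addrC [v - u]addrC expRD.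
have := expR_gt0 v; have := expR_gt0 (- v).
move: (expR v) (expR (- v)) (expR u) (expR (-u)) (expR (- `|u|)) h h' => a b c d e; nra.
Qed.

Lemma ch_ge_quad u : 0 <= u -> u / 2 <= ch u.
Proof.
move=> u0; have := expR_ge1Dx u; have := expR_gt0 (- u); rewrite /ch; lra.
Qed.

Lemma cont_expR : continuous (@expR R). Proof. exact: der_cont der_expR. Qed.
Lemma cont_sqr : continuous (fun x : R => x ^+ 2).
Proof. by move=> x; apply: cvgM; exact: cvg_id. Qed.
Lemma cont_ch : continuous ch. Proof. exact: der_cont der_ch. Qed.
Lemma cont_sh : continuous sh. Proof. exact: der_cont der_sh. Qed.
Lemma cont_cos : continuous (@cos R). Proof. exact: der_cont der_cos. Qed.
Lemma cont_sin : continuous (@sin R). Proof. exact: der_cont der_sin. Qed.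

End Calculus.

Ltac cont_step := lazymatch goal with
  | |- forall x, continuous_at x (fun z => z) => exact: cont_id
  | |- forall x, continuous_at x (fun z => fst z) => exact: cont_fst
  | |- forall x, continuous_at x (fun z => snd z) => exact: cont_snd
  | |- forall x, continuous_at x (fun z => @?f z + @?g z) => apply: cont_add
  | |- forall x, continuous_at x (fun z => - @?f z) => apply: cont_opp
  | |- forall x, continuous_at x (fun z => @?f z * @?g z) => apply: cont_mul
  | |- forall x, continuous_at x (fun z => @?f z ^+ 2) => apply: (cont_comp cont_sqr)
  | |- forall x, continuous_at x (fun z => ch (@?f z)) => apply: (cont_comp cont_ch)
  | |- forall x, continuous_at x (fun z => sh (@?f z)) => apply: (cont_comp cont_sh)
  | |- forall x, continuous_at x (fun z => cos (@?f z)) => apply: (cont_comp cont_cos)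
  | |- forall x, continuous_at x (fun z => sin (@?f z)) => apply: (cont_comp cont_sin)
  | |- forall x, continuous_at x (fun z => expR (@?f z)) => apply: (cont_comp cont_expR)
  | |- _ => first [ assumption | exact: cont_cst | exact: cont_fst | exact: cont_snd | exact: cont_id
                   | exact: cont_cos | exact: cont_sin ]
  end.
Ltac cont := repeat cont_step.

(** * The regularised periodic logarithmic kernel *)

Section Kernel.
Context {R : realType}.
Implicit Types (e x y s t r : R).

Lemma cos_per x : cos (2 * pi * (x + 1)) = cos (2 * pi * x) :> R.
Proof. by rewrite mulrDr mulr1 [2 * pi in X in _ + X]mulr_natl cosD2pi. Qed.

Lemma sin_per x : sin (2 * pi * (x + 1)) = sin (2 * pi * x) :> R.
Proof. by rewrite mulrDr mulr1 [2 * pi in X in _ + X]mulr_natl sinD2pi. Qed.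

(* Since [2 |sin (pi z)|^2 = ch (2 pi y) - cos (2 pi x)], the function [L e] below
   is [ln |sin (pi z)| + ln 2 / 2] regularised by [e]; [P e] is its laplacian. *)
Definition H e x y : R := ch (2 * pi * y) - cos (2 * pi * x) + e.

Lemma H_gt0 e x y : 0 < e -> 0 < H e x y.
Proof.
move=> e0; rewrite /H; have := ch_ge1 (2 * pi * y); have := cos_le1 (2 * pi * x); lra.
Qed.

Lemma H_neq0 e x y : 0 < e -> H e x y != 0.
Proof. by move=> e0; rewrite gt_eqF// H_gt0. Qed.

Lemma cont_H {T : topologicalType} e (f g : T -> R) : continuous f -> continuous g ->
  continuous (fun z => H e (f z) (g z)).
Proof. by rewrite /H => cf cg; cont. Qed.

Lemma der_H e (X X' Y Y' : R -> R) : der X X' -> der Y Y' ->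
  der (fun s => H e (X s) (Y s))
      (fun s => 2 * pi * (sh (2 * pi * Y s) * Y' s + sin (2 * pi * X s) * X' s)).
Proof.
move=> dX dY; apply: der_eq.
  apply: der_add (der_cst e); apply: der_add (der_opp _).
    by apply: (der_comp der_ch); apply: der_mul (der_cst _) dY.
  by apply: (der_comp der_cos); apply: der_mul (der_cst _) dX.
by move=> s /=; ring.
Qed.

Definition L e x y : R := ln (H e x y) / 2.

Definition Lx e x y : R := pi * sin (2 * pi * x) / H e x y.
Definition Ly e x y : R := pi * sh (2 * pi * y) / H e x y.
Definition Lxx e x y : R := 2 * pi ^+ 2 *
  (cos (2 * pi * x) / H e x y - sin (2 * pi * x) ^+ 2 / H e x y ^+ 2).
Definition Lyy e x y : R := 2 * pi ^+ 2 *
  (ch (2 * pi * y) / H e x y - sh (2 * pi * y) ^+ 2 / H e x y ^+ 2).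
Definition P e x y : R := 2 * pi ^+ 2 * e *
  (ch (2 * pi * y) + cos (2 * pi * x)) / H e x y ^+ 2.

(** Over the common denominator the numerator is [(ch + cos) H - sh^2 - sin^2]. The two quadratic
    identities cancel everything free of [e], because ln |sin (pi z)| is harmonic off its zeros;
    [e (ch + cos)] remains. *)
Lemma laplacian_L e x y : 0 < e -> Lxx e x y + Lyy e x y = P e x y.
Proof.
move=> e0; have := H_neq0 x y e0; rewrite /Lxx /Lyy /P /H => h0.
have := cos2Dsin2 (2 * pi * x); have := ch2Bsh2 (2 * pi * y).
move: h0; move: (ch _) (sh _) (cos _) (sin _) => a b c d h0 ab cd.
have -> : b ^+ 2 = a ^+ 2 - 1 by lra.
have -> : d ^+ 2 = 1 - c ^+ 2 by lra.
by field.
Qed.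

Lemma P_ge0 e x y : 0 < e -> 0 <= P e x y.
Proof.
move=> e0; rewrite /P divr_ge0 ?exprn_ge0 ?(ltW (H_gt0 _ _ e0))//.
apply: mulr_ge0; first by apply: mulr_ge0 (ltW e0); apply: mulr_ge0 (sqr_ge0 _).
have := ch_ge1 (2 * pi * y); have := cos_geN1 (2 * pi * x); lra.
Qed.

(** Chain rule along an arbitrary path; it serves both the partial derivatives and the polar
    coordinates. *)
Lemma der_Lx_path e (X X' Y Y' : R -> R) : 0 < e -> der X X' -> der Y Y' ->
  der (fun s => L e (X s) (Y s)) (fun s => Lx e (X s) (Y s) * X' s + Ly e (X s) (Y s) * Y' s).
Proof.
move=> e0 dX dY; apply: der_eq.
  by apply: der_mul (der_cst _); apply: der_ln (der_H e dX dY) => s; exact: H_gt0.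
by move=> s; rewrite /Lx /Ly; field; exact: H_neq0.
Qed.

Let dc s : der (fun x : R => x - s) (fun=> 1).
Proof. by apply: der_eq; [apply: der_add der_id (der_cst _)|move=> x /=; rewrite addr0]. Qed.

Lemma der_L_x e a y : 0 < e -> der (fun x => L e (x - a) y) (fun x => Lx e (x - a) y).
Proof.
move=> e0; apply: der_eq; first exact: der_Lx_path (dc a) (der_cst y).
by move=> x /=; ring.
Qed.

Lemma der_L_y e b x : 0 < e -> der (fun y => L e x (y - b)) (fun y => Ly e x (y - b)).
Proof.
move=> e0; apply: der_eq; first exact: der_Lx_path (der_cst x) (dc b).
by move=> y /=; ring.
Qed.

Lemma der_Lx_x e a y : 0 < e -> der (fun x => Lx e (x - a) y) (fun x => Lxx e (x - a) y).
Proof.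
move=> e0; apply: der_eq.
  apply: der_mul.
    apply: der_mul (der_cst _) _; apply: (der_comp der_sin).
    by apply: der_mul (der_cst _) (dc a).
  by apply: der_inv (der_H e (dc a) (der_cst y)) => s; exact: H_neq0.
by move=> x /=; rewrite /Lxx; field; exact: H_neq0.
Qed.

Lemma der_Ly_y e b x : 0 < e -> der (fun y => Ly e x (y - b)) (fun y => Lyy e x (y - b)).
Proof.
move=> e0; apply: der_eq.
  apply: der_mul.
    apply: der_mul (der_cst _) _; apply: (der_comp der_sh).
    by apply: der_mul (der_cst _) (dc b).
  by apply: der_inv (der_H e (der_cst x) (dc b)) => s; exact: H_neq0.
by move=> y /=; rewrite /Lyy; field; exact: H_neq0.
Qed.

Lemma cont_L {T : topologicalType} e (f g : T -> R) : 0 < e -> continuous f -> continuous g ->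
  continuous (fun z => L e (f z) (g z)).
Proof.
move=> e0 cf cg; apply: cont_mul; last cont.
by apply: cont_ln; [move=> z; exact: H_gt0|exact: cont_H].
Qed.

Lemma cont_Lx {T : topologicalType} e (f g : T -> R) : 0 < e -> continuous f -> continuous g ->
  continuous (fun z => Lx e (f z) (g z)).
Proof.
move=> e0 cf cg; apply: cont_mul; first cont.
by apply: cont_inv; [move=> z; exact: H_neq0|exact: cont_H].
Qed.

Lemma cont_Ly {T : topologicalType} e (f g : T -> R) : 0 < e -> continuous f -> continuous g ->
  continuous (fun z => Ly e (f z) (g z)).
Proof.
move=> e0 cf cg; apply: cont_mul; first cont.
by apply: cont_inv; [move=> z; exact: H_neq0|exact: cont_H].
Qed.

Lemma cont_Lxx {T : topologicalType} e (f g : T -> R) : 0 < e -> continuous f -> continuous g ->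
  continuous (fun z => Lxx e (f z) (g z)).
Proof.
move=> e0 cf cg; have cH := cont_H (e := e) cf cg.
have cHV : continuous (fun z => (H e (f z) (g z))^-1).
  by apply: cont_inv => // z; exact: H_neq0.
have cHV2 : continuous (fun z => (H e (f z) (g z) ^+ 2)^-1).
  apply: cont_inv => [z|]; first by rewrite expf_neq0// H_neq0.
  by cont.
rewrite /Lxx; apply: cont_mul; first cont; apply: cont_add; first cont.
by cont.
Qed.

Lemma cont_Lyy {T : topologicalType} e (f g : T -> R) : 0 < e -> continuous f -> continuous g ->
  continuous (fun z => Lyy e (f z) (g z)).
Proof.
move=> e0 cf cg; have cH := cont_H (e := e) cf cg.
have cHV : continuous (fun z => (H e (f z) (g z))^-1).
  by apply: cont_inv => // z; exact: H_neq0.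
have cHV2 : continuous (fun z => (H e (f z) (g z) ^+ 2)^-1).
  apply: cont_inv => [z|]; first by rewrite expf_neq0// H_neq0.
  by cont.
rewrite /Lyy; apply: cont_mul; first cont; apply: cont_add; first cont.
by cont.
Qed.

Lemma cont_P {T : topologicalType} e (f g : T -> R) : 0 < e -> continuous f -> continuous g ->
  continuous (fun z => P e (f z) (g z)).
Proof.
move=> e0 cf cg; rewrite (_ : (fun z => _) = (fun z => Lxx e (f z) (g z) + Lyy e (f z) (g z))).
  by apply: cont_add; [exact: cont_Lxx|exact: cont_Lyy].
by apply/funext => z; rewrite laplacian_L.
Qed.

(* The map [(s, t) |-> L e (x + s cos t) (y + s sin t)] and its derivatives;
   [Gm] is the derivative in [t] divided by [s], continued across [s = 0]. *)
Section Polar.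
Variables (e x y : R) (e0 : 0 < e).

Let X s t := x + s * cos t.
Let Y s t := y + s * sin t.
Let N s t := sh (2 * pi * Y s t) * sin t + sin (2 * pi * X s t) * cos t.
Let M s t := sh (2 * pi * Y s t) * cos t - sin (2 * pi * X s t) * sin t.
Let G s t := L e (X s t) (Y s t).
Let Gs s t := pi * N s t / H e (X s t) (Y s t).
Let Gm s t := pi * M s t / H e (X s t) (Y s t).
Let dsGs s t := Gs s t + s * (2 * pi ^+ 2 *
  ((ch (2 * pi * Y s t) * sin t ^+ 2 + cos (2 * pi * X s t) * cos t ^+ 2) / H e (X s t) (Y s t)
   - N s t ^+ 2 / H e (X s t) (Y s t) ^+ 2)).
Let dtGm s t := - Gs s t + s * (2 * pi ^+ 2 *
  ((ch (2 * pi * Y s t) * cos t ^+ 2 + cos (2 * pi * X s t) * sin t ^+ 2) / H e (X s t) (Y s t)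
   - M s t ^+ 2 / H e (X s t) (Y s t) ^+ 2)).

(** The laplacian in polar coordinates, multiplied by [s]: [dsGs] is the radial derivative of
    [s * Gs] and [dtGm] the angular derivative of [Gm]. The identity [E] is that of Lagrange for the
    vectors (b, d) and (u, v). *)
Let polar_laplacian s t : dsGs s t = s * P e (X s t) (Y s t) - dtGm s t.
Proof.
rewrite /dsGs /dtGm -laplacian_L// /Lxx /Lyy /Gs /N /M.
have := H_neq0 (X s t) (Y s t) e0; rewrite /H => h0.
have := cos2Dsin2 t.
move: h0; move: (ch _) (sh _) (cos (2 * pi * _)) (sin (2 * pi * _)) (cos t) (sin t).
move=> a b c d u v h0 uv.
have -> : v ^+ 2 = 1 - u ^+ 2 by lra.
have E : (b * u - d * v) ^+ 2 = (b ^+ 2 + d ^+ 2) - (b * v + d * u) ^+ 2.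
  transitivity ((b ^+ 2 + d ^+ 2) * (u ^+ 2 + v ^+ 2) - (b * v + d * u) ^+ 2); first by ring.
  by rewrite uv mulr1.
rewrite E; field; exact: h0.
Qed.

Let dX_s t : der (X ^~ t) (fun=> cos t).
Proof.
apply: der_eq; first by apply: der_add (der_cst _) (der_mul der_id (der_cst _)).
by move=> s /=; ring.
Qed.

Let dY_s t : der (Y ^~ t) (fun=> sin t).
Proof.
apply: der_eq; first by apply: der_add (der_cst _) (der_mul der_id (der_cst _)).
by move=> s /=; ring.
Qed.

Let dX_t s : der (X s) (fun t => - s * sin t).
Proof.
apply: der_eq; first by apply: der_add (der_cst _) (der_mul (der_cst _) der_cos).
by move=> t /=; ring.
Qed.

Let dY_t s : der (Y s) (fun t => s * cos t).
Proof.
apply: der_eq; first by apply: der_add (der_cst _) (der_mul (der_cst _) der_sin).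
by move=> t /=; ring.
Qed.

Let dG t : der (G ^~ t) (Gs ^~ t).
Proof.
apply: der_eq; first exact: der_Lx_path e0 (dX_s t) (dY_s t).
by move=> s; rewrite /Gs /Lx /Ly /N; field; exact: H_neq0.
Qed.

Let dsG t : der (fun s => s * Gs s t) (dsGs ^~ t).
Proof.
apply: der_eq.
  apply: der_mul der_id _; apply: der_mul.
    apply: der_mul (der_cst _) _; apply: der_add.
      apply: der_mul (der_cst _); apply: (der_comp der_sh).
      exact: der_mul (der_cst _) (dY_s t).
    apply: der_mul (der_cst _); apply: (der_comp der_sin).
    exact: der_mul (der_cst _) (dX_s t).
  by apply: der_inv (der_H e (dX_s t) (dY_s t)) => s; exact: H_neq0.
by move=> s; rewrite /dsGs /Gs /N /=; field; exact: H_neq0.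
Qed.

Let dG_m s : der (Gm s) (dtGm s).
Proof.
apply: der_eq.
  apply: der_mul.
    apply: der_mul (der_cst _) _; apply: der_add.
      apply: der_mul der_cos; apply: (der_comp der_sh).
      exact: der_mul (der_cst _) (dY_t s).
    apply: der_opp; apply: der_mul der_sin; apply: (der_comp der_sin).
    exact: der_mul (der_cst _) (dX_t s).
  by apply: der_inv (der_H e (dX_t s) (dY_t s)) => t; exact: H_neq0.
by move=> t; rewrite /dtGm /Gs /N /M /=; field; exact: H_neq0.
Qed.

Let cX : continuous (fun z : R * R => X z.1 z.2).
Proof. by rewrite /X; cont. Qed.

Let cY : continuous (fun z : R * R => Y z.1 z.2).
Proof. by rewrite /Y; cont. Qed.

Let cGs : continuous (fun z : R * R => Gs z.1 z.2).
Proof.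
have cN : continuous (fun z : R * R => N z.1 z.2) by rewrite /N; cont.
apply: cont_mul; first by cont.
by apply: cont_inv; [move=> z; exact: H_neq0|exact: cont_H].
Qed.

Let cdtGm : continuous (fun z : R * R => dtGm z.1 z.2).
Proof.
have cH := cont_H (e := e) cX cY.
have cHV : continuous (fun z : R * R => (H e (X z.1 z.2) (Y z.1 z.2))^-1).
  by apply: cont_inv => // z; exact: H_neq0.
have cHV2 : continuous (fun z : R * R => (H e (X z.1 z.2) (Y z.1 z.2) ^+ 2)^-1).
  apply: cont_inv => [z|]; first by rewrite expf_neq0// H_neq0.
  by cont.
have cM : continuous (fun z : R * R => M z.1 z.2) by rewrite /M; cont.
rewrite /dtGm; apply: cont_add; first by cont.
by cont.
Qed.

Let cdsGs : continuous (fun z : R * R => dsGs z.1 z.2).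
Proof.
rewrite (_ : (fun z => _) = (fun z => z.1 * P e (X z.1 z.2) (Y z.1 z.2) - dtGm z.1 z.2)).
  have cP := cont_P e0 cX cY; by cont.
by apply/funext => z; rewrite polar_laplacian.
Qed.

Let Gm_per s : Gm s (2 * pi) = Gm s 0.
Proof.
by rewrite /Gm /M /X /Y mulr_natl cos2pi sin2pi cos0 sin0.
Qed.

Let pi2_ge0 : 0 <= 2 * pi :> R.
Proof. by rewrite mulr_ge0// ltW// pi_gt0. Qed.

(** The angular derivative integrates to zero over a full turn, which leaves [s] times the integral
    of [P e]. *)
Let mean_dsGs s : 0 <= s -> 0 <= itg 0 (2 * pi) (dsGs s).
Proof.
move=> s0.
rewrite (eq_itg (g := fun t => s * P e (X s t) (Y s t) - dtGm s t)); last first.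
  by move=> t _; rewrite polar_laplacian.
have cP : continuous (fun t => s * P e (X s t) (Y s t)).
  apply: cont_mul; first exact: cont_cst.
  exact: cont_P e0 (der_cont (dX_t s)) (der_cont (dY_t s)).
have cD : continuous (dtGm s) by exact: (continuous_sectionr (x := s) cdtGm).
rewrite itgB// (itg_ftc pi2_ge0 (dG_m s))// Gm_per subrr subr0.
by apply: itg_ge0 => t _; rewrite mulr_ge0// P_ge0.
Qed.

(** For [s > 0], [s] times this integral is the integral over [[0, s]] of the quantities in
    [mean_dsGs], since [s * Gs] vanishes at the centre. *)
Let mean_Gs s : 0 <= s -> 0 <= itg 0 (2 * pi) (Gs s).
Proof.
rewrite le_eqVlt => /predU1P[<-|s0].
  (* No division by [s] is possible here, but at [s = 0] the functions [Gs] and [dsGs] coincide. *)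
  rewrite (eq_itg (g := dsGs 0)); first by rewrite mean_dsGs.
  by move=> t _; rewrite /dsGs mul0r addr0.
have cGss : continuous (Gs s) by exact: (continuous_sectionr (x := s) cGs).
have : 0 <= itg 0 s (fun u => itg 0 (2 * pi) (dsGs u)).
  by apply: itg_ge0 => u /andP[u0 _]; exact: mean_dsGs.
rewrite -(itg_swap (f := fun z => dsGs z.2 z.1)); last first.
  exact: (cont_swap cdsGs).
rewrite (eq_itg (g := fun t => s * Gs s t)); last first.
  move=> t _; rewrite /= (itg_ftc (ltW s0) (dsG t)) ?mul0r ?subr0//.
  exact: (continuous_sectionl (y := t) cdsGs).
by rewrite itgZl// pmulr_rge0.
Qed.

(** The circle mean grows with the radius, its radial derivative being the mean of [Gs], and it
    equals the central value at radius 0. *)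
Lemma L_circle_mean r : 0 <= r ->
  2 * pi * L e x y <= itg 0 (2 * pi) (fun t => L e (x + r * cos t) (y + r * sin t)).
Proof.
move=> r0.
have : 0 <= itg 0 r (fun u => itg 0 (2 * pi) (Gs u)).
  by apply: itg_ge0 => u /andP[u0 _]; exact: mean_Gs.
rewrite -(itg_swap (f := fun z => Gs z.2 z.1)); last first.
  exact: (cont_swap cGs).
rewrite (eq_itg (g := fun t => G r t - L e x y)); last first.
  move=> t _; rewrite /= (itg_ftc r0 (dG t)); last exact: (continuous_sectionl (y := t) cGs).
  by rewrite [G 0 t](_ : _ = L e x y)// /G /X /Y !mul0r !addr0.
rewrite itgB; last 2 first.
- exact: cont_L e0 (der_cont (dX_t r)) (der_cont (dY_t r)).
- by cont.
by rewrite itg_cst// subr0 subr_ge0 mulrC.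
Qed.

End Polar.
End Kernel.

(** * Mass and means of the regularised kernel over a period *)

Section KernelIntegrals.
Context {R : realType}.
Implicit Types (e x y a c d xi eta T : R).

Lemma itg_periodic_zero e xi a y : 0 < e ->
  itg a (a + 1) (fun x => Lxx e (x - xi) y) = 0.
Proof.
move=> e0; rewrite (itg_ftc _ (der_Lx_x xi y e0)) ?lerDl//; last by apply: cont_Lxx => //; cont.
have -> : a + 1 - xi = a - xi + 1 by ring.
by rewrite /Lx /H sin_per cos_per subrr.
Qed.

(** Divergence theorem on a cell one period wide: the vertical sides cancel by periodicity and only
    the horizontal ones contribute. *)
Lemma flux e xi eta a c d : 0 < e -> c <= d ->
  itg a (a + 1) (fun x => itg c d (fun y => P e (x - xi) (y - eta))) =
  itg a (a + 1) (fun x => Ly e (x - xi) (d - eta)) -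
  itg a (a + 1) (fun x => Ly e (x - xi) (c - eta)).
Proof.
move=> e0 cd.
have cxx : continuous (fun z : R * R => Lxx e (z.1 - xi) (z.2 - eta)).
  by apply: cont_Lxx => //; cont.
have cyy : continuous (fun z : R * R => Lyy e (z.1 - xi) (z.2 - eta)).
  by apply: cont_Lyy => //; cont.
transitivity (itg a (a + 1) (fun x => itg c d (fun y => Lxx e (x - xi) (y - eta)) +
    itg c d (fun y => Lyy e (x - xi) (y - eta)))).
  apply: eq_itg => x _; rewrite -itgD.
  - by apply: eq_itg => y _; rewrite laplacian_L.
  - exact: (continuous_sectionr (x := x) cxx).
  - exact: (continuous_sectionr (x := x) cyy).
rewrite itgD; last 2 first.
- exact: (continuous_itg_param2 cd cxx).
- exact: (continuous_itg_param2 cd cyy).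
rewrite (itg_swap (f := fun z => Lxx e (z.1 - xi) (z.2 - eta)))//=.
under [X in X + _]eq_itg do rewrite itg_periodic_zero//.
rewrite itg0 add0r -itgB; last 2 first.
- by apply: cont_Ly => //; cont.
- by apply: cont_Ly => //; cont.
apply: eq_itg => x _; rewrite (itg_ftc cd (der_Ly_y eta (x - xi) e0))//.
by apply: cont_Lyy => //; cont.
Qed.

Lemma pi_ge2' : 2 <= pi :> R.
Proof. exact: pi_ge2. Qed.

Lemma ch_ge_lin T : 1 <= T -> pi * T <= ch (2 * pi * T).
Proof.
move=> T1; have := @ch_ge_quad R (2 * pi * T); have := pi_ge2'.
have : 0 <= pi * T by rewrite mulr_ge0 ?pi_ge0//; lra.
by move=> h1 h2 h3; have := h3 _; rewrite -mulrA => h; apply: le_trans (h _) ; lra.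
Qed.

Lemma LyN e x y : Ly e x (- y) = - Ly e x y.
Proof. by rewrite /Ly /H mulrN shN chN mulrN mulNr. Qed.

(** The numerator of the difference is pi times [sh - ch + cos - e], at most 3 in absolute value,
    while [H] is at least [pi * T / 2]; hence the 6. *)
Lemma Ly_asymp e x T : 0 < e -> e <= 1 -> 1 <= T -> `|Ly e x T - pi| <= 6 / T.
Proof.
move=> e0 e1 T1; have h0 := H_gt0 x T e0; have p2 := pi_ge2'.
have chT := ch_ge_lin T1.
have pT : 2 <= pi * T by nra.
have shch : `|sh (2 * pi * T) - ch (2 * pi * T)| <= 1.
  have -> : sh (2 * pi * T) - ch (2 * pi * T) = - expR (- (2 * pi * T)).
    by rewrite /sh /ch; field.
  have : 0 < expR (- (2 * pi * T)) by exact: expR_gt0.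
  have : expR (- (2 * pi * T)) <= 1 by rewrite -[leRHS]expR0 ler_expR; nra.
  by move=> *; rewrite ler_norml; apply/andP; split; lra.
have -> : Ly e x T - pi = pi * (sh (2 * pi * T) - ch (2 * pi * T) + cos (2 * pi * x) - e) / H e x T.
  by move: h0; rewrite /Ly /H => h0; field; exact: lt0r_neq0.
rewrite normrM normfV (gtr0_norm h0) ler_pdivrMr// normrM ger0_norm ?pi_ge0//.
have c1 := cos_le1 (2 * pi * x); have c2 := cos_geN1 (2 * pi * x).
have n3 : `|sh (2 * pi * T) - ch (2 * pi * T) + cos (2 * pi * x) - e| <= 3.
  by move: shch; rewrite !ler_norml => /andP[? ?]; apply/andP; split; lra.
have H2 : pi * T / 2 <= H e x T by rewrite /H; lra.
have T0 : 0 < T by lra.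
apply: (@le_trans _ _ (pi * 3)); first by rewrite ler_wpM2l// pi_ge0.
have -> : pi * 3 = 6 / T * (pi * T / 2) by field; lra.
by rewrite ler_wpM2l// divr_ge0// ltW.
Qed.

Lemma Ly_mean_asymp e xi a T : 0 < e -> e <= 1 -> 1 <= T ->
  `|itg a (a + 1) (fun x => Ly e (x - xi) T) - pi| <= 6 / T.
Proof.
move=> e0 e1 T1.
have cL : continuous (fun x => Ly e (x - xi) T) by apply: cont_Ly => //; cont.
have -> : itg a (a + 1) (fun x => Ly e (x - xi) T) - pi =
    itg a (a + 1) (fun x => Ly e (x - xi) T - pi).
  by rewrite itgB//; [rewrite itg_cst ?lerDl//; congr (_ - _); ring|cont].
apply: le_trans (itg_bound (C := 6 / T) _ _ _) _; rewrite ?lerDl//.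
- by cont.
- by move=> x _; exact: Ly_asymp.
- by rewrite le_eqVlt; apply/orP; left; apply/eqP; ring.
Qed.

(** [Ly] is odd in y, so the fluxes through top and bottom add up to about 2 pi. The error does not
    depend on [e], which lets [T] be chosen before [e] later on. *)
Lemma cell_mass e xi eta a T : 0 < e -> e <= 1 -> 1 <= T ->
  `|itg a (a + 1) (fun x => itg (eta - T) (eta + T) (fun y => P e (x - xi) (y - eta)))
    - 2 * pi| <= 12 / T.
Proof.
move=> e0 e1 T1; rewrite flux//; last lra.
have -> : eta + T - eta = T by ring.
have -> : eta - T - eta = - T by ring.
under [X in _ - X - _]eq_itg do rewrite LyN -mulN1r.
rewrite (itgZl (f := fun x => Ly e (x - xi) T) (-1)); last by apply: cont_Ly => //; cont.
have := Ly_mean_asymp xi a e0 e1 T1; rewrite !ler_norml => /andP[h1 h2].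
have -> : 12 / T = 2 * (6 / T) by ring.
by apply/andP; split; lra.
Qed.

(** At height 1 above the pole [H >= 1], so the mean of [L] is nonnegative. Between heights 0 and 1
    its derivative is the mean of [Ly], which increases with the height because [P >= 0], hence is
    at most its value at height 1, that is at most pi + 6. *)
Lemma L_mean_lower e xi a : 0 < e -> e <= 1 ->
  - (pi + 6) <= itg a (a + 1) (fun x => L e (x - xi) 0).
Proof.
move=> e0 e1.
have cLy : continuous (fun z : R * R => Ly e (z.1 - xi) (z.2 - 0)).
  by apply: cont_Ly => //; cont.
have J1 y : 0 <= y <= 1 -> itg a (a + 1) (fun x => Ly e (x - xi) (y - 0)) <= pi + 6.
  move=> /andP[y0 y1].
  have := Ly_mean_asymp xi a e0 e1 (lexx 1); rewrite ler_norml => /andP[_ h].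
  have := flux xi 0 a e0 y1.
  have : 0 <= itg a (a + 1) (fun x => itg y 1 (fun y => P e (x - xi) (y - 0))).
    by apply: itg_ge0 => x _; apply: itg_ge0 => t _; exact: P_ge0.
  rewrite [1 - 0]subr0 => + E; rewrite E subr_ge0 => /le_trans; apply.
  by rewrite -lerBlDl (le_trans h)// divr1.
have : itg 0 1 (fun y => itg a (a + 1) (fun x => Ly e (x - xi) (y - 0))) <= pi + 6.
  apply: le_trans (_ : itg 0 1 (fun=> pi + 6) <= _); last by rewrite itg_cst//; lra.
  apply: le_itg => //; last by cont.
  by apply: (continuous_itg_param (f := fun z => Ly e (z.1 - xi) (z.2 - 0))) => //; rewrite lerDl.
rewrite -(itg_swap (f := fun z => Ly e (z.1 - xi) (z.2 - 0)))//=.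
under eq_itg => x _.
  rewrite (itg_ftc ler01 (der_L_y 0 (x - xi) e0)); last by apply: cont_Ly => //; cont.
  rewrite !subr0; over.
rewrite itgB; [|by apply: cont_L => //; cont..].
have : 0 <= itg a (a + 1) (fun x => L e (x - xi) 1).
  apply: itg_ge0 => x _; rewrite /L divr_ge0// ln_ge0//.
  have := ch_ge_lin (lexx 1); have := pi_ge2'; have := cos_le1 (2 * pi * (x - xi)).
  by rewrite /H; lra.
by move=> hA hB; rewrite lerNl; apply: le_trans hB; rewrite lerDr.
Qed.

(** The quotient [(u - v + 1) / (u - v + e)] decreases in [u = ch (2 pi y)], whose least value is
    taken at y = 0. *)
Lemma L_diff_le e x y : 0 < e -> e <= 1 -> L 1 x y - L e x y <= L 1 x 0 - L e x 0.
Proof.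
move=> e0 e1; rewrite /L -!mulrBl ler_pM2r// -!ln_div ?posrE ?H_gt0//.
rewrite ler_ln ?posrE ?divr_gt0 ?H_gt0// ler_pdivrMr ?H_gt0// mulrAC ler_pdivlMr ?H_gt0//.
rewrite /H mulr0 (_ : ch 0 = 1); last by rewrite /ch oppr0 expR0; lra.
have := ch_ge1 (2 * pi * y); move: (ch _) (cos _) => u v u1; nra.
Qed.

(** Bound uniform in [e], the pole and the height, the source of the local integrability of the
    limit potential. To the pi + 6 of [L_mean_lower] it adds 1, a bound for [ln 3 / 2]. *)
Lemma L_diff_mean e xi eta a y : 0 < e -> e <= 1 ->
  itg a (a + 1) (fun x => L 1 (x - xi) (y - eta) - L e (x - xi) (y - eta)) <= pi + 7.
Proof.
move=> e0 e1.
apply: le_trans (_ : itg a (a + 1) (fun x => L 1 (x - xi) 0 - L e (x - xi) 0) <= _).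
  apply: le_itg.
  - by apply: cont_add; [|apply: cont_opp]; apply: cont_L => //; cont.
  - by apply: cont_add; [|apply: cont_opp]; apply: cont_L => //; cont.
  - by move=> x _; exact: L_diff_le.
rewrite itgB; [|by apply: cont_L => //; cont..].
have := L_mean_lower xi a e0 e1.
have : itg a (a + 1) (fun x => L 1 (x - xi) 0) <= 1; last lra.
apply: le_trans (_ : itg a (a + 1) (fun=> 1) <= _); last by rewrite itg_cst ?lerDl//; lra.
apply: le_itg; [by apply: cont_L => //; cont|by cont|].
move=> x _; rewrite /L ler_pdivrMr// mul1r.
apply: le_trans (_ : ln 3 <= _).
  rewrite ler_ln ?posrE ?H_gt0// /H mulr0 (_ : ch 0 = 1); last by rewrite /ch oppr0 expR0; lra.
  by have := cos_geN1 (2 * pi * (x - xi)); lra.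
rewrite -[leRHS]expRK ler_ln ?posrE ?expR_gt0//.
by have := expR_ge1Dx (2 : R); lra.
Qed.

(** From [ch u = 1 + 2 sh (u / 2) ^+ 2] and [sh (u / 2) >= u / 4] for [u >= 0]. A bound on [ch - 1]
    that is positive off 0 is what keeps [H] away from 0 at heights different from that of the
    pole. *)
Lemma ch_ge_sqr u : 1 + u ^+ 2 / 8 <= ch u :> R.
Proof.
wlog u0 : u / 0 <= u.
  move=> h; case: (leP 0 u) => [/h//|/ltW u0].
  by have := h (- u); rewrite chN sqrrN; apply; rewrite oppr_ge0.
have E : ch u = 1 + 2 * sh (u / 2) ^+ 2.
  rewrite /ch /sh.
  have -> : expR u = expR (u / 2) ^+ 2 by rewrite expr2 -expRD -splitr.
  have -> : expR (- u) = expR (- (u / 2)) ^+ 2 by rewrite expr2 -expRD -opprD -splitr.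
  have := expRxMexpNx_1 (u / 2); move: (expR _) (expR _) => p q pq.
  transitivity ((p ^+ 2 + q ^+ 2) / 2 + (1 - p * q)); last by field.
  by rewrite (mulrC p q) pq subrr addr0 addrC.
have h : u / 4 <= sh (u / 2).
  have := expR_ge1Dx (u / 2).
  have : expR (- (u / 2)) <= 1 by rewrite -[leRHS]expR0 ler_expR; lra.
  by rewrite /sh; lra.
have : (u / 4) ^+ 2 <= sh (u / 2) ^+ 2 by rewrite ler_sqr ?nnegrE//; lra.
rewrite E; lra.
Qed.

(** Within half a period horizontally the only pole is the origin. Away from it [H] is at least [k],
    through [1 - cos] if [u] is far from 0 and through [ch - 1] if [v] is, and the numerator of [P]
    carries the factor [e]. *)
Lemma P_off_small (delta T : R) : 0 < delta -> delta <= 1 / 2 ->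
  exists2 K, 0 <= K & forall e u v, 0 < e -> `|u| <= 1 / 2 -> `|v| <= T ->
    (delta <= `|u|) || (delta <= `|v|) -> P e u v <= K * e.
Proof.
move=> d0 d2; have p0 : 0 < pi :> R by exact: pi_gt0.
pose k := Num.min ((2 * pi * delta) ^+ 2 / 8) (1 - cos (2 * pi * delta)).
have cosd u : delta <= `|u| -> `|u| <= 1 / 2 -> cos (2 * pi * u) <= cos (2 * pi * delta).
  move=> du u2.
  have -> : cos (2 * pi * u) = cos (2 * pi * `|u|).
    by case: (ler0P u) => _ //; rewrite mulrN cosN.
  by rewrite leNgt (ltr_cos _) -?leNgt ?ler_pM2l// ?in_itv/=; try (apply/andP; split); nra.
have p20 : 0 < 2 * pi :> R by rewrite mulr_gt0.
have pd0 : 0 < 2 * pi * delta by rewrite !mulr_gt0.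
have pd : 2 * pi * delta <= pi by have := ler_wpM2l (ltW p0) d2; lra.
have cosd1 : cos (2 * pi * delta) < 1.
  by rewrite -[ltRHS]cos0 ltr_cos ?in_itv//= ?lexx ?(ltW p0) ?(ltW pd0).
have k0 : 0 < k.
  by rewrite lt_min subr_gt0 cosd1 andbT divr_gt0// exprn_gt0// !mulr_gt0.
exists (4 * pi ^+ 2 * expR (2 * pi * T) / k ^+ 2).
  by rewrite divr_ge0 ?sqr_ge0// mulr_ge0 ?expR_ge0// mulr_ge0// sqr_ge0.
move=> e u v e0 u2 vT uv.
have kH : k <= H e u v.
  have c1 := ch_ge1 (2 * pi * v); have c2 := cos_le1 (2 * pi * u).
  rewrite /H; case/orP: uv => h.
    apply: (@le_trans _ _ (1 - cos (2 * pi * delta))); first by rewrite ge_min lexx orbT.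
    by have := cosd _ h u2; lra.
  apply: (@le_trans _ _ ((2 * pi * delta) ^+ 2 / 8)); first by rewrite ge_min lexx.
  have := ch_ge_sqr (2 * pi * v).
  have : (2 * pi * delta) ^+ 2 <= (2 * pi * v) ^+ 2; last lra.
  rewrite -[leRHS]real_normK ?num_real// ler_sqr ?nnegrE ?(ltW pd0)//.
  by rewrite normrM (gtr0_norm p20) ler_pM2l.
have cT : ch (2 * pi * v) + cos (2 * pi * u) <= 2 * expR (2 * pi * T).
  have : ch (2 * pi * v) <= expR (2 * pi * T).
    apply: le_trans (ch_le_expR _) _; by rewrite ler_expR normrM (gtr0_norm p20) ler_pM2l.
  have := ch_ge1 (2 * pi * v); have := cos_le1 (2 * pi * u); lra.
rewrite /P.
have c0 : 0 <= ch (2 * pi * v) + cos (2 * pi * u).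
  by have := ch_ge1 (2 * pi * v); have := cos_geN1 (2 * pi * u); lra.
have -> : 4 * pi ^+ 2 * expR (2 * pi * T) / k ^+ 2 * e =
  2 * pi ^+ 2 * e * (2 * expR (2 * pi * T)) / k ^+ 2 by ring.
have A0 : 0 <= 2 * pi ^+ 2 * e by rewrite mulr_ge0 ?(ltW e0)// mulr_ge0// sqr_ge0.
apply: ler_pM; first by rewrite mulr_ge0.
- by rewrite invr_ge0 sqr_ge0.
- by rewrite ler_wpM2l.
- by rewrite lef_pV2 ?posrE ?exprn_gt0// ?H_gt0// ler_sqr ?nnegrE// ltW// H_gt0.
Qed.

End KernelIntegrals.

Section DoubleIntegrals.
Context {R : realType}.
Implicit Types (f g : R * R -> R) (a b c d : R).

Definition itg2 a b c d f : R := itg a b (fun x => itg c d (fun y => f (x, y))).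

Lemma eq_itg2 g f a b c d : (forall x y, a <= x <= b -> c <= y <= d -> f (x, y) = g (x, y)) ->
  itg2 a b c d f = itg2 a b c d g.
Proof. by move=> fg; apply: eq_itg => x xab; apply: eq_itg => y; exact: fg. Qed.

Lemma itg2D f g a b c d : c <= d -> continuous f -> continuous g ->
  itg2 a b c d (fun z => f z + g z) = itg2 a b c d f + itg2 a b c d g.
Proof.
move=> cd cf cg; rewrite /itg2 -itgD; try exact: continuous_itg_param2.
by apply: eq_itg => x _; rewrite -itgD//; exact: continuous_sectionr.
Qed.

Lemma itg2Zl f k a b c d : c <= d -> continuous f ->
  itg2 a b c d (fun z => k * f z) = k * itg2 a b c d f.
Proof.
move=> cd cf; rewrite /itg2 -itgZl; last exact: continuous_itg_param2.
by apply: eq_itg => x _; rewrite -itgZl//; exact: continuous_sectionr.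
Qed.

Lemma itg2B f g a b c d : c <= d -> continuous f -> continuous g ->
  itg2 a b c d (fun z => f z - g z) = itg2 a b c d f - itg2 a b c d g.
Proof.
move=> cd cf cg; rewrite /itg2 -itgB; try exact: continuous_itg_param2.
by apply: eq_itg => x _; rewrite -itgB//; exact: continuous_sectionr.
Qed.

Lemma itg2_cst k a b c d : a <= b -> c <= d ->
  itg2 a b c d (fun=> k) = k * (b - a) * (d - c).
Proof.
move=> ab cd; rewrite /itg2; under eq_itg do rewrite itg_cst//.
by rewrite itg_cst//; ring.
Qed.

Lemma le_itg2 f g a b c d : c <= d -> continuous f -> continuous g ->
  (forall x y, a <= x <= b -> c <= y <= d -> f (x, y) <= g (x, y)) ->
  itg2 a b c d f <= itg2 a b c d g.
Proof.
move=> cd cf cg fg; apply: le_itg; try exact: continuous_itg_param2.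
by move=> x xab; apply: le_itg; [exact: continuous_sectionr..|move=> y; exact: fg].
Qed.

Lemma norm_itg2_le f g a b c d : c <= d -> continuous f -> continuous g ->
  (forall x y, a <= x <= b -> c <= y <= d -> `|f (x, y)| <= g (x, y)) ->
  `|itg2 a b c d f| <= itg2 a b c d g.
Proof.
move=> cd cf cg fg; rewrite ler_norml; apply/andP; split; last first.
  by apply: le_itg2 => // x y xab ycd; apply: le_trans (ler_norm _) (fg _ _ _ _).
rewrite lerNl -mulN1r -itg2Zl//; apply: le_itg2 => //; first by cont.
move=> x y xab ycd; rewrite mulN1r.
by apply: le_trans (fg _ _ xab ycd); rewrite -normrN ler_norm.
Qed.

Lemma itg_split_sum (f : R -> R) a n : continuous f ->
  itg a (a + n%:R) f = \sum_(k < n) itg (a + k%:R) (a + k%:R + 1) f.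
Proof.
move=> cf; elim: n => [|n IH].
  by rewrite big_ord0 addr0 /itg set_itv1 Rintegral_set1.
rewrite big_ord_recr /= -IH (itg_split (b := a + n%:R))//.
- by rewrite -addrA -natr1.
- by rewrite lerDl ler0n.
- by rewrite lerD2l ler_nat.
Qed.

End DoubleIntegrals.

(** * Test functions and Green's identity *)

Section TestFunctions.
Context {R : realType}.
Implicit Types (phi : R * R -> R).

Lemma der_vanish (f f' : R -> R) A : der f f' -> (forall x, A < `|x| -> f x = 0) ->
  forall x, A < `|x| -> f' x = 0.
Proof.
move=> df f0 x Ax.
have h : is_derive x 1 (cst 0 : R -> R) (f' x).
  apply: near_eq_is_derive (df x).
  have : \forall t \near x, A < `|t|.
    have : (fun t : R => `|t|) @ x --> `|x| by apply: cvg_norm; exact: cvg_id.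
    by move/(@cvgr_gt _ _ _ _ _ _); apply.
  by apply: filterS => t At; rewrite /= f0.
by rewrite -(derive_val (is_derive := h)) derive_cst.
Qed.

(** Links the directional derivative in the plane to the ordinary derivative of a section, so that
    one-variable calculus applies to [d_x]. *)
Lemma diff_quotient_x phi x y :
  (fun h : R => h^-1 *: (((fun x => phi (x, y)) \o shift x) (h *: 1) - phi (x, y))) =
  (fun h : R => h^-1 *: ((phi \o shift (x, y)) (h *: (1, 0) : R * R) - phi (x, y))).
Proof.
apply/funext => h; congr (_ *: (phi _ - _)).
by congr pair => //=; rewrite scaler0 add0r.
Qed.

Lemma diff_quotient_y phi x y :
  (fun h : R => h^-1 *: (((fun y => phi (x, y)) \o shift y) (h *: 1) - phi (x, y))) =
  (fun h : R => h^-1 *: ((phi \o shift (x, y)) (h *: (0, 1) : R * R) - phi (x, y))).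
Proof.
apply/funext => h; congr (_ *: (phi _ - _)).
by congr pair => //=; rewrite scaler0 add0r.
Qed.

Lemma der_dx phi y : (forall z, derivable phi z (1, 0)) ->
  der (fun x => phi (x, y)) (fun x => d_x phi (x, y)).
Proof.
move=> dphi x.
by split; [rewrite /derivable diff_quotient_x; exact: dphi|rewrite /derive diff_quotient_x].
Qed.

Lemma der_dy phi x : (forall z, derivable phi z (0, 1)) ->
  der (fun y => phi (x, y)) (fun y => d_y phi (x, y)).
Proof.
move=> dphi y.
by split; [rewrite /derivable diff_quotient_y; exact: dphi|rewrite /derive diff_quotient_y].
Qed.

(** The data consumed by Green's identity. The partial derivatives are explicit functions, so that
    the kernel enters with its closed formulas and a test function with [d_x] and [d_y]. *)
Record C2 phi (phix phiy phixx phiyy : R * R -> R) : Prop := MkC2 {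
  C2_der_x : forall y, der (fun x => phi (x, y)) (fun x => phix (x, y));
  C2_der_y : forall x, der (fun y => phi (x, y)) (fun y => phiy (x, y));
  C2_der_xx : forall y, der (fun x => phix (x, y)) (fun x => phixx (x, y));
  C2_der_yy : forall x, der (fun y => phiy (x, y)) (fun y => phiyy (x, y));
  C2_cont : continuous phi;
  C2_cont_x : continuous phix;
  C2_cont_y : continuous phiy;
  C2_cont_xx : continuous phixx;
  C2_cont_yy : continuous phiyy }.

Lemma test_function_C2 phi : test_function phi ->
  C2 phi (d_x phi) (d_y phi) (d_x (d_x phi)) (d_y (d_y phi)).
Proof.
move=> [Cphi _]; have c0 := Cphi 0%N.
have [dx dy [dxx _ cxx _] [_ dyy _ cyy]] := Cphi 2%N.
have [_ _ cx cy] := Cphi 1%N.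
split.
- by move=> y; exact: der_dx.
- by move=> x; exact: der_dy.
- by move=> y; exact: der_dx.
- by move=> x; exact: der_dy.
- exact: c0.
- exact: cx.
- exact: cy.
- exact: cxx.
- exact: cyy.
Qed.

Lemma test_function_support phi : test_function phi ->
  exists2 A, 0 < A & forall z, (A < `|z.1|) || (A < `|z.2|) ->
    [/\ phi z = 0, d_x phi z = 0, d_y phi z = 0, d_x (d_x phi) z = 0 & d_y (d_y phi) z = 0].
Proof.
move=> tphi; have [dx dy dxx dyy _ _ _ _ _] := test_function_C2 tphi.
case: tphi => _ /compact_bounded[M [_ MK]].
pose A := Num.max M 0 + 1.
have p0 z : (A < `|z.1|) || (A < `|z.2|) -> phi z = 0.
  move=> zA; apply/eqP; apply: contraPT isT => pz.
  have := MK A _ z (@subset_closure _ [set z | phi z != 0] z pz).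
  rewrite /A ltr_pwDr ?le_max ?lexx// => /(_ isT); rewrite /= prod_normE ge_max.
  by move=> /andP[h1 h2]; case/orP: zA; rewrite ltNge ?h1 ?h2.
exists A; first by rewrite /A ltr_pwDr// le_max lexx orbT.
move=> [x y] /=.
have hx y' : (forall x, A < `|x| -> d_x phi (x, y') = 0).
  by apply: der_vanish (dx y') _ => t At; rewrite p0//= At.
have hy x' : (forall y, A < `|y| -> d_y phi (x', y) = 0).
  by apply: der_vanish (dy x') _ => t At; rewrite p0//= At orbT.
have hx' x' y' : A < `|y'| -> d_x phi (x', y') = 0.
  (* With [A := -1] the condition on [|x|] always holds: the section is zero on the whole line,
     hence so is its derivative. *)
  move=> Ay; apply: (der_vanish (A := -1) (dx y')); last by rewrite (lt_le_trans _ (normr_ge0 _)).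
  by move=> t _; rewrite p0//= Ay orbT.
have hy' x' y' : A < `|x'| -> d_y phi (x', y') = 0.
  move=> Ay; apply: (der_vanish (A := -1) (dy x')); last by rewrite (lt_le_trans _ (normr_ge0 _)).
  by move=> t _; rewrite p0//= Ay.
have N1 (t : R) : -1 < `|t| by rewrite (lt_le_trans _ (normr_ge0 _)).
move=> xy; case/orP: (xy) => h; split.
- exact: p0.
- exact: hx.
- exact: hy'.
- by apply: (der_vanish (A := A) (dxx y)) => // t At; exact: hx.
- by apply: (der_vanish (A := -1) (dyy x)) => // t _; exact: hy'.
- exact: p0.
- exact: hx'.
- exact: hy.
- by apply: (der_vanish (A := -1) (dxx y)) => // t _; exact: hx'.
- by apply: (der_vanish (A := A) (dyy x)) => // t At; exact: hy.
Qed.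

(** The difference of the integrands is the derivative of the Wronskian [f * g1 - f1 * g], which
    vanishes at both ends. *)
Lemma green_1d (f f1 f2 g g1 g2 : R -> R) a b : a <= b ->
  der f f1 -> der f1 f2 -> der g g1 -> der g1 g2 -> continuous f2 -> continuous g2 ->
  g a = 0 -> g b = 0 -> g1 a = 0 -> g1 b = 0 ->
  itg a b (fun x => f x * g2 x) = itg a b (fun x => f2 x * g x).
Proof.
move=> ab df df1 dg dg1 cf2 cg2 ga gb g1a g1b.
have cf := der_cont df; have cg := der_cont dg.
apply/eqP; rewrite -subr_eq0 -itgB; [|by cont..].
have dF : der (fun x => f x * g1 x - f1 x * g x) (fun x => f x * g2 x - f2 x * g x).
  apply: der_eq; first exact: der_add (der_mul df dg1) (der_opp (der_mul df1 dg)).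
  by move=> x /=; ring.
rewrite (itg_ftc ab dF); last by cont.
by rewrite ga gb g1a g1b !mulr0 subrr.
Qed.

Lemma green_2d A f fx fy fxx fyy g gx gy gxx gyy : 0 <= A ->
  C2 f fx fy fxx fyy -> C2 g gx gy gxx gyy ->
  (forall z, (`|z.1| = A) \/ (`|z.2| = A) -> [/\ g z = 0, gx z = 0 & gy z = 0]) ->
  itg2 (- A) A (- A) A (fun z => f z * (gxx z + gyy z)) =
  itg2 (- A) A (- A) A (fun z => (fxx z + fyy z) * g z).
Proof.
move=> A0 [fdx fdy fdxx fdyy fc fcx fcy fcxx fcyy] [gdx gdy gdxx gdyy gc gcx gcy gcxx gcyy] g0.
have AA : - A <= A by lra.
have nA : `|A| = A by exact: ger0_norm.
have nNA : `|- A| = A by rewrite normrN.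
transitivity (itg2 (- A) A (- A) A (fun z => f z * gxx z + f z * gyy z)).
  by apply: eq_itg2 => x y _ _; rewrite mulrDr.
transitivity (itg2 (- A) A (- A) A (fun z => fxx z * g z + fyy z * g z)); last first.
  by apply: eq_itg2 => x y _ _; rewrite mulrDl.
have c1 : continuous (fun z => f z * gxx z) by cont.
have c2 : continuous (fun z => f z * gyy z) by cont.
have c3 : continuous (fun z => fxx z * g z) by cont.
have c4 : continuous (fun z => fyy z * g z) by cont.
rewrite (itg2D _ _ AA c1 c2).
rewrite (itg2D _ _ AA c3 c4).
apply: (f_equal2 +%R); last first.
  apply: eq_itg => x _; apply: (green_1d AA (fdy x) (fdyy x) (gdy x) (gdyy x)).
  - exact: continuous_sectionr.
  - exact: continuous_sectionr.
  - by case: (g0 (x, - A)) => //=; right.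
  - by case: (g0 (x, A)) => //=; right.
  - by case: (g0 (x, - A)) => //=; right.
  - by case: (g0 (x, A)) => //=; right.
rewrite /itg2 (itg_swap _ _ _ _ c1).
rewrite (itg_swap _ _ _ _ c3).
apply: eq_itg => y _; apply: (green_1d AA (fdx y) (fdxx y) (gdx y) (gdxx y)).
- exact: continuous_sectionl.
- exact: continuous_sectionl.
- by case: (g0 (- A, y)) => //=; left.
- by case: (g0 (A, y)) => //=; left.
- by case: (g0 (- A, y)) => //=; left.
- by case: (g0 (A, y)) => //=; left.
Qed.

End TestFunctions.

(** * The laplacian of the kernel as an approximate point mass *)

Section Cells.
Context {R : realType}.
Implicit Types (phi : R * R -> R) (e xi eta T : R).

(** The window is one period wide and centred at the pole [(xi, eta)]; its right end is written as
    left end plus 1 to fit [flux] and [cell_mass]. *)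
Definition cell e T phi xi eta : R :=
  itg2 (xi - 1 / 2) (xi - 1 / 2 + 1) (eta - T) (eta + T)
    (fun z => P e (z.1 - xi) (z.2 - eta) * phi z).

Lemma cont_P_shift e xi eta : 0 < e ->
  continuous (fun z : R * R => P e (z.1 - xi) (z.2 - eta)).
Proof. by move=> e0; apply: cont_P => //; cont. Qed.

Lemma itg2_P_mass e xi eta a T : 0 < e -> e <= 1 -> 1 <= T ->
  `|itg2 a (a + 1) (eta - T) (eta + T) (fun z => P e (z.1 - xi) (z.2 - eta)) - 2 * pi| <= 12 / T.
Proof. exact: cell_mass. Qed.

Lemma itg2_P_le e xi eta a T : 0 < e -> e <= 1 -> 1 <= T ->
  itg2 a (a + 1) (eta - T) (eta + T) (fun z => P e (z.1 - xi) (z.2 - eta)) <= 2 * pi + 12.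
Proof.
move=> e0 e1 T1; have := itg2_P_mass xi eta a e0 e1 T1; rewrite ler_norml => /andP[_].
have : 12 / T <= 12 by rewrite ler_pdivrMr; lra.
move: (itg2 _ _ _ _ _) (12 / T) => u v; lra.
Qed.

Lemma cell_bound e T phi xi eta (B : R) : 0 < e -> e <= 1 -> 1 <= T -> continuous phi ->
  (forall z, `|phi z| <= B) -> `|cell e T phi xi eta| <= B * (2 * pi + 12).
Proof.
move=> e0 e1 T1 cphi phiB; have cP := cont_P_shift (xi := xi) (eta := eta) e0.
have B0 : 0 <= B by exact: le_trans (normr_ge0 _) (phiB (0, 0)).
apply: (@le_trans _ _ (B * itg2 (xi - 1 / 2) (xi - 1 / 2 + 1) (eta - T) (eta + T)
    (fun z => P e (z.1 - xi) (z.2 - eta)))); last first.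
  by rewrite ler_wpM2l// itg2_P_le.
rewrite -itg2Zl//; last lra.
apply: norm_itg2_le; [lra|by cont|by cont|].
move=> x y _ _; rewrite normrM (ger0_norm (P_ge0 _ _ e0)) mulrC.
by rewrite ler_wpM2r// P_ge0.
Qed.

(** Approximate identity with three errors of eps / 3. The mass defect is small for large [T]. Near
    the pole [phi] is almost constant. Elsewhere [P] is at most [K * e], where [K] depends on [T];
    so [e0] can only be chosen after [T]. *)
Lemma cell_limit phi xi eta (B eps : R) : continuous phi -> (forall z, `|phi z| <= B) -> 0 < eps ->
  exists2 T0, 1 <= T0 & forall T, T0 <= T -> exists2 e0, 0 < e0 &
    forall e, 0 < e -> e <= e0 -> e <= 1 ->
      `|cell e T phi xi eta - 2 * pi * phi (xi, eta)| <= eps.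
Proof.
move=> cphi phiB eps0.
have B0 : 0 <= B by exact: le_trans (normr_ge0 _) (phiB (0, 0)).
have p0 : 0 < pi :> R by exact: pi_gt0.
(* 2 pi + 12 bounds the mass of a cell, so an oscillation [eps1] of [phi] costs at most eps / 3. *)
pose eps1 := eps / (3 * (2 * pi + 12)).
have e10 : 0 < eps1 by rewrite divr_gt0// mulr_gt0//; lra.
(* Makes the mass defect 12 / T, multiplied by the bound [B] of [phi], at most eps / 3. *)
exists (1 + 36 * B / eps).
  by rewrite lerDl divr_ge0 ?mulr_ge0// ltW.
move=> T T0.
have T1 : 1 <= T by apply: le_trans T0; rewrite lerDl divr_ge0 ?mulr_ge0// ltW.
have TB : B * (12 / T) <= eps / 3.
  have h : 36 * B / eps <= T by apply: le_trans T0; rewrite lerDr.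
  rewrite mulrA ler_pdivrMr; last lra.
  by move: h; rewrite ler_pdivrMr// => h; lra.
have [d /andP[d0 d2] phid] : exists2 d, 0 < d <= 1 / 2 & forall x y, `|x - xi| < d ->
    `|y - eta| < d -> `|phi (x, y) - phi (xi, eta)| <= eps1.
  have /cvgrPdist_le/(_ _ e10) := cphi (xi, eta).
  move=> /nbhs_ballP[d /= d0 h]; exists (Num.min d (1 / 2)).
    by rewrite lt_min d0 ge_min lexx orbT/=; lra.
  move=> x y; rewrite !lt_min => /andP[xd _] /andP[yd _].
  by rewrite distrC; apply: h; split; rewrite /ball/= distrC.
have [K K0 PK] := P_off_small T d0 d2.
(* Off the pole the integrand is at most [2 * B * K * e] and the cell has area [2 * T]; the added 1
   keeps the denominator positive. *)
pose e0 := eps / (3 * (4 * B * K * T + 1)).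
have D0 : 0 < 3 * (4 * B * K * T + 1).
  by rewrite mulr_gt0// ltr_wpDl// !mulr_ge0//; lra.
exists e0; first by rewrite divr_gt0.
move=> e eg0 ee0 e1.
have cP := cont_P_shift (xi := xi) (eta := eta) eg0.
have TT : eta - T <= eta + T by lra.
set a := xi - 1 / 2; pose mass := itg2 a (a + 1) (eta - T) (eta + T) (fun z => P e (z.1 - xi)
  (z.2 - eta)).
have massE : `|mass - 2 * pi| <= 12 / T by exact: itg2_P_mass.
have mass_le : mass <= 2 * pi + 12 by exact: itg2_P_le.
have -> : cell e T phi xi eta - 2 * pi * phi (xi, eta) =
  itg2 a (a + 1) (eta - T) (eta + T) (fun z => P e (z.1 - xi) (z.2 - eta) * (phi z - phi (xi, eta)))
  + phi (xi, eta) * (mass - 2 * pi).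
  rewrite mulrBr -itg2Zl// addrA [_ * (2 * pi)]mulrC; congr (_ - _).
  rewrite -itg2D.
  4: by cont. 3: by cont. 2: by [].
  by apply: eq_itg2 => x y _ _ /=; ring.
have -> : eps = eps / 3 + eps / 3 + eps / 3 by field.
apply: le_trans (ler_normD _ _) _; apply: lerD; last first.
  rewrite normrM; apply: le_trans TB; exact: ler_pM.
apply: (@le_trans _ _ (itg2 a (a + 1) (eta - T) (eta + T)
    (fun z => eps1 * P e (z.1 - xi) (z.2 - eta) + 2 * B * K * e))).
  apply: norm_itg2_le => //; [by cont|by cont|].
  move=> x y xa yT; rewrite /= normrM (ger0_norm (P_ge0 _ _ eg0)).
  have Pg := P_ge0 (x - xi) (y - eta) eg0.
  have phi2 : `|phi (x, y) - phi (xi, eta)| <= 2 * B.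
    by apply: le_trans (ler_normB _ _) _; rewrite mulrDl mul1r lerD.
  have BKe : 0 <= 2 * B * K * e by rewrite !mulr_ge0// ltW.
  case: (ltP `|x - xi| d) => hx; first case: (ltP `|y - eta| d) => hy.
  - by rewrite mulrC ler_wpDr// ler_wpM2r// phid.
  - rewrite (ler_wpDl (mulr_ge0 (ltW e10) Pg))//.
    apply: le_trans (_ : K * e * (2 * B) <= _); last by rewrite le_eqVlt; apply/orP; left;
      apply/eqP; ring.
    apply: ler_pM => //; apply: PK; rewrite ?hy ?orbT//.
    + by rewrite ler_norml; move: xa; rewrite /a => /andP[? ?]; apply/andP; split; lra.
    + by rewrite ler_norml; move: yT => /andP[? ?]; apply/andP; split; lra.
  - rewrite (ler_wpDl (mulr_ge0 (ltW e10) Pg))//.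
    apply: le_trans (_ : K * e * (2 * B) <= _); last by rewrite le_eqVlt; apply/orP; left;
      apply/eqP; ring.
    apply: ler_pM => //; apply: PK; rewrite ?hx//.
    + by rewrite ler_norml; move: xa; rewrite /a => /andP[? ?]; apply/andP; split; lra.
    + by rewrite ler_norml; move: yT => /andP[? ?]; apply/andP; split; lra.
rewrite itg2D//; [|by cont..]; rewrite itg2Zl// itg2_cst//; last by rewrite lerDl.
apply: lerD.
  apply: le_trans (_ : eps1 * (2 * pi + 12) <= _); first by rewrite ler_wpM2l// ltW.
  by rewrite /eps1 le_eqVlt; apply/orP; left; apply/eqP; field; rewrite gt_eqF//; lra.
have -> : 2 * B * K * e * (a + 1 - a) * (eta + T - (eta - T)) = 4 * B * K * T * e by ring.
have : (4 * B * K * T + 1) * e <= eps / 3.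
  move: ee0; rewrite /e0 ler_pdivlMr// => h.
  rewrite ler_pdivlMr//; apply: le_trans h.
  by rewrite le_eqVlt; apply/orP; left; apply/eqP; ring.
by apply: le_trans; rewrite [(_ + 1) * e]mulrDl mul1r lerDl ltW.
Qed.

Lemma cos_perN (x : R) n : cos (2 * pi * (x + n%:R)) = cos (2 * pi * x).
Proof. by elim: n => [|n IH]; [rewrite addr0|rewrite -(@natr1 R n) addrA cos_per]. Qed.

Lemma P_perN e (x y : R) n : P e (x + n%:R) y = P e x y.
Proof. by rewrite /P /H cos_perN. Qed.

Lemma P_perB e (x y : R) n : P e (x - n%:R) y = P e x y.
Proof. by rewrite -(P_perN e (x - n%:R) y n) subrK. Qed.

Lemma itg2_plane phi (a b c d a' b' c' d' : R) : continuous phi ->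
  a <= b -> c <= d -> a' <= b' -> c' <= d' ->
  (forall z, ~ (a <= z.1 <= b /\ c <= z.2 <= d) -> phi z = 0) ->
  (forall z, ~ (a' <= z.1 <= b' /\ c' <= z.2 <= d') -> phi z = 0) ->
  itg2 a b c d phi = itg2 a' b' c' d' phi.
Proof.
move=> cphi ab cd ab' cd' h h'; apply: EFin_inj.
exact: (etrans (esym (integral_plane_box cphi h ab cd)) (integral_plane_box cphi h' ab' cd')).
Qed.

(** [P] has a pole at each integer translate of [(xi, eta)]. The 2M + 1 adjacent cells centred at xi
    - M, ..., xi + M cover the support of [phi], and by periodicity each sees [P] as centred at its
    own pole. *)
Lemma P_cells e phi xi eta (A : R) (M : nat) T : 0 < e -> 0 <= A -> continuous phi ->
  (forall z, (A < `|z.1|) || (A < `|z.2|) -> phi z = 0) ->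
  A + `|xi| <= M%:R -> A + `|eta| <= T ->
  itg2 (- A) A (- A) A (fun z => P e (z.1 - xi) (z.2 - eta) * phi z) =
  \sum_(k < M.*2.+1) cell e T phi (xi - M%:R + k%:R) eta.
Proof.
move=> e0 A0 cphi phi0 AM AT; have cP := cont_P_shift (xi := xi) (eta := eta) e0.
have x1 := ler_norm xi; have x2 := ler_norm (- xi); rewrite normrN in x2.
have y1 := ler_norm eta; have y2 := ler_norm (- eta); rewrite normrN in y2.
pose a := xi - M%:R - 1 / 2.
have ng : a + M.*2.+1%:R = xi + M%:R + 1 / 2.
  by rewrite /a -(@natr1 R M.*2) -addnn natrD; field.
have cF : continuous (fun z : R * R => P e (z.1 - xi) (z.2 - eta) * phi z) by cont.
have M0 : 0 <= M%:R :> R by [].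
have n1 := normr_ge0 xi; have n2 := normr_ge0 eta.
rewrite (itg2_plane (a' := a) (b' := a + M.*2.+1%:R) (c' := eta - T) (d' := eta + T) cF).
- rewrite {1}/itg2 itg_split_sum; last by apply: (continuous_itg_param2 _ cF); lra.
  apply: eq_bigr => k _; rewrite /cell.
  rewrite (_ : xi - M%:R + k%:R - 1 / 2 = a + k%:R); last by rewrite /a; ring.
  apply: eq_itg => x _; apply: eq_itg => y _ /=; congr (_ * _).
  have -> : x - xi = x - (xi - M%:R + k%:R) + k%:R - M%:R by ring.
  by rewrite P_perB P_perN.
- lra.
- lra.
- by rewrite ng /a; lra.
- lra.
- move=> z nz; rewrite phi0 ?mulr0//; apply: contra_notT nz; rewrite negb_or -!leNgt.
  by rewrite !ler_norml => /andP[].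
- move=> z nz; rewrite phi0 ?mulr0//; apply: contra_notT nz; rewrite negb_or -!leNgt ng /a.
  by rewrite !ler_norml => /andP[/andP[? ?] /andP[? ?]]; split; apply/andP; split; lra.
Qed.

End Cells.

(** * Periodic potentials *)

Section DecreasingInfimum.
Context d (T : measurableType d) (R : realType) (m : {measure set T -> \bar R}).
Variables (D : set T) (mD : measurable D) (f : nat -> T -> R) (c : R).
Hypothesis intf : forall n, m.-integrable D (EFin \o f n).
Hypothesis decf : forall n x, f n.+1 x <= f n x.
Hypothesis fc : forall n, c <= \int[m]_(x in D) f n x.

Let F x : \bar R := ereal_inf (range (fun n => (f n x)%:E)).

Let g n x : \bar R := (f 0%N x - f n x)%:E.

Let f_mono x n k : (n <= k)%N -> f k x <= f n x.
Proof.
move=> /subnK <-; elim: (k - n)%N => // i IH.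
by rewrite addSn; exact: le_trans (decf _ _) IH.
Qed.

Lemma cvg_inf_range x : (f n x)%:E @[n --> \oo] --> F x.
Proof.
by apply: ereal_nonincreasing_cvgn => n k nk; rewrite lee_fin; exact: f_mono.
Qed.

Let F_le n x : (F x <= (f n x)%:E)%E.
Proof. by apply: ereal_inf_lbound; exists n. Qed.

Let lim_g x : limn (g ^~ x) = ((f 0%N x)%:E - F x)%E.
Proof.
apply/cvg_lim => //.
rewrite (_ : g ^~ x = (fun n => (f 0%N x)%:E - (f n x)%:E)%E); last by apply/funext.
apply: cvgeB; [|exact: cvg_cst|exact: cvg_inf_range].
by rewrite fin_num_adde_defr.
Qed.

Let mF : measurable_fun D F.
Proof.
apply: (emeasurable_fun_cvg (fun n x => (f n x)%:E)).
  by move=> n; exact: (measurable_int m (intf n)).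
by move=> x _; exact: cvg_inf_range.
Qed.

Let h x : \bar R := ((f 0%N x)%:E - F x)%E.

Let int_g n : (\int[m]_(x in D) g n x = (\int[m]_(x in D) f 0%N x - \int[m]_(x in D) f n x)%:E)%E.
Proof.
rewrite /g -RintegralB// /Rintegral fineK//.
apply: integrable_fin_num => //.
exact: (integrableB mD (intf 0%N) (intf n)).
Qed.

Let h_ge0 x : (0 <= h x)%E.
Proof.
rewrite /h; case: (F x) (F_le 0%N x) => [r h'|h'|_].
- by rewrite -EFinB lee_fin subr_ge0 -lee_fin.
- by rewrite leye_eq in h'.
- by rewrite /= leey.
Qed.

Let int_h_le : (\int[m]_(x in D) h x <= (\int[m]_(x in D) f 0%N x - c)%:E)%E.
Proof.
rewrite /h; under eq_integral do rewrite -lim_g.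
rewrite monotone_convergence//.
- apply: lime_le.
    apply: ereal_nondecreasing_is_cvgn => n k nk; rewrite !int_g lee_fin lerD2l lerN2.
    by apply: le_Rintegral => // x _; exact: f_mono.
  by apply: nearW => n; rewrite int_g lee_fin lerD2l lerN2.
- by move=> n; exact: (measurable_int m (integrableB mD (intf 0%N) (intf n))).
- by move=> n x _; rewrite lee_fin subr_ge0 f_mono.
- by move=> x _ n k nk; rewrite lee_fin lerD2l lerN2 f_mono.
Qed.

Let int_h : m.-integrable D h.
Proof.
apply/integrableP; split.
  by apply: emeasurable_funB => //; exact: (measurable_int m (intf 0%N)).
under eq_integral do rewrite gee0_abs ?h_ge0//.
by apply: le_lt_trans int_h_le _; rewrite ltry.
Qed.

Let F_eq x : F x = ((f 0%N x)%:E - h x)%E.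
Proof.
rewrite /h; have := F_le 0%N x; case: (F x) => [r _| |_] //=.
by rewrite -!EFinB; congr (_%:E); ring.
Qed.

(** [F] is [f 0] minus the nonnegative limit [h] of [f 0 - f n]. By monotone convergence the
    integral of [h] is at most that of [f 0] minus [c]. *)
Lemma integrable_inf_range : m.-integrable D F.
Proof.
rewrite (_ : F = fun x => ((f 0%N x)%:E - h x)%E); last exact/funext.
exact: (integrableB mD (intf 0%N) int_h).
Qed.

Lemma integral_inf_range_ge : (c%:E <= \int[m]_(x in D) F x)%E.
Proof.
rewrite (eq_integral (fun x => (f 0%N x)%:E - h x)%E); last by move=> x _; rewrite F_eq.
rewrite (integralB mD (intf 0%N) int_h).
have fin0 : (\int[m]_(x in D) (f 0%N x)%:E)%E \is a fin_num.
  exact: (integrable_fin_num mD (intf 0%N)).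
have finh : (\int[m]_(x in D) h x)%E \is a fin_num.
  exact: (integrable_fin_num mD int_h).
rewrite -(fineK fin0) -(fineK finh) -EFinB lee_fin.
by have := int_h_le; rewrite -(fineK finh) lee_fin /Rintegral; lra.
Qed.

End DecreasingInfimum.

(** * The regularised potentials of a finite measure and their infimum *)

Section Potential.
Context {R : realType} (nu : {finite_measure set (R * R)%type -> \bar R}).
Implicit Types (z w : R * R) (n : nat).
Notation leb := (@lebesgue_measure R).

(** Starts at 1, so that [kern 0] is the regularisation to which [L_diff_mean] compares the
    others. *)
Definition eps_ n : R := n.+1%:R^-1.

Lemma eps_gt0 n : 0 < eps_ n.
Proof. by rewrite /eps_ invr_gt0. Qed.

Lemma eps_le1 n : eps_ n <= 1.
Proof. by rewrite /eps_ invf_le1 // ler1n. Qed.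

Lemma eps_dec n : eps_ n.+1 <= eps_ n.
Proof. by rewrite /eps_ lef_pV2 ?posrE// ler_nat. Qed.

(* The subtracted term bounds the kernel from above uniformly in the pole [w]. *)
Definition kern n z w : R := L (eps_ n) (z.1 - w.1) (z.2 - w.2) - ln (ch (2 * pi * w.2)) / 2.

Definition kbound n (y : R) : R := 1 + pi * `|y| - ln (eps_ n) / 2.

Lemma ln_eps_le0 n : ln (eps_ n) <= 0.
Proof. by rewrite -(@ln1 R) ler_ln ?posrE// ?eps_le1// eps_gt0. Qed.

(** [H] is at most [3 * ch (2 pi (y - Im w))]; dividing by [ch (2 pi Im w)] leaves at most
    [3 * expR (2 pi |y|)], and 3 is at most [expR 2]. The logarithm is then halved. *)
Lemma kern_le n z w : kern n z w <= 1 + pi * `|z.2|.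
Proof.
have c0 := ch_gt0 (2 * pi * w.2); have H0 := H_gt0 (z.1 - w.1) (z.2 - w.2) (eps_gt0 n).
rewrite /kern /L -mulrBl ler_pdivrMr// -ln_div ?posrE//.
have q0 := divr_gt0 H0 c0; rewrite -ler_expR lnK ?posrE// ler_pdivrMr//.
have e1 := eps_le1 n; have cc := cos_geN1 (2 * pi * (z.1 - w.1)).
have c1 := ch_ge1 (2 * pi * (z.2 - w.2)).
apply: (@le_trans _ _ (3 * ch (2 * pi * (z.2 - w.2)))); first by rewrite /H; lra.
have -> : (1 + pi * `|z.2|) * 2 = 2 + `|2 * pi * z.2|.
  by rewrite normrM ger0_norm ?mulr_ge0 ?pi_ge0//; ring.
rewrite expRD mulrBr -[leRHS]mulrA; apply: ler_pM => //; first by rewrite ltW// ch_gt0.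
  by have := expR_ge1Dx (2 : R); lra.
exact: chB_le.
Qed.

(** Since [eps_ n <= 1], [cos <= 1] and [ch >= 1], [H] is at least [eps_ n] times the hyperbolic
    cosine. *)
Lemma kern_ge n z w : ln (eps_ n) / 2 - pi * `|z.2| <= kern n z w.
Proof.
have e0 := eps_gt0 n; have e1 := eps_le1 n.
have c0 := ch_gt0 (2 * pi * w.2); have H0 := H_gt0 (z.1 - w.1) (z.2 - w.2) e0.
rewrite /kern /L -mulrBl ler_pdivlMr// -ln_div ?posrE//.
have q0 := divr_gt0 H0 c0; rewrite -ler_expR [leRHS]lnK ?posrE// ler_pdivlMr//.
have -> : (ln (eps_ n) / 2 - pi * `|z.2|) * 2 = ln (eps_ n) - `|2 * pi * z.2|.
  by rewrite normrM ger0_norm ?mulr_ge0 ?pi_ge0//; field.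
rewrite expRD lnK ?posrE// -[leLHS]mulrA.
apply: (@le_trans _ _ (eps_ n * ch (2 * pi * (z.2 - w.2)))).
  by rewrite ler_wpM2l ?(ltW e0)// mulrBr chB_ge.
have cc := cos_le1 (2 * pi * (z.1 - w.1)).
have c1 := ch_ge1 (2 * pi * (z.2 - w.2)).
rewrite /H; move: (ch (2 * pi * (z.2 - w.2))) (cos _) cc c1 => u v cc c1.
nra.
Qed.

Lemma kern_bound n z w : `|kern n z w| <= kbound n z.2.
Proof.
have := kern_le n z w; have := kern_ge n z w; have := ln_eps_le0 n.
by rewrite /kbound ler_norml => ? ? ?; apply/andP; split; lra.
Qed.

Lemma kern_dec n z w : kern n.+1 z w <= kern n z w.
Proof.
rewrite /kern lerD2r /L ler_pM2r// ler_ln ?posrE ?H_gt0 ?eps_gt0//.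
by rewrite /H lerD2l eps_dec.
Qed.

Lemma kern_per n z w : kern n (translate1 z) w = kern n z w.
Proof.
rewrite /kern /translate1 /= /L /H.
have -> : z.1 + 1 - w.1 = z.1 - w.1 + 1 by ring.
by rewrite cos_per.
Qed.

(** Arbitrary measurable coordinates cover measurability in the pole alone as well as the joint
    measurability that Fubini asks for over circles and boxes. *)
Lemma measurable_kern_path d (T : measurableType d) n (X Y XI ETA : T -> R) :
  measurable_fun setT X -> measurable_fun setT Y ->
  measurable_fun setT XI -> measurable_fun setT ETA ->
  measurable_fun setT (fun t => kern n (X t, Y t) (XI t, ETA t)).
Proof.
move=> mX mY mXI mETA; rewrite /kern /L /H /=.
have mch := continuous_measurable_fun (@cont_ch R).
have mcos := continuous_measurable_fun (@cont_cos R).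
apply: measurable_funB.
  apply: measurable_funM => //; apply: (measurableT_comp (@measurable_ln R)).
  apply: measurable_funD => //; apply: measurable_funB.
    by apply: (measurableT_comp mch); apply: measurable_funM => //; exact: measurable_funB.
  by apply: (measurableT_comp mcos); apply: measurable_funM => //; exact: measurable_funB.
apply: measurable_funM => //; apply: (measurableT_comp (@measurable_ln R)).
by apply: (measurableT_comp mch); exact: measurable_funM.
Qed.

Lemma measurable_kern n z : measurable_fun setT (kern n z).
Proof.
have -> : kern n z = (fun w => kern n (z.1, z.2) (w.1, w.2)).
  by apply/funext => -[? ?]; case: z.
by apply: measurable_kern_path => //.
Qed.

Lemma integrable_kern n z : nu.-integrable setT (fun w => (kern n z w)%:E).
Proof.
apply: (measurable_bounded_integrable (f := kern n z)) => //.
- by rewrite -ge0_fin_numE// fin_num_measure.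
- exact: measurable_kern.
- exists (kbound n z.2); split; first exact: num_real.
  by move=> M /ltW CM w _; exact: le_trans (kern_bound n z w) CM.
Qed.

Definition pot n z : R := \int[nu]_w kern n z w.

Let mass : R := fine (nu setT).

Let mass_ge0 : 0 <= mass.
Proof. exact: fine_ge0. Qed.

Let Rint_cst (c : R) : \int[nu]_(w in setT) c = c * mass.
Proof. by rewrite Rintegral_cst. Qed.

Let int_cst (c : R) : nu.-integrable setT (fun=> c%:E).
Proof. by apply/finite_measure_integrable_cst. Qed.

Lemma pot_dec n z : pot n.+1 z <= pot n z.
Proof.
apply: le_Rintegral => //; try exact: integrable_kern.
by move=> w _; exact: kern_dec.
Qed.

Lemma pot_le n z : pot n z <= (1 + pi * `|z.2|) * mass.
Proof.
rewrite -Rint_cst; apply: le_Rintegral => //; [exact: integrable_kern|exact: int_cst|].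
by move=> w _; exact: kern_le.
Qed.

Lemma pot_per n z : pot n (translate1 z) = pot n z.
Proof. by apply: eq_Rintegral => w _; exact: kern_per. Qed.

Lemma lipschitz_der (f f' : R -> R) (C : R) : der f f' -> (forall x, `|f' x| <= C) ->
  forall a b, `|f b - f a| <= C * `|b - a|.
Proof.
move=> df fC a b; wlog ab : a b / a <= b.
  by move=> h; case: (leP a b) => [/h//|/ltW/h]; rewrite distrC [`|a - b|]distrC.
have [c _ ->] := MVT_segment ab (fun x _ => df x) (continuous_subspaceT (der_cont df)).
by rewrite normrM ler_wpM2r.
Qed.

Lemma Lx_bound e (x y : R) : 0 < e -> `|Lx e x y| <= pi / e.
Proof.
move=> e0; have H0 := H_gt0 x y e0;
  rewrite /Lx normrM normfV (gtr0_norm H0) normrM ger0_norm ?pi_ge0//.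
have s1 : `|sin (2 * pi * x)| <= 1 by rewrite ler_norml sin_geN1 sin_le1.
apply: ler_pM => //; first by rewrite mulr_ge0 ?pi_ge0.
- by rewrite invr_ge0 ltW.
- by rewrite ler_piMr ?pi_ge0.
- rewrite lef_pV2 ?posrE// /H.
  by have := ch_ge1 (2 * pi * y); have := cos_le1 (2 * pi * x); lra.
Qed.

Lemma Ly_bound e (x y : R) : 0 < e -> e <= 1 -> `|Ly e x y| <= pi / e.
Proof.
move=> e0 e1; have H0 := H_gt0 x y e0;
  rewrite /Ly normrM normfV (gtr0_norm H0) normrM ger0_norm ?pi_ge0//.
rewrite ler_pdivrMr// [leRHS]mulrAC ler_pdivlMr// -[leLHS]mulrA ler_wpM2l ?pi_ge0//.
have := sh_le_ch (2 * pi * y); have c1 := ch_ge1 (2 * pi * y); have := cos_le1 (2 * pi * x).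
rewrite /H; move: (ch _) (`|sh _|) (cos _) c1 => u s v c1 cc su; nra.
Qed.

Lemma kern_lip n z z' w :
  `|kern n z w - kern n z' w| <= pi / eps_ n * (`|z.1 - z'.1| + `|z.2 - z'.2|).
Proof.
have e0 := eps_gt0 n; have e1 := eps_le1 n.
have h1 : `|L (eps_ n) (z.1 - w.1) (z.2 - w.2) - L (eps_ n) (z'.1 - w.1) (z.2 - w.2)| <=
    pi / eps_ n * `|z.1 - z'.1|.
  apply: (lipschitz_der (der_L_x w.1 (z.2 - w.2) e0)) => x; exact: Lx_bound.
have h2 : `|L (eps_ n) (z'.1 - w.1) (z.2 - w.2) - L (eps_ n) (z'.1 - w.1) (z'.2 - w.2)| <=
    pi / eps_ n * `|z.2 - z'.2|.
  apply: (lipschitz_der (der_L_y w.2 (z'.1 - w.1) e0)) => y; exact: Ly_bound.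
rewrite /kern [leRHS]mulrDr; apply: (le_trans _ (lerD h1 h2)); apply: (le_trans _ (ler_normD _ _)).
by rewrite le_eqVlt; apply/orP; left; apply/eqP; congr `|_|; ring.
Qed.

(** The Lipschitz constant of the kernel does not depend on the pole, so it integrates against [nu].
    It blows up with n; the limit is only semicontinuous. *)
Lemma pot_lip n z z' :
  `|pot n z - pot n z'| <= pi / eps_ n * mass * (`|z.1 - z'.1| + `|z.2 - z'.2|).
Proof.
rewrite /pot -RintegralB//; try exact: integrable_kern.
rewrite mulrAC -Rint_cst.
have iB : nu.-integrable setT (EFin \o (fun w => kern n z w - kern n z' w)).
  exact: (integrableB measurableT (integrable_kern n z) (integrable_kern n z')).
apply: le_trans (le_normr_Rintegral _ iB) _ => //.
apply: le_Rintegral => //; [exact: (integrable_abse iB)|exact: int_cst|].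
by move=> w _; exact: kern_lip.
Qed.

Lemma pot_cont n : continuous (pot n).
Proof.
move=> z; apply/cvgrPdist_le => e e0.
have C0 : 0 <= pi / eps_ n * mass.
  by rewrite mulr_ge0// divr_ge0 ?pi_ge0// ltW// eps_gt0.
set C := _ * mass in C0; pose D := e / (2 * (C + 1)).
have D0 : 0 < D by rewrite divr_gt0// mulr_gt0// ltr_wpDl.
have := nbhsx_ballx z D D0; apply: filterS => z' [].
rewrite /ball/= => h1 h2; apply: le_trans (pot_lip n z z') _; rewrite -/C.
apply: (@le_trans _ _ (C * (D + D))); first by rewrite ler_wpM2l// lerD// ltW.
have -> : C * (D + D) = C / (C + 1) * e by rewrite /D; field; rewrite gt_eqF// ltr_wpDl.
by rewrite ler_piMl ?(ltW e0)// ler_pdivrMr ?ltr_wpDl// mul1r lerDl.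
Qed.

(** Plays the part of the integral of the singular kernel. As an infimum of continuous functions it
    is upper semicontinuous at once. *)
Definition vpot z : \bar R := ereal_inf (range (fun n => (pot n z)%:E)).

Lemma vpot_le n z : (vpot z <= (pot n z)%:E)%E.
Proof. by apply: ereal_inf_lbound; exists n. Qed.

Lemma vpot_ltoo z : (vpot z < +oo)%E.
Proof. exact: le_lt_trans (vpot_le 0 z) (ltry _). Qed.

Lemma vpot_lsc : lower_semicontinuous (fun z => (- vpot z)%E).
Proof.
move=> z a; rewrite lteNr => /ereal_inf_lt[_ [n _ <-]]; rewrite -EFinN lte_fin => h.
have := pot_cont (n := n) (x := z); move/(@cvgr_lt _ _ _ _ _ _)/(_ _ h) => near.
exists [set z' | pot n z' < - a]; first exact: near.
move=> z' /= h'; rewrite lteNr; apply: le_lt_trans (vpot_le n z') _.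
by rewrite -EFinN lte_fin.
Qed.

Lemma vpot_per : periodic1 vpot.
Proof. by move=> z; rewrite /vpot; congr ereal_inf; apply: eq_imagel => n _; rewrite pot_per. Qed.

Lemma vpot_growth : at_most_linear_growth vpot.
Proof.
exists (pi * mass) => z; apply: le_trans (vpot_le 0 z) _; rewrite lee_fin.
apply: le_trans (pot_le 0 z) _; rewrite mulrAC ler_wpM2r//.
have yz : `|z.2| <= cmod z.
  rewrite /cmod -sqrtr_sqr ler_wsqrtr//.
  by rewrite lerDr sqr_ge0.
have p2 := @pi_ge2 R.
rewrite mulrDr mulr1 addrC; apply: lerD; last lra.
by rewrite ler_wpM2l// pi_ge0.
Qed.

End Potential.

(* A name for the product measure with a canonical sigma-finite instance. *)
Definition leb2 {R : realType} : set (measurableTypeR R * measurableTypeR R) -> \bar R :=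
  (@lebesgue_measure R \x @lebesgue_measure R)%E.
HB.instance Definition _ (R : realType) := Measure.on (@leb2 R).
Definition box {R : realType} (a b c d : R) : set (R * R) := `[a, b]%classic `*` `[c, d]%classic.

Lemma measurable_box {R : realType} (a b c d : R)  : measurable (box a b c d).
Proof. exact: measurableX. Qed.

Lemma leb2_sigma_finite (R : realType) : sigma_finite setT (@leb2 R).
Proof.
exists (fun n => box (- n%:R) n%:R (- n%:R) n%:R).
  apply/seteqP; split => // z _; exists (Num.trunc (Num.max `|z.1| `|z.2|)).+1 => //.
  have := truncn_itv (le_trans (normr_ge0 z.1) (_ : _ <= Num.max `|z.1| `|z.2|)).
  rewrite le_max lexx => /(_ isT)/andP[_ /ltW]; rewrite ge_max => /andP[z1 z2].
  by split; rewrite /= in_itv/= -ler_norml.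
move=> n; split; first exact: measurable_box.
have := @product_measure1E _ _ _ _ R (@lebesgue_measure R) (@lebesgue_measure R) `[- n%:R,
  n%:R]%classic `[- n%:R, n%:R]%classic
  (measurable_itv _) (measurable_itv _).
rewrite /leb2 /box => ->.
by rewrite lte_mul_pinfty ?lebesgue_itv_fin// ge0_fin_numE// lebesgue_itv_fin.
Qed.
HB.instance Definition _ (R : realType) := Measure_isSigmaFinite.Build _ _ _ (@leb2 R)
  (@leb2_sigma_finite R).

Section BoxIntegrals.
Context {R : realType}.
Implicit Types (f : R * R -> R) (a b c d : R).
Notation leb := (@lebesgue_measure R).

Lemma leb2_box a b c d : a <= b -> c <= d ->
  leb2 (box a b c d) = ((b - a) * (d - c))%:E.
Proof.
move=> ab cd; apply: (etrans (@product_measure1E _ _ _ _ R leb leb `[a, b]%classic `[c, d]%classic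
  (measurable_itv _) (measurable_itv _))).
exact: (f_equal2 mule (lebesgue_segment ab) (lebesgue_segment cd)).
Qed.

Lemma box_fin a b c d : (leb2 (box a b c d) < +oo)%E.
Proof.
have := @product_measure1E _ _ _ _ R leb leb `[a, b]%classic `[c, d]%classic
  (measurable_itv _) (measurable_itv _).
by rewrite /leb2 /box /= => ->;
  rewrite lte_mul_pinfty ?lebesgue_itv_fin// ge0_fin_numE// lebesgue_itv_fin.
Qed.

Lemma integrable_box f a b c d : continuous f ->
  leb2.-integrable (box a b c d) (EFin \o f).
Proof.
move=> cf; have [C _ fC] := continuous_bounded_box a b c d cf.
apply: measurable_bounded_integrable.
- exact: measurable_box.
- exact: box_fin.
- by apply: measurable_funTS; exact: continuous_measurable_prod.
- exists C; split; first exact: num_real.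
  move=> M /ltW CM [x y] [/= xab ycd]; apply: le_trans CM.
  by move: xab ycd; rewrite !in_itv/=; exact: fC.
Qed.

Lemma Rintegral_box f a b c d : c <= d -> continuous f ->
  \int[leb2]_(z in box a b c d) f z = itg2 a b c d f.
Proof.
move=> cd cf; have [C _ fC] := continuous_bounded_box a b c d cf.
have E := @integral_prod_iter1 _ _ _ _ _ leb leb `[a, b]%classic `[c, d]%classic f C
  (measurable_itv _) (measurable_itv _) (lebesgue_itv_fin a b) (lebesgue_itv_fin c d)
  (continuous_measurable_prod cf).
apply: (etrans (congr1 fine (E _)) (congr1 fine (itg_EFin a b (continuous_itg_param2 cd cf)))).
by move=> x y; rewrite /= !in_itv/=; exact: fC.
Qed.

End BoxIntegrals.

(** * Means, local integrability and laplacian of the potential *)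

Section PotentialMeans.
Context {R : realType} (nu : {finite_measure set (R * R)%type -> \bar R}).
Implicit Types (z w : R * R) (n : nat).
Notation leb := (@lebesgue_measure R).
Notation pot := (pot nu).
Notation vpot := (vpot nu).

Let nu_fin : (nu setT < +oo)%E.
Proof. by rewrite -ge0_fin_numE// fin_num_measure. Qed.

Lemma cont_kern n w : continuous (fun z => kern n z w).
Proof.
rewrite /kern; apply: cont_add; last exact: cont_cst.
by apply: cont_L; [exact: eps_gt0|cont|cont].
Qed.

Lemma kern_circle n z w r : 0 <= r ->
  2 * pi * kern n z w <= itg 0 (2 * pi) (fun t => kern n (z.1 + r * cos t, z.2 + r * sin t) w).
Proof.
move=> r0; have := L_circle_mean (z.1 - w.1) (z.2 - w.2) (eps_gt0 n) r0.
have cX : continuous (fun t : R => z.1 - w.1 + r * cos t) by cont.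
have cY : continuous (fun t : R => z.2 - w.2 + r * sin t) by cont.
have cL := cont_L (eps_gt0 n) cX cY.
have -> : itg 0 (2 * pi) (fun t => kern n (z.1 + r * cos t, z.2 + r * sin t) w) =
    itg 0 (2 * pi) (fun t => L (eps_ n) (z.1 - w.1 + r * cos t) (z.2 - w.2 + r * sin t)
   - ln (ch (2 * pi * w.2)) / 2).
  by apply: eq_itg => t _; rewrite /kern /= addrAC [z.2 + _ - _]addrAC.
rewrite (itgB _ _ cL (@cont_cst _ _ _)) itg_cst; last by rewrite mulr_ge0// pi_ge0.
by rewrite subr0 [X in _ <= _ - X]mulrC /kern mulrBr => h; rewrite lerD2r.
Qed.

Lemma pot_circle n z r : 0 <= r ->
  2 * pi * pot n z <= itg 0 (2 * pi) (fun t => pot n (z.1 + r * cos t, z.2 + r * sin t)).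
Proof.
move=> r0.
pose f (p : (R * R) * R) := kern n (z.1 + r * cos p.2, z.2 + r * sin p.2) (p.1.1, p.1.2).
have mf : measurable_fun setT f.
  have mcos := continuous_measurable_fun (@cont_cos R).
  have msin := continuous_measurable_fun (@cont_sin R).
  apply: (measurable_kern_path n (X := fun p => z.1 + r * cos p.2) (Y := fun p => z.2 + r * sin p.2)
    (XI := fun p : (R * R) * R => p.1.1) (ETA := fun p : (R * R) * R => p.1.2)).
  - by apply: measurable_funD => //; apply: measurable_funM => //; exact: measurableT_comp.
  - by apply: measurable_funD => //; apply: measurable_funM => //; exact: measurableT_comp.
  - exact: (measurableT_comp measurable_fst measurable_fst).
  - exact: (measurableT_comp measurable_snd measurable_fst).
have fC (w : R * R) (t : R) : setT w -> `[0, 2 * pi]%classic t -> `|f (w,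
  t)| <= kbound n (`|z.2| + r).
  move=> _ _; apply: le_trans (kern_bound _ _ _) _;
    rewrite /kbound lerD2r lerD2l ler_wpM2l ?pi_ge0//=.
  rewrite (ger0_norm (addr_ge0 (normr_ge0 _) r0)); apply: le_trans (ler_normD _ _) _;
    rewrite lerD2l normrM (ger0_norm r0) ler_piMr//.
  by rewrite ler_norml sin_geN1 sin_le1.
have swp := @Rintegral_swap _ _ _ _ R nu leb setT `[0, 2 * pi]%classic f _ measurableT
  (measurable_itv _) nu_fin (lebesgue_itv_fin 0 (2 * pi)) mf fC.
have ii := @bounded_integrable_iter1 _ _ _ _ R nu leb setT `[0, 2 * pi]%classic f _ measurableT
  (measurable_itv _) nu_fin (lebesgue_itv_fin 0 (2 * pi)) mf fC.
have -> : itg 0 (2 * pi) (fun t => pot n (z.1 + r * cos t, z.2 + r * sin t)) =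
  \int[nu]_w itg 0 (2 * pi) (fun t => f (w, t)).
  rewrite swp; apply: eq_itg => t _; apply: eq_Rintegral => -[a b] _; by [].
rewrite /pot -RintegralZl//; last exact: integrable_kern.
apply: le_Rintegral => //.
- exact: (integrableZl measurableT (2 * pi) (integrable_kern nu n z)).
- by move=> [a b] _; exact: kern_circle.
Qed.

(** At fixed n the kernel is bounded uniformly in [w] over a box and [nu] is finite, so Fubini
    applies. *)
Lemma pot_box_swap n (g : R * R -> R) a b c d : c <= d -> continuous g ->
  itg2 a b c d (fun z => pot n z * g z) = \int[nu]_w itg2 a b c d (fun z => kern n z w * g z)
  /\ nu.-integrable setT (fun w => (itg2 a b c d (fun z => kern n z w * g z))%:E).
Proof.
move=> cd cg; have [C C0 gC] := continuous_bounded_box a b c d cg.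
pose f (p : (R * R) * (R * R)) := kern n (p.2.1, p.2.2) (p.1.1, p.1.2) * g p.2.
have mf : measurable_fun setT f.
  apply: measurable_funM; last first.
    exact: (measurableT_comp (continuous_measurable_prod cg) measurable_snd).
  apply: (measurable_kern_path n (X := fun p : (R * R) * (R * R) => p.2.1) (Y :=
    fun p : (R * R) * (R * R) => p.2.2)
    (XI := fun p : (R * R) * (R * R) => p.1.1) (ETA := fun p : (R * R) * (R * R) => p.1.2)).
  - exact: (measurableT_comp measurable_fst measurable_snd).
  - exact: (measurableT_comp measurable_snd measurable_snd).
  - exact: (measurableT_comp measurable_fst measurable_fst).
  - exact: (measurableT_comp measurable_snd measurable_fst).
have fC w z : setT w -> box a b c d z -> `|f (w, z)| <= kbound n (`|c| + `|d|) * C.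
  move=> _ [/= z1 z2]; rewrite normrM; apply: ler_pM => //; last first.
    by case: z z1 z2 => x y /=; rewrite !in_itv/=; exact: gC.
  apply: le_trans (kern_bound _ _ _) _; rewrite /kbound lerD2r lerD2l ler_wpM2l ?pi_ge0//=.
  rewrite (ger0_norm (addr_ge0 (normr_ge0 _) (normr_ge0 _))).
  move: z2; rewrite in_itv/= => /andP[z2 z2'].
  have := ler_norm d; have := ler_norm (- c); rewrite normrN => h1 h2.
  have h3 := normr_ge0 c; have h4 := normr_ge0 d.
  by rewrite ler_norml; apply/andP; split; lra.
have swp := @Rintegral_swap _ _ _ _ R nu leb2 setT (box a b c d) f _ measurableT
  (measurable_box _ _ _ _) nu_fin (box_fin a b c d) mf fC.
have ii := @bounded_integrable_iter1 _ _ _ _ R nu leb2 setT (box a b c d) f _ measurableT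
  (measurable_box _ _ _ _) nu_fin (box_fin a b c d) mf fC.
have ck w : continuous (fun z => kern n z w * g z) by have c0 := cont_kern (n := n) (w := w); cont.
have E w : itg2 a b c d (fun z => kern n z w * g z) = \int[leb2]_(z in box a b c d) f (w, z).
  rewrite -Rintegral_box//; apply: eq_Rintegral => -[x y] _; by case: w.
split; last by under eq_fun do rewrite E.
under [RHS]eq_Rintegral do rewrite E.
rewrite swp -Rintegral_box//; last by have c0 := pot_cont (nu := nu) (n := n); cont.
apply: eq_Rintegral => z _; rewrite /f /pot -RintegralZr//; last exact: integrable_kern.
Qed.

(** Each horizontal slice consists of 2N segments of length 1, on each of which [L_diff_mean] bounds
    the integral by pi + 7; the slices fill a height 2N. *)
Lemma kern_box_diff n w N : 
  itg2 (- N%:R) N%:R (- N%:R) N%:R (fun z => kern 0 z w - kern n z w) <=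
  N.*2%:R * (pi + 7) * N.*2%:R.
Proof.
have N0 : 0 <= N%:R :> R by [].
have NN : - N%:R <= N%:R :> R by lra.
have N2 : N.*2%:R = N%:R + N%:R :> R by rewrite -addnn natrD.
have cd : continuous (fun z => kern 0 z w - kern n z w).
  by have c0 := cont_kern (n := 0%N) (w := w); have cn := cont_kern (n := n) (w := w); cont.
rewrite /itg2 (itg_swap _ _ _ _ cd).
apply: (@le_trans _ _ (itg (- N%:R) N%:R (fun=> N.*2%:R * (pi + 7)))); last first.
  by rewrite itg_cst// opprK -N2.
have ci := continuous_itg_param NN cd; apply: le_itg; [exact: ci|exact: cont_cst|].
move=> y _; rewrite [X in itg _ X _](_ : N%:R = - N%:R + N.*2%:R :> R); last by rewrite N2; lra.
rewrite itg_split_sum; last exact: (continuous_sectionl (y := y) cd).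
apply: (@le_trans _ _ (\sum_(k < N.*2) (pi + 7))); last by rewrite sumr_const card_ord mulr_natl.
apply: ler_sum => k _.
apply: le_trans (L_diff_mean w.1 w.2 _ y (eps_gt0 n) (eps_le1 n)).
rewrite le_eqVlt; apply/orP; left; apply/eqP; apply: eq_itg => x _.
by rewrite /kern /eps_ invr1 /=; ring.
Qed.

(** The loss from [pot 0] to [pot n] over a box is at most the bound of [kern_box_diff] times the
    mass of [nu], whatever n is. *)
Lemma pot_box_lower N : exists c : R, forall n,
  c <= \int[leb2]_(z in box (- N%:R) N%:R (- N%:R) N%:R) pot n z.
Proof.
have N0 : 0 <= N%:R :> R by [].
have NN : - N%:R <= N%:R :> R by lra.
set a := - N%:R; set b := N%:R.
exists (itg2 a b a b (pot 0%N) - N.*2%:R * (pi + 7) * N.*2%:R * fine (nu setT)) => n.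
rewrite Rintegral_box//; last exact: pot_cont.
have h k : itg2 a b a b (pot k) = \int[nu]_w itg2 a b a b (fun z => kern k z w * 1) /\
    nu.-integrable setT (fun w => (itg2 a b a b (fun z => kern k z w * 1))%:E).
  have [h1 h2] := pot_box_swap k a b NN (@cont_cst _ (R * R)%type 1).
  split; last exact: h2.
  by apply: (etrans _ h1); apply: eq_itg2 => x y _ _; rewrite mulr1.
have [e0 i0] := h 0%N; have [en i_n] := h n.
rewrite lerBlDr -lerBlDl e0 en -(RintegralB measurableT i0 i_n) -(Rintegral_cst nu measurableT).
apply: le_Rintegral.
- exact: measurableT.
- exact: (integrableB measurableT i0 i_n).
- exact/finite_measure_integrable_cst.
- move=> w _; apply: le_trans (kern_box_diff n w N).
  rewrite le_eqVlt; apply/orP; left; apply/eqP.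
  have c0 := cont_kern (n := 0%N) (w := w); have cn := cont_kern (n := n) (w := w).
  rewrite -(itg2B _ _ NN (cont_mul c0 (@cont_cst _ _ 1)) (cont_mul cn (@cont_cst _ _ 1))).
  by apply: eq_itg2 => x y _ _; rewrite !mulr1.
Qed.

Lemma vpot_box_integrable N : leb2.-integrable (box (- N%:R) N%:R (- N%:R) N%:R) vpot.
Proof.
have [c cP] := pot_box_lower N.
apply: (@integrable_inf_range _ _ R leb2 _ (measurable_box (- N%:R) N%:R (- N%:R) N%:R)
  pot c _ _ cP).
- by move=> n; apply: integrable_box; exact: pot_cont.
- by move=> n z; exact: pot_dec.
Qed.

(** A function equal to -oo everywhere would have integral -oo over a square of positive area,
    against the uniform lower bound. *)
Lemma vpot_neqNy : exists z, vpot z != -oo%E.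
Proof.
have [c cP] := pot_box_lower 1.
have ip n : leb2.-integrable (box (- 1%:R) 1%:R (- 1%:R) (1%:R : R)) (EFin \o pot n).
  by apply: integrable_box; exact: pot_cont.
have h := @integral_inf_range_ge _ _ R leb2 _ (measurable_box (- 1%:R) 1%:R (- 1%:R) (1%:R : R))
   pot c ip (pot_dec nu) cP.
apply: contrapT => /forallNP vNy.
have E z : vpot z = -oo%E by have := vNy z => /negP; rewrite negbK => /eqP.
move: h; under eq_integral do rewrite -/(vpot _) E.
rewrite integral_cst; last exact: measurable_box.
have l1 : - 1%:R <= 1%:R :> R by lra.
rewrite [X in (_ * X)%E](leb2_box l1 l1).
by rewrite mulNyr gtr0_sg ?mul1e//; nra.
Qed.

(** If the central value is finite it is a lower bound for the circle means of all [pot n], and such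
    a bound passes to the decreasing limit. *)
Lemma vpot_mean z r : 0 < r -> (vpot z <= circle_mean vpot z r)%E.
Proof.
move=> /ltW r0; have p20 : 0 < 2 * pi :> R by rewrite mulr_gt0// pi_gt0.
case E : (vpot z) => [s| |]; [|by have := vpot_ltoo nu z; rewrite E|by rewrite leNye].
have ct n : continuous (fun t => pot n (z.1 + r * cos t, z.2 + r * sin t)).
  move=> t; apply: (@continuous_comp _ _ _ (fun t => (z.1 + r * cos t, z.2 + r * sin t))
    (pot n)); last exact: pot_cont.
  have c1 : continuous (fun t : R => z.1 + r * cos t) by cont.
  have c2 : continuous (fun t : R => z.2 + r * sin t) by cont.
  exact: (cvg_pair (c1 t) (c2 t)).
have sP n : 2 * pi * s <= itg 0 (2 * pi) (fun t => pot n (z.1 + r * cos t, z.2 + r * sin t)).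
  apply: le_trans (pot_circle n z r0); rewrite ler_wpM2l ?(ltW p20)//.
  by rewrite -lee_fin -E; exact: vpot_le.
have h := @integral_inf_range_ge _ _ R leb `[0, 2 * pi]%classic (measurable_itv _)
  (fun n t => pot n (z.1 + r * cos t, z.2 + r * sin t)) _
  (fun n => cont_integrable _ _ (ct n)) (fun n t => pot_dec nu n _) sP.
rewrite /circle_mean.
have -> : s%:E = ((2 * pi)^-1%:E * (2 * pi * s)%:E)%E.
  by rewrite -EFinM mulKf// gt_eqF.
by apply: lee_wpmul2l => //; rewrite lee_fin invr_ge0 ltW.
Qed.

Lemma vpot_subharmonic : subharmonic vpot.
Proof.
split; [exact: vpot_ltoo|exact: vpot_lsc|exact: vpot_mean|exact: vpot_neqNy].
Qed.

(** For each n, Fubini and Green turn the integral of [pot n] times the laplacian into the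
    expression under the limit; dominated convergence on the square then replaces [pot n] by
    [vpot]. *)
Lemma vpot_riesz_limit phi N : test_function phi ->
  (forall z, (N%:R <= `|z.1|) || (N%:R <= `|z.2|) ->
    [/\ phi z = 0, d_x phi z = 0, d_y phi z = 0, d_x (d_x phi) z = 0 & d_y (d_y phi) z = 0]) ->
  (forall n, nu.-integrable setT (fun w => (itg2 (- N%:R) N%:R (- N%:R) N%:R
      (fun z => P (eps_ n) (z.1 - w.1) (z.2 - w.2) * phi z))%:E)) /\
  (\int[nu]_w itg2 (- N%:R) N%:R (- N%:R) N%:R
      (fun z => P (eps_ n) (z.1 - w.1) (z.2 - w.2) * phi z))%:E @[n --> \oo] -->
  (\int[leb2]_z (vpot z * (laplacian phi z)%:E))%E.
Proof.
move=> tphi phi0; have C2phi := test_function_C2 tphi.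
have cphi := C2_cont C2phi.
have N0 : 0 <= N%:R :> R by [].
have NN : - N%:R <= N%:R :> R by lra.
set D := box (- N%:R) N%:R (- N%:R) (N%:R : R).
have clap : continuous (laplacian phi).
  by apply: cont_add; [exact: (C2_cont_xx C2phi)|exact: (C2_cont_yy C2phi)].
have green n w : itg2 (- N%:R) N%:R (- N%:R) N%:R (fun z => kern n z w * laplacian phi z) =
    itg2 (- N%:R) N%:R (- N%:R) N%:R (fun z => P (eps_ n) (z.1 - w.1) (z.2 - w.2) * phi z).
  have e0 : 0 < eps_ n :> R := eps_gt0 n.
  have C2k : C2 (fun z => kern n z w) (fun z => Lx (eps_ n) (z.1 - w.1) (z.2 - w.2))
     (fun z => Ly (eps_ n) (z.1 - w.1) (z.2 - w.2))
     (fun z => Lxx (eps_ n) (z.1 - w.1) (z.2 - w.2)) (fun z => Lyy (eps_ n) (z.1 - w.1)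
       (z.2 - w.2)).
    split.
    - move=> y; rewrite /kern /=.
    apply: der_eq; first exact: (der_add (der_L_x w.1 (y - w.2) e0) (der_cst _)).
      by move=> x /=; rewrite addr0.
    - move=> x; rewrite /kern /=; apply: der_eq;
      first exact: (der_add (der_L_y w.2 (x - w.1) e0) (der_cst _)).
      by move=> y /=; rewrite addr0.
    - by move=> y; exact: (der_Lx_x w.1 (y - w.2) e0).
    - by move=> x; exact: (der_Ly_y w.2 (x - w.1) e0).
    - exact: cont_kern.
    - by apply: cont_Lx; [exact: e0|cont|cont].
    - by apply: cont_Ly; [exact: e0|cont|cont].
    - by apply: cont_Lxx; [exact: e0|cont|cont].
    - by apply: cont_Lyy; [exact: e0|cont|cont].
  have G := green_2d N0 C2k C2phi.
  rewrite [LHS]G; last first.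
    move=> z zN; have [] := phi0 z; last by [].
    by case: zN => ->; rewrite lexx ?orbT.
  by apply: eq_itg2 => x y _ _; rewrite laplacian_L.
have swp n := pot_box_swap n (- N%:R) N%:R NN clap.
split.
  by move=> n; have [_] := swp n; under eq_fun do rewrite green.
have -> : (\int[leb2]_z (vpot z * (laplacian phi z)%:E) =
    \int[leb2]_(z in D) (vpot z * (laplacian phi z)%:E))%E.
  rewrite [RHS]integral_mkcond; apply: eq_integral => z _; rewrite patchE; case: ifPn => //.
  rewrite notin_setE => zD; rewrite /laplacian.
  have [|_ _ _ -> ->] := phi0 z; last by rewrite addr0 mule0.
  apply: contra_notT zD; rewrite negb_or -!ltNge => /andP[z1 z2].
  by split; rewrite /= in_itv/= -ler_norml ltW.
have [C C0 lapC] := continuous_bounded_box (- N%:R) N%:R (- N%:R) N%:R clap.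
have iv : leb2.-integrable D vpot by exact: vpot_box_integrable.
have ip n : leb2.-integrable D (EFin \o pot n) by apply: integrable_box; exact: pot_cont.
have cpl n : continuous (fun z => pot n z * laplacian phi z).
  by have c0 := pot_cont (nu := nu) (n := n); cont.
have mD : measurable D by exact: measurable_box.
have mlap : measurable_fun D (EFin \o laplacian phi).
  by apply/measurable_EFinP; apply: measurable_funTS; exact: continuous_measurable_prod.
(* [pot n] lies between [vpot] and [pot 0], so the sum of their absolute values dominates it. *)
pose g z : \bar R := ((`|(pot 0%N z)%:E| + `|vpot z|) * C%:E)%E.
have [] := @dominated_convergence _ _ R leb2 D mD
  (fun n z => (pot n z * laplacian phi z)%:E) (fun z => vpot z * (laplacian phi z)%:E)%E g.
- by move=> n; exact: (measurable_int _ (integrable_box _ _ _ _ (cpl n))).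
- by apply: emeasurable_funM => //; exact: (measurable_int _ iv).
(* Convergence of the products is claimed only where [vpot] is finite, which is almost everywhere by
   integrability. *)
- have := @integrable_ae _ _ R leb2 D mD vpot iv; apply: filterS => z /= + Dz => /(_ Dz) fv.
  rewrite -(fineK fv) -EFinM; apply: cvg_EFin; first exact: nearW.
  apply: cvgMl => /=.
  have h : (pot n z)%:E @[n --> \oo] --> (fine (vpot z))%:E.
    rewrite fineK//; exact: (@cvg_inf_range _ _ R pot (pot_dec nu) z).
  exact: (fine_cvg h).
- have iD : leb2.-integrable D (fun z => `|(pot 0%N z)%:E| + `|vpot z|)%E.
    exact: (@integrableD _ _ R leb2 D mD _ _ (integrable_abse (ip 0%N)) (integrable_abse iv)).
  exact: (@integrableZr _ _ R leb2 D mD C _ iD).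
- apply: aeW => z n Dz; rewrite EFinM abseM /g lee_pmul//; last first.
    by case: z Dz => x y [/=]; rewrite !in_itv/= lee_fin; exact: lapC.
  have := vpot_le nu n z; have : pot n z <= pot 0%N z.
    by elim: n => // n; apply: le_trans; exact: pot_dec.
  case: (vpot z) => [v h1 h2|//|_ _] /=; rewrite ?addeNy ?leey//.
  rewrite -EFinD !lee_fin in h1 h2 *.
  have := ler_norm (pot 0%N z); have := ler_norm (- v); rewrite normrN => h3 h4.
  have h5 := normr_ge0 (pot 0%N z); have h6 := normr_ge0 v.
  by rewrite ler_norml; apply/andP; split; lra.
move=> _ _; apply: cvg_trans; apply: near_eq_cvg; apply: nearW => n /=.
have [e _] := swp n.
under eq_Rintegral do rewrite -green.
rewrite -e -Rintegral_box// /Rintegral fineK//.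
by apply: integrable_fin_num => //; exact: integrable_box.
Qed.

End PotentialMeans.

(** * Folding an integral over the plane into one strip *)

Section Periodisation.
Context {R : realType} (mu : {measure set (R * R)%type -> \bar R}).
Hypothesis mu_compact : finite_on_compacts mu.
Implicit Types (f : R * R -> R) (a b c d A : R) (n : nat).

(** Half-open, so that unit slabs tile the plane. *)
Definition slab a b : set (R * R) := [set z | a <= z.1 /\ z.1 < b].

Lemma measurable_slab a b : measurable (slab a b).
Proof.
have : measurable (setT `&` (fst : R * R -> R) @^-1` `[a, b[%classic).
  by apply: measurable_fst => //; exact: measurable_itv.
rewrite setTI; congr measurable; apply/seteqP; split => z /=; rewrite in_itv/=.
  by move/andP.
by case=> -> ->.
Qed.

Definition csupp f A := continuous f /\ forall z, (A < `|z.1|) || (A < `|z.2|) -> f z = 0.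

Definition shiftx f d (z : R * R) : R := f (z.1 + d, z.2).

Lemma csupp_shiftx f A d : csupp f A -> csupp (shiftx f d) (A + `|d|).
Proof.
move=> [cf f0]; split.
  move=> z; apply: (@continuous_comp _ _ _ (fun z : R * R => (z.1 + d, z.2)) f); last exact: cf.
  have c1 : continuous (fun z : R * R => z.1 + d) by cont.
  have c2 : continuous (fun z : R * R => z.2) by cont.
  exact: (cvg_pair (c1 z) (c2 z)).
move=> z h; apply: f0 => /=; case/orP: h => h; apply/orP; [left|right].
  have := ler_normD (z.1 + d) (- d); rewrite addrK normrN; lra.
by have := normr_ge0 d; lra.
Qed.

Lemma shiftx0 f : shiftx f 0 = f.
Proof. by apply/funext => -[x y]; rewrite /shiftx /= addr0. Qed.

Lemma compact_box a b c d : compact (box a b c d).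
Proof. by apply: compact_setX; exact: segment_compact. Qed.

Lemma csupp_integrable f A : csupp f A -> mu.-integrable setT (EFin \o f).
Proof.
move=> [cf f0]; set K := box (- A) A (- A) A.
have mK : measurable K by exact: measurable_box.
have iK : mu.-integrable K (EFin \o f).
  have [C _ fC] := continuous_bounded_box (- A) A (- A) A cf.
  apply: measurable_bounded_integrable.
  - exact: mK.
  - exact: mu_compact (@compact_box _ _ _ _).
  - by apply: measurable_funTS; exact: continuous_measurable_prod.
  - exists C; split; first exact: num_real.
    move=> M /ltW CM [x y] [/= xab ycd]; apply: le_trans CM.
    by move: xab ycd; rewrite !in_itv/=; exact: fC.
move: iK; rewrite integrable_mkcond//; congr (_.-integrable _ _).
apply/funext => z; rewrite patchE; case: ifPn => //; rewrite notin_setE => zK.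
rewrite /= f0//; apply: contra_notT zK; rewrite negb_or -!leNgt => /andP[z1 z2].
by split; rewrite /= in_itv/= -ler_norml.
Qed.

Lemma csupp_integrableS f A D : measurable D -> csupp f A -> mu.-integrable D (EFin \o f).
Proof. by move=> mD /csupp_integrable; apply: integrableS. Qed.

Lemma csupp_slab f A a b : csupp f A -> a <= - A -> A < b ->
  \int[mu]_z f z = \int[mu]_(z in slab a b) f z.
Proof.
move=> [cf f0] aA Ab; rewrite [RHS]Rintegral_mkcond; apply: eq_Rintegral => z _.
rewrite patchE; case: ifPn => //; rewrite notin_setE => zK.
rewrite f0//; apply: contra_notT zK; rewrite negb_or -!leNgt => /andP[+ _].
by rewrite ler_norml => /andP[h1 h2]; rewrite /slab /=; split; lra.
Qed.

Lemma slab_sum f A a n : csupp f A ->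
  \int[mu]_(z in slab a (a + n%:R)) f z =
  \sum_(k < n) \int[mu]_(z in slab (a + k%:R) (a + k%:R + 1)) f z.
Proof.
move=> cf; elim: n => [|n IH].
  rewrite addr0 big_ord0 (_ : slab a a = set0) ?Rintegral_set0//.
  by apply/seteqP; split => // z [h1 h2] /=; lra.
rewrite big_ord_recr /= -IH -Rintegral_setU.
- congr Rintegral; apply/seteqP; split => z /=.
    rewrite -(@natr1 R n) /slab /= => -[h1 h2].
    by case: (ltP z.1 (a + n%:R)) => h; [left|right]; split => //; lra.
  have := ler0n R n.
  by rewrite -(@natr1 R n) /slab /= => h0 [[h1 h2]|[h1 h2]]; split => //; lra.
- exact: measurable_slab.
- exact: measurable_slab.
- by apply: csupp_integrableS cf; apply: measurableU; exact: measurable_slab.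
- by apply/disj_setPS => z [[_ h1] [h2 _]] /=; lra.
Qed.

Hypothesis mu_inv : translation_invariant mu.

Lemma measurable_translate1 : measurable_fun setT (@translate1 R).
Proof.
apply: measurable_fun_pair.
  by apply: measurable_funD => //; exact: measurable_fst.
exact: measurable_snd.
Qed.

Lemma Rintegral_slab_translate f A a b : csupp f A ->
  \int[mu]_(z in slab (a + 1) (b + 1)) f z = \int[mu]_(z in slab a b) shiftx f 1 z.
Proof.
move=> cf; have cf1 := csupp_shiftx 1 cf.
have pre : @translate1 R @^-1` slab (a + 1) (b + 1) = slab a b.
  by apply/seteqP; split => z; rewrite /slab /= => -[h1 h2]; split; lra.
have := @integral_pushforward _ _ _ _ R _ measurable_translate1 mu (slab (a + 1) (b + 1))
  (EFin \o f).
rewrite pre => E; rewrite /Rintegral; congr fine.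
rewrite -E.
- apply: esym; apply: eq_measure_integral; first exact: measurable_translate1.
  by move=> ? B mB _; exact: (mu_inv mB).
- by apply/measurable_EFinP; exact: continuous_measurable_prod (proj1 cf).
- exact: (csupp_integrableS (measurable_slab _ _) cf1).
- exact: measurable_slab.
Qed.

Lemma Rintegral_slab_translaten f A a b d n : csupp f A ->
  \int[mu]_(z in slab (a + n%:R) (b + n%:R)) shiftx f d z =
  \int[mu]_(z in slab a b) shiftx f (d + n%:R) z.
Proof.
move=> cf; elim: n d => [|n IH] d; first by rewrite !addr0.
rewrite -(@natr1 R n) !addrA (Rintegral_slab_translate _ _ (csupp_shiftx d cf)).
rewrite (_ : shiftx (shiftx f d) 1 = shiftx f (d + 1)); last first.
  by apply/funext => z; rewrite /shiftx /= -addrA [1 + d]addrC.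
by rewrite IH addrAC.
Qed.

(** The support is cut into unit slabs from -M to M + 1, each carried to the base strip by
    invariance. The odd number of slabs is due to their being open on the right. *)
Lemma Rintegral_fold f A (M : nat) : csupp f A -> A <= M%:R ->
  \int[mu]_z f z = \sum_(k < M.*2.+1) \int[mu]_(z in slab 0 1) shiftx f (- M%:R + k%:R) z.
Proof.
move=> cf AM; rewrite (csupp_slab (a := - M%:R) (b := - M%:R + M.*2.+1%:R) cf); last 2 first.
- by rewrite lerN2.
- by rewrite -(@natr1 R M.*2) -addnn natrD; lra.
rewrite (slab_sum _ _ cf); apply: eq_bigr => k _.
(* Translations are by natural numbers only, so both sides are brought to the leftmost slab. *)
have := Rintegral_slab_translaten (- M%:R) (- M%:R + 1) (- M%:R + k%:R) M cf.
rewrite addNr addrAC addNr add0r => ->.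
rewrite -[f in LHS]shiftx0 -[- M%:R + k%:R + 1]addrAC (Rintegral_slab_translaten _ _ _ _ cf).
by rewrite add0r addrAC addNr add0r.
Qed.

End Periodisation.

Lemma Rintegral_sum d (T : measurableType d) (R : realType) (m : {measure set T -> \bar R})
    (D : set T) (mD : measurable D) (h : nat -> T -> R) (n : nat) :
  (forall k, m.-integrable D (EFin \o h k)) ->
  m.-integrable D (fun x => (\sum_(k < n) h k x)%:E) /\
  \int[m]_(x in D) (\sum_(k < n) h k x) = \sum_(k < n) \int[m]_(x in D) h k x.
Proof.
move=> ih; elim: n => [|n [IH1 IH2]].
  rewrite big_ord0; under eq_fun do rewrite big_ord0.
  split; first exact: integrable0.
  by under eq_Rintegral do rewrite big_ord0; rewrite Rintegral_cst// mul0r.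
under eq_fun do rewrite big_ord_recr/= EFinD; split; first exact: (integrableD mD IH1 (ih n)).
by under eq_Rintegral do rewrite big_ord_recr; rewrite big_ord_recr /= -IH2 -RintegralD.
Qed.

(** * The Riesz measure of the potential of the strip *)

Section PotentialOfStrip.
Context {R : realType}.

Lemma cvg_eps_ : eps_ n @[n --> \oo] --> (0 : R).
Proof. exact: cvg_harmonic. Qed.

Lemma cells_limit (phi : R * R -> R) (xi : nat -> R) eta (B eps : R) (n : nat) : continuous phi ->
  (forall z, `|phi z| <= B) -> 0 < eps ->
  exists2 T0, 1 <= T0 & forall T, T0 <= T -> exists2 e0, 0 < e0 &
    forall e, 0 < e -> e <= e0 -> e <= 1 ->
      `|\sum_(k < n) cell e T phi (xi k) eta - 2 * pi * \sum_(k < n) phi (xi k, eta)| <= eps * n%:R.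
Proof.
move=> cphi phiB eps0; elim: n => [|n [T1 T11 IH]].
  by exists 1 => // T _; exists 1 => // e _ _ _; rewrite !big_ord0 mulr0 subrr normr0 mulr0.
have [T2 T21 h2] := cell_limit (xi n) eta cphi phiB eps0.
exists (Num.max T1 T2); first by rewrite le_max T11.
move=> T; rewrite ge_max => /andP[/IH[e1 e10 h1] /h2[e2 e20 {}h2]].
exists (Num.min e1 e2); first by rewrite lt_min e10.
move=> e e0; rewrite le_min => /andP[ee1 ee2] le1.
rewrite !big_ord_recr /= mulrDr opprD addrACA -(@natr1 R n) [leRHS]mulrDr mulr1.
by apply: le_trans (ler_normD _ _) _; apply: lerD; [exact: h1|exact: h2].
Qed.

(** For [w] in the strip, N + w.1 is at most N + 1, so 2 (N + 1) + 1 cells cover the support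
    whatever [w] is. The height [T] may depend on [w], the convergence being pointwise. *)
Lemma smoothed_cvg (phi : R * R -> R) (N : nat) (w : R * R) (B : R) : continuous phi ->
  (forall z, `|phi z| <= B) ->
  (forall z, (N%:R < `|z.1|) || (N%:R < `|z.2|) -> phi z = 0) -> 0 <= w.1 < 1 ->
  itg2 (- N%:R) N%:R (- N%:R) N%:R (fun z => P (eps_ n) (z.1 - w.1)
    (z.2 - w.2) * phi z) @[n --> \oo] -->
  2 * pi * \sum_(k < N.+1.*2.+1) phi (w.1 - N.+1%:R + k%:R, w.2).
Proof.
move=> cphi phiB phi0 /andP[w0 w1]; apply/cvgrPdist_le => eps eps0.
set m := N.+1.*2.+1.
have [T0 T01 h] := cells_limit (fun k => w.1 - N.+1%:R + k%:R) w.2 m cphi phiB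
  (divr_gt0 eps0 (ltr0Sn R N.+1.*2)).
have Nw := normr_ge0 w.2.
pose T := Num.max T0 (N%:R + `|w.2|).
have [|e0 e00 {}h] := h T; first by rewrite le_max lexx.
near=> n.
rewrite (P_cells (M := N.+1) (T := T) (eps_gt0 n) (ler0n R N) cphi phi0); last 2 first.
- by rewrite (ger0_norm w0) -(@natr1 R N) lerD2l ltW.
- by rewrite le_max lexx orbT.
rewrite distrC; apply: le_trans (h (eps_ n) (eps_gt0 n) _ (eps_le1 n)) _.
  near: n; have /cvgrPdist_le/(_ _ e00) := cvg_eps_.
  by apply: filterS => n; rewrite sub0r normrN (ger0_norm (ltW (eps_gt0 n))).
by rewrite divfK.
Unshelve. all: by end_near.
Qed.

(** Provides the dominating constant on the strip: the height of the cells depends on [w], but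
    [cell_bound] does not depend on the height. *)
Lemma smoothed_bound (phi : R * R -> R) (N n : nat) (w : R * R) (B : R) : continuous phi ->
  (forall z, `|phi z| <= B) ->
  (forall z, (N%:R < `|z.1|) || (N%:R < `|z.2|) -> phi z = 0) -> 0 <= w.1 < 1 ->
  `|itg2 (- N%:R) N%:R (- N%:R) N%:R (fun z => P (eps_ n) (z.1 - w.1) (z.2 - w.2) * phi z)| <=
  B * (2 * pi + 12) * N.+1.*2.+1%:R.
Proof.
move=> cphi phiB phi0 /andP[w0 w1].
have Nw := normr_ge0 w.2.
have N0 : 0 <= N%:R :> R by [].
rewrite (P_cells (M := N.+1) (T := 1 + (N%:R + `|w.2|)) (eps_gt0 n) N0 cphi phi0); last 2 first.
- by rewrite (ger0_norm w0) -(@natr1 R N) lerD2l ltW.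
- by rewrite lerDr.
apply: le_trans (ler_norm_sum _ _ _) _.
apply: (@le_trans _ _ (\sum_(k < N.+1.*2.+1) B * (2 * pi + 12))); last first.
  by rewrite sumr_const card_ord mulr_natr.
apply: ler_sum => k _; apply: cell_bound => //; [exact: eps_gt0|exact: eps_le1|lra].
Qed.

Variable mu : {measure set (R * R)%type -> \bar R}.
Hypothesis mu_compact : finite_on_compacts mu.
Hypothesis mu_inv : translation_invariant mu.
Hypothesis strip_fin : (mu (slab 0 1) < +oo)%E.

Let mS : measurable (slab 0 1 : set (R * R)) := measurable_slab 0 1.
Let nu : {finite_measure set (R * R)%type -> \bar R} := mfrestr mS strip_fin.

Lemma Rintegral_restr (h : R * R -> R) : nu.-integrable setT (EFin \o h) ->
  \int[nu]_w h w = \int[mu]_(w in slab 0 1) h w.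
Proof.
move=> ih; have mSC := measurableC mS.
rewrite -(setUv (slab 0 1)) Rintegral_setU ?setUv//; last exact/disj_setPCl.
rewrite (_ : \int[nu]_(x in ~` _) _ = 0) ?addr0; last first.
  rewrite /Rintegral (eq_measure_integral mzero) ?integral_measure_zero// => A mA AS.
  by rewrite /nu /= /mfrestr /mrestr /= (_ : A `&` slab 0 1 = set0) ?measure0//; apply/seteqP;
    split => // z [/AS].
congr fine; apply: eq_measure_integral => A mA AS.
by rewrite /nu /= /mfrestr /mrestr /= setIidl.
Qed.

Lemma bounded_integrable_strip (h : R * R -> R) (B : R) : measurable_fun setT h ->
  (forall w, slab 0 1 w -> `|h w| <= B) -> mu.-integrable (slab 0 1) (EFin \o h).
Proof.
move=> mh hB; apply: measurable_bounded_integrable.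
- exact: mS.
- exact: strip_fin.
- exact: measurable_funTS.
- by exists B; split => [|M /ltW BM w wS]; [exact: num_real|apply: le_trans BM; exact: hB].
Qed.

(** The same sequence is shown to converge to the integral of [vpot] against the laplacian and, by
    dominated convergence on the strip, to the integral of [g]. Folding identifies the latter with 2
    pi times the integral of [phi] against [mu]. *)
Lemma vpot_riesz : riesz_measure (vpot nu) mu.
Proof.
move=> phi tphi; have p20 : 0 < 2 * pi :> R by rewrite mulr_gt0// pi_gt0.
have cphi := C2_cont (test_function_C2 tphi).
have [A A0 phi0] := test_function_support tphi.
(* Strictly above [A], so that [phi] and its derivatives vanish on the sides of the square too,
   where Green's identity has its boundary terms. *)
pose N := (Num.trunc A).+1.
have AN : A < N%:R by have /andP[_] := truncn_itv (ltW A0).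
have [inu lim] := vpot_riesz_limit nu tphi (N := N) (fun z h =>
  phi0 z (match orP h with or_introl h => introT orP (or_introl (lt_le_trans AN h))
    | or_intror h => introT orP (or_intror (lt_le_trans AN h)) end)).
have phi0N z : (N%:R < `|z.1|) || (N%:R < `|z.2|) -> phi z = 0.
  by move=> h; have [|->] := phi0 z => //; case/orP: h => h; rewrite (lt_trans AN h) ?orbT.
have csphi : csupp phi N%:R by [].
have [B phiB] : exists B, forall z, `|phi z| <= B.
  have [B B0 phiB] := continuous_bounded_box (- N%:R) N%:R (- N%:R) N%:R cphi.
  exists B => z; case: (boolP ((N%:R < `|z.1|) || (N%:R < `|z.2|))) => [/phi0N->|].
    by rewrite normr0.
  by rewrite negb_or -!leNgt => /andP[z1 z2]; rewrite !ler_norml in z1 z2;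
    case: z z1 z2 => x y; exact: phiB.
pose K := B * (2 * pi + 12) * N.+1.*2.+1%:R.
pose g w := 2 * pi * \sum_(k < N.+1.*2.+1) shiftx phi (- N.+1%:R + k%:R) w.
have is_k (k : nat) : mu.-integrable (slab 0 1) (EFin \o shiftx phi (- N.+1%:R + k%:R)).
  exact (csupp_integrableS mu_compact mS (csupp_shiftx (- N.+1%:R + k%:R) csphi)).
have lim2 : (\int[mu]_(w in slab 0 1) (itg2 (- N%:R) N%:R (- N%:R) N%:R
     (fun z => P (eps_ n) (z.1 - w.1) (z.2 - w.2) * phi z))%:E)%E @[n --> \oo] -->
     (\int[mu]_(w in slab 0 1) (g w)%:E)%E.
  apply: (@dominated_cvg _ _ R mu _ mS _ _ (fun=> K%:E)).
  - by move=> n; exact: (measurable_funTS (measurable_int _ (inu n))).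
  - move=> w wS; apply: cvg_EFin; first exact: nearW.
    rewrite /g; under eq_bigr do rewrite /shiftx addrA.
    exact: (smoothed_cvg cphi phiB phi0N (introT andP wS)).
  - by [].
  - exact: (bounded_integrable_strip (h := fun=> K) (B := `|K|)).
  - by move=> n w wS; rewrite lee_fin; exact: (smoothed_bound n cphi phiB phi0N (introT andP wS)).
have [ish sumE] := Rintegral_sum mS N.+1.*2.+1 is_k.
have ig : mu.-integrable (slab 0 1) (EFin \o g) by exact: (integrableZl mS (2 * pi) ish).
have E n : (\int[nu]_w itg2 (- N%:R) N%:R (- N%:R) N%:R
      (fun z => P (eps_ n) (z.1 - w.1) (z.2 - w.2) * phi z))%:E =
    (\int[mu]_(w in slab 0 1) (itg2 (- N%:R) N%:R (- N%:R) N%:R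
      (fun z => P (eps_ n) (z.1 - w.1) (z.2 - w.2) * phi z))%:E)%E.
  rewrite (Rintegral_restr (inu n)) /Rintegral fineK//.
  apply: integrable_fin_num; first exact: mS.
  apply: (bounded_integrable_strip (B := K)).
    by apply/measurable_EFinP; exact: (measurable_int _ (inu n)).
  by move=> w wS; exact: (smoothed_bound n cphi phiB phi0N (introT andP wS)).
rewrite (funext E) in lim.
rewrite [X in (_ * X)%E](cvg_unique (@ereal_hausdorff R) lim lim2).
rewrite -[in LHS](fineK (integrable_fin_num mS ig)) -/(Rintegral _ _ _).
rewrite RintegralZl// sumE -(Rintegral_fold mu_compact mu_inv csphi); last by rewrite ler_nat.
rewrite -EFinM mulKf ?gt_eqF// /Rintegral fineK//.
by apply: integrable_fin_num => //; exact: (csupp_integrable mu_compact csphi).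
Qed.

Lemma periodic_potential_exists : exists v : R * R -> \bar R,
  [/\ subharmonic v, riesz_measure v mu, periodic1 v & at_most_linear_growth v].
Proof.
exists (vpot nu); split.
- exact: vpot_subharmonic.
- exact: vpot_riesz.
- exact: vpot_per.
- exact: vpot_growth.
Qed.

End PotentialOfStrip.

(** * Smooth cutoffs and tensor test functions *)

Section SmoothFunctions.
Context {R : realType}.
Implicit Types (f g : R -> R) (x y : R) (n k : nat).

Fixpoint Cn n f : Prop :=
  match n with
  | 0 => continuous f
  | n.+1 => exists2 f' : R -> R, der f f' & Cn n f'
  end.

Definition smooth f := forall n, Cn n f.

Lemma CnS n f : Cn n.+1 f -> Cn n f.
Proof.
elim: n f => [|n IH] f [f' df cf]; first exact: der_cont df.
by exists f' => //; exact: IH.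
Qed.

Lemma Cn_cst n (c : R) : Cn n (fun=> c).
Proof. by elim: n c => [|n IH] c; [exact: cont_cst|exists (fun=> 0); [exact: der_cst|]]. Qed.

Lemma Cn_add n f g : Cn n f -> Cn n g -> Cn n (fun x => f x + g x).
Proof.
elim: n f g => [|n IH] f g; first exact: cont_add.
move=> [f' df cf] [g' dg cg]; exists (fun x => f' x + g' x); [exact: der_add|exact: IH].
Qed.

Lemma Cn_opp n f : Cn n f -> Cn n (fun x => - f x).
Proof.
elim: n f => [|n IH] f; first exact: cont_opp.
move=> [f' df cf]; exists (fun x => - f' x); [exact: der_opp|exact: IH].
Qed.

Lemma Cn_mul n f g : Cn n f -> Cn n g -> Cn n (fun x => f x * g x).
Proof.
elim: n f g => [|n IH] f g; first exact: cont_mul.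
move=> sf sg; have := CnS sf; have := CnS sg.
case: sf sg => [f' df cf] [g' dg cg] cg0 cf0.
exists (fun x => f' x * g x + f x * g' x); first exact: der_mul.
by apply: Cn_add; exact: IH.
Qed.

Lemma der_affine (m b : R) : der (fun x => m * x + b) (fun=> m).
Proof.
apply: der_eq; first exact: (der_add (der_mul (der_cst m) (@der_id R)) (der_cst b)).
by move=> x /=; rewrite mul0r add0r mulr1 addr0.
Qed.

Lemma Cn_affine n f (m b : R) : Cn n f -> Cn n (fun x => f (m * x + b)).
Proof.
elim: n f => [|n IH] f.
  by move=> cf; apply: cont_comp => //; exact: der_cont (der_affine m b).
move=> [f' df cf]; exists (fun x => f' (m * x + b) * m).
  exact: (der_comp df (der_affine m b)).
by apply: Cn_mul; [exact: IH|exact: Cn_cst].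
Qed.

Lemma smooth_der f : smooth f -> exists2 f' : R -> R, der f f' & smooth f'.
Proof.
move=> sf; have [f' df _] := sf 1%N; exists f' => // n.
have [g dg cg] := sf n.+1; suff -> : f' = g by [].
by apply/funext => x; rewrite -(derive_val (is_derive := df x)) -(derive_val (is_derive := dg x)).
Qed.

Lemma der_smooth f f' : der f f' -> smooth f' -> smooth f.
Proof. by move=> df sf' [|n]; [exact: der_cont df|exists f']. Qed.

Lemma smooth_cont f : smooth f -> continuous f.
Proof. by move=> /(_ 0%N). Qed.

End SmoothFunctions.

Section FlatFunction.
Context {R : realType}.
Implicit Types (x y : R) (n k : nat).

(** The extra powers of 1 / x make the span of the family stable under differentiation, so that
    smoothness of all members follows by one induction. *)
Definition flat k x : R := if 0 < x then x^-1 ^+ k * expR (- x^-1) else 0.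

Lemma flat_ge0 k x : 0 <= flat k x.
Proof.
by rewrite /flat; case: ifP => // x0; rewrite mulr_ge0 ?expR_ge0// exprn_ge0// invr_ge0 ltW.
Qed.

Lemma flat_le0 k x : x <= 0 -> flat k x = 0.
Proof. by rewrite /flat leNgt => /negbTE ->. Qed.

(** With m = k + 2 and y = 1 / x, [1 + y / m <= expR (y / m)] gives [y ^+ m <= m ^+ m * expR y]. The
    two spare powers make the bound quadratic, whence the zero derivative at 0. *)
Lemma flat_le k x : flat k x <= k.+2%:R ^+ k.+2 * x ^+ 2.
Proof.
rewrite /flat; case: ifPn => x0; last by rewrite mulr_ge0 ?sqr_ge0.
set m := k.+2; have m0 : 0 < m%:R :> R by rewrite ltr0n.
set y := x^-1; have y0 : 0 < y by rewrite invr_gt0.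
have xy : x * y = 1 by rewrite divff// gt_eqF.
have e : expR y = expR (y / m%:R) ^+ m by rewrite -expRM_natr divfK// gt_eqF.
have h : y ^+ m <= m%:R ^+ m * expR y.
  rewrite e -exprMn; apply: lerXn2r; rewrite ?nnegrE ?mulr_ge0 ?expR_ge0 ?(ltW y0)//.
  by rewrite -ler_pdivrMl// [_^-1 * y]mulrC; apply: le_trans (expR_ge1Dx _); lra.
have -> : y ^+ k = y ^+ m * x ^+ 2.
  by rewrite /m -addn2 exprD -mulrA -exprMn [y * x]mulrC xy expr1n mulr1.
rewrite mulrAC; apply: ler_wpM2r; first exact: sqr_ge0.
by rewrite expRN ler_pdivrMr// expR_gt0.
Qed.

Lemma flat_der0 k : is_derive (0 : R) 1 (flat k) 0.
Proof.
have h : (h^-1 *: ((flat k \o shift 0) (h *: 1) - flat k 0)) @[h --> 0^'] --> (0 : R).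
  apply/cvgrPdist_le => e e0; set C := k.+2%:R ^+ k.+2 : R.
  have C0 : 0 < C by rewrite exprn_gt0// ltr0n.
  have : \forall t \near (0 : R), `|t| <= e / C.
    have /cvgrPdist_le/(_ (e / C) (divr_gt0 e0 C0)) := @cvg_id _ (nbhs (0 : R)).
    by apply: filterS => t; rewrite sub0r normrN.
  move=> /nbhs_dnbhs; apply: filter_app; near=> t => te.
  rewrite sub0r normrN /= [flat k 0]flat_le0// subr0 addr0 normrZ normfV.
  have t0 : 0 < `|t| by rewrite normr_gt0; near: t; exact: nbhs_dnbhs_neq.
  rewrite mulrC ler_pdivrMr// (ger0_norm (flat_ge0 _ _)) [t *: 1]mulr1.
  apply: le_trans (flat_le k t) _; rewrite -/C -real_normK ?num_real// expr2 mulrA ler_wpM2r//.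
  by move: te; rewrite ler_pdivlMr// mulrC.
by apply: DeriveDef; [apply/cvg_ex; exists 0; exact: h|exact: cvg_lim h].
Unshelve. all: by end_near.
Qed.

Lemma flat_der k : der (flat k) (fun x => flat k.+2 x - k%:R * flat k.+1 x).
Proof.
move=> x; have [x0|x0|->] := ltgtP x 0.
- rewrite !flat_le0 ?(ltW x0)// mulr0 subr0; apply: near_eq_is_derive (is_derive_cst 0 x 1).
  by apply: filterS (lt_nbhsl x0) => y y0; rewrite flat_le0// ltW.
- pose f (y : R) := y^-1 ^+ k * expR (- y^-1).
  have df : is_derive x 1 f (flat k.+2 x - k%:R * flat k.+1 x).
    have x1 : x != 0 by rewrite gt_eqF.
    have dV : is_derive x 1 (fun y : R => y^-1) (- x ^- 2).
      by have := is_deriveV (f := id) x1 (is_derive_id x 1); rewrite [_ *: _]mulr1.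
    have dX := is_deriveX k dV; have dE := is_derive1_comp (is_derive_expR _) (is_deriveN dV).
    have E : (fun y : R => y^-1) ^+ k = (fun y : R => y^-1 ^+ k).
      by apply/funext => y; rewrite exprfctE.
    rewrite E in dX; have h := is_deriveM dX dE.
    rewrite (_ : flat k.+2 x - k%:R * flat k.+1 x = x^-1 ^+ k * (expR (- x^-1) * - - x ^- 2) +
      expR (- x^-1) * ((k%:R * x^-1 ^+ k.-1) * - x ^- 2)); first exact: h.
    rewrite /flat x0 opprK.
    by case: k {h dX E f} => [|j] /=; rewrite ?mul0r ?exprS ?expr0; field.
  apply: near_eq_is_derive df.
  by apply: filterS (lt_nbhsr x0) => y y0; rewrite /flat y0.
- rewrite !flat_le0// mulr0 subr0; exact: flat_der0.
Qed.

Lemma flat_smooth k : smooth (flat k).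
Proof.
move=> n; elim: n k => [|n IH] k; first exact: der_cont (@flat_der k).
exists (fun x => flat k.+2 x - k%:R * flat k.+1 x); first exact: flat_der.
by apply: Cn_add => //; apply: Cn_opp; apply: Cn_mul => //; exact: Cn_cst.
Qed.

End FlatFunction.

Section BumpStepRamp.
Context {R : realType}.
Implicit Types (f : R -> R) (x y : R).

(** To the left of -1 the integral is locally zero, also below -2, where the segment is empty; from
    -1 on, the base point -2 lies strictly to the left and the fundamental theorem applies. *)
Lemma antider_der f : continuous f -> (forall x, x <= -1 -> f x = 0) ->
  der (fun x => itg (- 2) x f) f.
Proof.
move=> cf f0 x; case: (ltP x (-1)) => x1.
  rewrite f0 ?(ltW x1)//; apply: near_eq_is_derive (is_derive_cst 0 x 1).
  apply: filterS (lt_nbhsl x1) => y y1.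
  rewrite -(itg0 (- 2) y); apply: eq_itg => t /andP[_ ty]; rewrite f0//.
  by rewrite (le_trans ty)// ltW.
have x2 : - 2 < x by lra.
have xx : x < x + 1 by lra.
have [] := continuous_FTC1_closed xx (cont_integrable (- 2) (x + 1) cf) x2 (cf x).
by move=> df e; apply: DeriveDef; [exact: df|rewrite -derive1E].
Qed.

Lemma antider_le0 f x : (forall x, x <= -1 -> f x = 0) -> x <= -1 -> itg (- 2) x f = 0.
Proof.
move=> f0 x1; rewrite -(itg0 (- 2) x); apply: eq_itg => t /andP[_ tx].
by rewrite f0// (le_trans tx).
Qed.

Definition bump0 x : R := flat 0 (x + 1) * flat 0 (1 - x).

Lemma bump0_smooth : smooth bump0.
Proof.
move=> n; apply: Cn_mul.
  by have := Cn_affine 1 1 (@flat_smooth R 0 n); under eq_fun do rewrite mul1r.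
by have := Cn_affine (-1) 1 (@flat_smooth R 0 n); under eq_fun do rewrite mulN1r addrC.
Qed.

Lemma bump0_ge0 x : 0 <= bump0 x.
Proof. by rewrite mulr_ge0// flat_ge0. Qed.

Lemma bump0_eq0 x : 1 <= `|x| -> bump0 x = 0.
Proof.
rewrite ler_normr => /orP[] h; rewrite /bump0.
  by rewrite [X in _ * X]flat_le0 ?mulr0//; lra.
by rewrite [X in X * _]flat_le0 ?mul0r//; lra.
Qed.

Lemma bump0_le0 x : x <= -1 -> bump0 x = 0.
Proof. by move=> x1; rewrite bump0_eq0// ler0_norm; lra. Qed.

Definition step0 x : R := itg (- 2) x bump0.

Lemma step0_der : der step0 bump0.
Proof. by apply: antider_der; [exact: smooth_cont bump0_smooth|exact: bump0_le0]. Qed.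

Lemma step0_ge1 x : 1 <= x -> step0 x = step0 1.
Proof.
move=> x1; have cb := smooth_cont bump0_smooth.
have h : - 2 <= 1 :> R by lra.
rewrite /step0 (itg_split cb h x1).
rewrite [X in _ + X](_ : _ = 0) ?addr0// -[RHS](itg0 1 x); apply: eq_itg => t /andP[t1 _].
by rewrite bump0_eq0// ger0_norm//; lra.
Qed.

Lemma step0_gt0 : 0 < step0 1.
Proof.
have cb := smooth_cont bump0_smooth.
have b0 : 0 < bump0 0.
  by rewrite /bump0 add0r subr0 /flat ltr01 !mulr_gt0// ?expR_gt0// expr0.
have [e /andP[e0 e1] be] : exists2 e, 0 < e <= 1 & forall t, 0 <= t <= e -> bump0 0 / 2 <= bump0 t.
  have b2 : 0 < bump0 0 / 2 by lra.
  have /cvgrPdist_lt/(_ _ b2) := cb 0.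
  move=> /nbhs_ballP[d /= d0 h]; exists (Num.min (d / 2) 1).
    by rewrite lt_min ltr01 ge_min lexx orbT !andbT divr_gt0.
  move=> t /andP[t0]; rewrite le_min => /andP[td _]; have : `|bump0 0 - bump0 t| < bump0 0 / 2.
    by apply: h; rewrite /ball /= sub0r normrN ger0_norm//; lra.
  by rewrite ltr_norml => /andP[_ ?]; lra.
have cc : continuous (fun _ : R => bump0 0 / 2) by exact: cont_cst.
have h1 : 0 <= itg (- 2) 0 bump0 by apply: itg_ge0 => // t _; exact: bump0_ge0.
have h3 : 0 <= itg e 1 bump0 by apply: itg_ge0 => // t _; exact: bump0_ge0.
have h2 : e * (bump0 0 / 2) <= itg 0 e bump0.
  have := le_itg (a := 0) (b := e) cc cb be; rewrite itg_cst ?(ltW e0)// subr0 mulrC; exact.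
rewrite /step0 (itg_split (b := 0) cb) //; try lra.
rewrite [X in _ + X](itg_split (b := e) cb) //; try lra.
have h4 : 0 < e * (bump0 0 / 2) by rewrite mulr_gt0// divr_gt0.
move: h1 h2 h3 h4; move: (itg _ 0 _) (itg _ e _) (itg _ 1 _) (e * _) => p q r u; lra.
Qed.

(** [bump], [step] and [ramp] smooth the point mass at 0, the Heaviside function and the positive
    part; each is the derivative of the next. *)
Definition bump x : R := bump0 x / step0 1.
Definition step x : R := step0 x / step0 1.
Definition ramp x : R := itg (- 2) x step.

Lemma bump_smooth : smooth bump.
Proof. by move=> n; apply: Cn_mul; [exact: bump0_smooth|exact: Cn_cst]. Qed.

Lemma bump_ge0 x : 0 <= bump x.
Proof. by rewrite /bump divr_ge0 ?bump0_ge0// ltW// step0_gt0. Qed.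

Lemma bump_eq0 x : 1 <= `|x| -> bump x = 0.
Proof. by move=> x1; rewrite /bump bump0_eq0// mul0r. Qed.

Lemma step_der : der step bump.
Proof.
apply: der_eq; first exact: (der_mul step0_der (der_cst (step0 1)^-1)).
by move=> x /=; rewrite mulr0 addr0.
Qed.

Lemma step_smooth : smooth step.
Proof. exact: der_smooth step_der bump_smooth. Qed.

Lemma step_le0 x : x <= -1 -> step x = 0.
Proof. by move=> x1; rewrite /step /step0 antider_le0 ?mul0r//; exact: bump0_le0. Qed.

Lemma step_ge1 x : 1 <= x -> step x = 1.
Proof. by move=> x1; rewrite /step step0_ge1// divff// gt_eqF// step0_gt0. Qed.

Lemma der_ndecr (f f' : R -> R) x y : der f f' -> continuous f' -> (forall t, 0 <= f' t) ->
  x <= y -> f x <= f y.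
Proof.
by move=> df cf f0 xy; rewrite -subr_ge0 -(itg_ftc xy df cf); apply: itg_ge0.
Qed.

Lemma step_ndecr x y : x <= y -> step x <= step y.
Proof.
by apply: der_ndecr; [exact: step_der|exact: smooth_cont bump_smooth|exact: bump_ge0].
Qed.

Lemma step_ge0 x : 0 <= step x.
Proof.
case: (leP x (-1)) => [/step_le0->//|x1].
by rewrite -(step_le0 (lexx (-1))); apply: step_ndecr; exact: ltW.
Qed.

Lemma step_le1 x : step x <= 1.
Proof.
case: (leP 1 x) => [/step_ge1->//|x1].
by rewrite -(step_ge1 (lexx 1)); apply: step_ndecr; exact: ltW.
Qed.

Lemma ramp_der : der ramp step.
Proof. by apply: antider_der; [exact: smooth_cont step_smooth|exact: step_le0]. Qed.

Lemma ramp_smooth : smooth ramp.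
Proof. exact: der_smooth ramp_der step_smooth. Qed.

Lemma ramp_le0 x : x <= -1 -> ramp x = 0.
Proof. by move=> x1; rewrite /ramp antider_le0//; exact: step_le0. Qed.

Lemma rampB x y : x <= y -> ramp y - ramp x = itg x y step.
Proof.
by move=> xy; rewrite (itg_ftc xy ramp_der)//; exact: smooth_cont step_smooth.
Qed.

Lemma ramp_ge1 x : 1 <= x -> ramp x = ramp 1 + (x - 1).
Proof.
move=> x1; rewrite -[LHS](subrK (ramp 1)) (rampB x1) addrC; congr (_ + _).
rewrite (@eq_itg _ (fun=> 1)); last by move=> t /andP[t1 _]; rewrite step_ge1.
by rewrite itg_cst// mul1r.
Qed.

Lemma ramp_ge0 x : 0 <= ramp x.
Proof.
case: (leP x (-1)) => [/ramp_le0->//|/ltW x1].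
have -> : ramp x = itg (-1) x step by rewrite -(rampB x1) (ramp_le0 (lexx (-1))) subr0.
apply: itg_ge0 => // t _.
exact: step_ge0.
Qed.

Lemma ramp_ge x : x - 1 <= ramp x.
Proof.
case: (leP 1 x) => x1; last by apply: le_trans (ramp_ge0 x); lra.
by rewrite ramp_ge1// lerDr ramp_ge0.
Qed.

Lemma ramp_le x : ramp x <= Num.max (x + 1) 0.
Proof.
case: (leP x (-1)) => [/ramp_le0->|/ltW x1]; first by rewrite le_max lexx orbT.
rewrite le_max; apply/orP; left.
have -> : ramp x = itg (-1) x step by rewrite -(rampB x1) (ramp_le0 (lexx (-1))) subr0.
have c1 : continuous (fun _ : R => 1 : R) by exact: cont_cst.
have := le_itg (smooth_cont step_smooth) c1 (fun t _ => step_le1 t) (a := -1) (b := x).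
by rewrite itg_cst// mul1r opprK; exact.
Qed.

(** Kept generic in [f] because it commutes with differentiation: two derivatives of the tent give
    the second difference of [bump]. *)
Definition second_diff (f : R -> R) r y : R := f (y + r) + f (y - r) - 2 * f y.

Definition tent (r : R) := second_diff ramp r.

(** Convexity of [ramp]: its increments to the right and to the left of y are compared with the
    slope [step y]. *)
Lemma tent_ge0 r y : 0 <= r -> 0 <= tent r y.
Proof.
move=> r0; have cs := smooth_cont step_smooth.
have cc : continuous (fun _ : R => step y) by exact: cont_cst.
have h1 : r * step y <= ramp (y + r) - ramp y.
  have yr : y <= y + r by lra.
  rewrite (rampB yr); have := le_itg cc cs (a := y) (b := y + r).
  rewrite itg_cst// addrAC subrr add0r mulrC; apply=> t /andP[yt _]; exact: step_ndecr.
have h2 : ramp y - ramp (y - r) <= r * step y.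
  have yr : y - r <= y by lra.
  rewrite (rampB yr); have := le_itg cs cc (a := y - r) (b := y).
  rewrite itg_cst// opprB addrCA subrr addr0 mulrC; apply=> t /andP[_ yt]; exact: step_ndecr.
rewrite /tent /second_diff; move: h1 h2; move: (ramp _) (ramp _) (ramp _) (r * _) => p q s t; lra.
Qed.

Lemma tent_eq0 r y : 0 <= r -> r + 1 <= `|y| -> tent r y = 0.
Proof.
move=> r0; rewrite ler_normr => /orP[] h; rewrite /tent /second_diff.
  rewrite (@ramp_ge1 y) ?(@ramp_ge1 (y + r)) ?(@ramp_ge1 (y - r)); first by ring.
  - by lra.
  - by lra.
  - by lra.
rewrite (@ramp_le0 y) ?(@ramp_le0 (y + r)) ?(@ramp_le0 (y - r)); first by ring.
- by lra.
- by lra.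
- by lra.
Qed.

(** [ramp] differs from the positive part by at most 1; the 3 collects one such error at y + r and
    two at y. *)
Lemma tent_ge r y : r - `|y| - 3 <= tent r y.
Proof.
rewrite /tent /second_diff; have := ramp_ge (y + r); have := ramp_ge0 (y - r); have := ramp_le y.
have := ramp_ge0 y; have := ramp_ge0 (y + r).
have := ler_norm y; have := ler_norm (- y); rewrite normrN.
by rewrite maxEle; case: ifPn; rewrite -?ltNge => ?; lra.
Qed.

Lemma der_shift (f f' : R -> R) r : der f f' -> der (fun y => f (y + r)) (fun y => f' (y + r)).
Proof.
move=> df; have := der_comp df (der_affine 1 r).
by under [in X in der X _]eq_fun do rewrite mul1r;
  under [in X in der _ X]eq_fun do rewrite mul1r mulr1.
Qed.

Lemma smooth_shift (f : R -> R) r : smooth f -> smooth (fun y => f (y + r)).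
Proof. by move=> sf n; have := Cn_affine 1 r (sf n); under eq_fun do rewrite mul1r. Qed.

Lemma second_diff_der (f f' : R -> R) r : der f f' -> der (second_diff f r) (second_diff f' r).
Proof.
move=> df; apply: der_eq.
  exact: (der_add (der_add (der_shift r df) (der_shift (- r) df))
    (der_opp (der_mul (der_cst 2) df))).
by move=> x /=; rewrite mul0r add0r.
Qed.

Lemma smooth_second_diff (f : R -> R) r : smooth f -> smooth (second_diff f r).
Proof.
move=> sf n; apply: Cn_add; first by apply: Cn_add; exact: smooth_shift.
by apply: Cn_opp; apply: Cn_mul; [exact: Cn_cst|exact: sf].
Qed.

Definition plateau (p q : R) x : R := step (x - p) - step (x - q).

Lemma plateau_der p q : der (plateau p q) (fun x => bump (x - p) - bump (x - q)).
Proof. exact: (der_add (der_shift (- p) step_der) (der_opp (der_shift (- q) step_der))). Qed.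

Lemma plateau_smooth p q : smooth (plateau p q).
Proof.
move=> n; apply: Cn_add; first exact: smooth_shift step_smooth n.
by apply: Cn_opp; exact: smooth_shift step_smooth n.
Qed.

Lemma plateau_ge0 p q x : p <= q -> 0 <= plateau p q x.
Proof. by move=> pq; rewrite subr_ge0 step_ndecr//; lra. Qed.

Lemma plateau_eq1 p q x : p + 1 <= x <= q - 1 -> plateau p q x = 1.
Proof.
by move=> /andP[h1 h2]; rewrite /plateau step_ge1 ?step_le0 ?subr0//; lra.
Qed.

Lemma plateau_eq0 p q x : p <= q -> (x <= p - 1) || (q + 1 <= x) -> plateau p q x = 0.
Proof.
by move=> pq /orP[] h; rewrite /plateau; [rewrite !step_le0|rewrite !step_ge1];
  rewrite ?subrr//; lra.
Qed.

End BumpStepRamp.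

Section TensorTests.
Context {R : realType}.
Implicit Types (a b : R -> R) (phi : R * R -> R).

Lemma dx_der phi phix : (forall y, der (fun x => phi (x, y)) (fun x => phix (x, y))) ->
  (forall z, derivable phi z (1, 0)) /\ d_x phi = phix.
Proof.
move=> dphi.
split; first by move=> [x y]; have [+ _] := dphi y x; rewrite /derivable diff_quotient_x.
by apply/funext => -[x y]; have [_ +] := dphi y x; rewrite /derive diff_quotient_x.
Qed.

Lemma dy_der phi phiy : (forall x, der (fun y => phi (x, y)) (fun y => phiy (x, y))) ->
  (forall z, derivable phi z (0, 1)) /\ d_y phi = phiy.
Proof.
move=> dphi.
split; first by move=> [x y]; have [+ _] := dphi x y; rewrite /derivable diff_quotient_y.
by apply/funext => -[x y]; have [_ +] := dphi x y; rewrite /derive diff_quotient_y.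
Qed.

Definition tens a b (z : R * R) : R := a z.1 * b z.2.

Lemma tens_dx a a' b : der a a' ->
  (forall z, derivable (tens a b) z (1, 0)) /\ d_x (tens a b) = tens a' b.
Proof.
move=> da; apply: dx_der => y; rewrite /tens /=.
by apply: der_eq (der_mul da (der_cst (b y))) _ => x /=; rewrite mulr0 addr0.
Qed.

Lemma tens_dy a b b' : der b b' ->
  (forall z, derivable (tens a b) z (0, 1)) /\ d_y (tens a b) = tens a b'.
Proof.
move=> db; apply: dy_der => x; rewrite /tens /=.
by apply: der_eq (der_mul (der_cst (a x)) db) _ => y /=; rewrite mul0r add0r.
Qed.

Lemma tens_cont a b : continuous a -> continuous b -> continuous (tens a b).
Proof.
by move=> ca cb; apply: cont_mul; [exact: cont_comp ca cont_fst|exact: cont_comp cb cont_snd].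
Qed.

Lemma tens_Ck k a b : smooth a -> smooth b -> Ck k (tens a b).
Proof.
elim: k a b => [|k IH] a b sa sb; first by apply: tens_cont; exact: smooth_cont.
have [a' da sa'] := smooth_der sa; have [b' db sb'] := smooth_der sb.
have [dx dxE] := tens_dx b da; have [dy dyE] := tens_dy a db.
by split => //; rewrite ?dxE ?dyE; exact: IH.
Qed.

Lemma csupp_test_function (phi : R * R -> R) A : (forall k, Ck k phi) ->
  (forall z, (A < `|z.1|) || (A < `|z.2|) -> phi z = 0) -> test_function phi.
Proof.
move=> Cphi phi0; split=> //.
have cB : compact (box (- A) A (- A) A) by exact: compact_box.
apply: (subclosed_compact _ cB); first exact: closed_closure.
have clB := compact_closed (@norm_hausdorff _ _) cB.
rewrite (closure_id (box (- A) A (- A) A)).1//; apply: closure_subset => z /= nz.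
have : ~~ ((A < `|z.1|) || (A < `|z.2|)) by apply: contraNN nz => /phi0 ->.
by rewrite negb_or -!leNgt !ler_norml => /andP[h1 h2]; split; rewrite /= in_itv.
Qed.

Lemma tens_eq0 a b A : (forall x, A < `|x| -> a x = 0) -> (forall x, A < `|x| -> b x = 0) ->
  forall z, (A < `|z.1|) || (A < `|z.2|) -> tens a b z = 0.
Proof. by move=> a0 b0 z /orP[/a0|/b0] E; rewrite /tens E ?mul0r ?mulr0. Qed.

Lemma tens_test a b A : smooth a -> smooth b ->
  (forall x, A < `|x| -> a x = 0) -> (forall x, A < `|x| -> b x = 0) -> test_function (tens a b).
Proof.
move=> sa sb a0 b0; apply: (@csupp_test_function _ A); last exact: tens_eq0.
by move=> k; exact: tens_Ck.
Qed.

Lemma tens_laplacian a a' a2 b b' b2 : der a a' -> der a' a2 -> der b b' -> der b' b2 ->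
  laplacian (tens a b) = fun z => tens a2 b z + tens a b2 z.
Proof.
move=> da da' db db'; apply/funext => z; rewrite /laplacian.
by rewrite (tens_dx b da).2 (tens_dx b da').2 (tens_dy a db).2 (tens_dy a db').2.
Qed.

End TensorTests.

(** * Uniqueness of measures and translation invariance *)

Section MeasureUniqueness.
Context {R : realType}.
Implicit Types (a b c d : R).

Definition ocrect a b c d : set (R * R) := `]a, b]%classic `*` `]c, d]%classic.

Definition ocrects : set (set (R * R)) :=
  [set A | exists a b c d, A = ocrect a b c d].

Lemma measurable_ocrect a b c d : measurable (ocrect a b c d).
Proof. by apply: measurableX; exact: measurable_itv. Qed.

Lemma ocrectI a b c d a' b' c' d' : ocrect a b c d `&` ocrect a' b' c' d' =
  ocrect (Num.max a a') (Num.min b b') (Num.max c c') (Num.min d d').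
Proof.
apply/seteqP; split => -[x y]; rewrite /ocrect /= !in_itv/= !gt_max !le_min.
  by move=> [[/andP[-> ->] /andP[-> ->]] [/andP[-> ->] /andP[-> ->]]].
by move=> [/andP[/andP[-> ->] /andP[-> ->]] /andP[/andP[-> ->] /andP[-> ->]]].
Qed.

Lemma bigcup_ocrect : \bigcup_k ocrect (- k%:R) k%:R (- k%:R) (k%:R : R) = setT.
Proof.
apply/seteqP; split => // z _; pose k := (Num.trunc (Num.max `|z.1| `|z.2|)).+1.
exists k => //.
have := truncn_itv (le_trans (normr_ge0 z.1) (_ : _ <= Num.max `|z.1| `|z.2|)).
rewrite le_max lexx => /(_ isT)/andP[_];
  rewrite -/k gt_max !ltr_norml => /andP[/andP[h1 h2] /andP[h3 h4]].
by split; rewrite /= in_itv/= ?h1 ?h3 ltW.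
Qed.

(** The coordinates are measurable for the generated sigma-algebra, strips being countable unions of
    rectangles; hence so is the identity. *)
Lemma measurable_ocrects : @measurable _ (R * R)%type = <<s ocrects >>.
Proof.
apply/seteqP; split; last first.
  apply: smallest_sub; first exact: sigma_algebra_measurable.
  by move=> _ [a [b [c [d ->]]]]; exact: measurable_ocrect.
pose T := g_sigma_algebraType ocrects.
have mrect a b c d : measurable (ocrect a b c d : set T).
  by apply: sub_sigma_algebra; exists a, b, c, d.
have cov (x : R) : exists k : nat, - k%:R < x <= k%:R.
  exists (Num.trunc `|x|).+1; have /andP[_] := truncn_itv (normr_ge0 x).
  by rewrite ltr_norml => /andP[-> /ltW].
have m1 : measurable_fun setT (fst : T -> R).
  apply: (measurability (@ocitv R)) => // _ [_ [[a b] _ <-] <-].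
  rewrite setTI (_ : _ @^-1` _ = \bigcup_k ocrect a b (- k%:R) k%:R);
    first exact: bigcup_measurable.
  apply/seteqP; split => -[x y]; last by case=> k _ [].
  by move=> xab; have [k ky] := cov y; exists k => //; split => //=; rewrite in_itv.
have m2 : measurable_fun setT (snd : T -> R).
  apply: (measurability (@ocitv R)) => // _ [_ [[a b] _ <-] <-].
  rewrite setTI (_ : _ @^-1` _ = \bigcup_k ocrect (- k%:R) k%:R a b);
    first exact: bigcup_measurable.
  apply/seteqP; split => -[x y]; last by case=> k _ [].
  by move=> yab; have [k kx] := cov x; exists k => //; split => //=; rewrite in_itv.
move=> A mA; have := measurable_fun_pair m1 m2 measurableT mA.
by rewrite setTI (_ : (fun x : T => (x.1, x.2)) = id)//; apply/funext => -[].
Qed.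

Lemma measure_rect_unique (m1 m2 : {measure set (R * R)%type -> \bar R}) :
  (forall a b c d, m1 (ocrect a b c d) = m2 (ocrect a b c d)) ->
  (forall a b c d, (m1 (ocrect a b c d) < +oo)%E) ->
  forall A, measurable A -> m1 A = m2 A.
Proof.
move=> m12 m1oo A mA.
apply: (@measure_unique _ R _ ocrects _ measurable_ocrects _ _ bigcup_ocrect m1 m2 _ _ A mA).
- move=> _ _ [a [b [c [d ->]]]] [a' [b' [c' [d' ->]]]]; rewrite ocrectI.
  by do 4 eexists.
- by move=> k; do 4 eexists.
- by move=> _ [a [b [c [d ->]]]]; exact: m12.
- by move=> k; exact: m1oo.
Qed.

End MeasureUniqueness.

Section Cutoffs.
Context {R : realType}.
Implicit Types (a b c d x y A : R) (n : nat).

(** The shifts by 1 make the first factor 0 for [x <= a] and the second 1 for [x <= b], so that the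
    pointwise limit is exactly the indicator of the half-open interval. *)
Definition cutoff a b n x : R := step (n%:R * (x - a) - 1) * step (n%:R * (b - x) + 1).

Lemma cutoff_smooth a b n : smooth (cutoff a b n).
Proof.
move=> k; apply: Cn_mul.
  have := Cn_affine n%:R (- n%:R * a - 1) (@step_smooth R k).
  by congr Cn; apply/funext => x; congr step; ring.
have := Cn_affine (- n%:R) (n%:R * b + 1) (@step_smooth R k).
by congr Cn; apply/funext => x; congr step; ring.
Qed.

Lemma cutoff_ge0 a b n x : 0 <= cutoff a b n x.
Proof. by rewrite mulr_ge0// step_ge0. Qed.

Lemma cutoff_le1 a b n x : cutoff a b n x <= 1.
Proof. by rewrite mulr_ile1// ?step_ge0 ?step_le1. Qed.

Lemma cutoff_eq0 a b n x : (x <= a) || (b + 2 <= x) -> cutoff a b n x = 0.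
Proof.
case: n => [|n]; first by rewrite /cutoff !mul0r sub0r step_le0 ?mul0r.
case/orP => h; rewrite /cutoff.
  rewrite step_le0 ?mul0r// lerBlDr addNr mulr_ge0_le0//; lra.
rewrite [X in _ * X]step_le0 ?mulr0//.
have : n.+1%:R * (b - x) <= 1 * (b - x).
  by apply: ler_wnM2r; [lra|rewrite ler1n].
lra.
Qed.

Lemma cutoff_ev a b x : exists N, forall n, (N <= n)%N -> cutoff a b n x = (a < x <= b)%R%:R.
Proof.
have arch (t : R) : 0 < t -> exists N, forall n, (N <= n)%N -> 2 <= n%:R * t.
  move=> t0; exists (Num.trunc (2 / t)).+1 => n Nn.
  have /andP[_] : (Num.trunc (2 / t))%:R <= 2 / t < (Num.trunc (2 / t)).+1%:R.
    by apply: truncn_itv; rewrite divr_ge0 // ltW.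
  rewrite ltr_pdivrMr// => /ltW h; apply: (le_trans h); rewrite ler_pM2r//.
  by rewrite ler_nat.
case: (leP x a) => xa /=; first by exists 0%N => n _; rewrite cutoff_eq0// xa.
have [N1 h1] := arch (x - a) ltac:(lra).
case: (leP x b) => xb.
  exists N1 => n /h1 h; rewrite /cutoff [X in X * _]step_ge1 ?mul1r; last lra.
  by rewrite step_ge1// lerDr mulr_ge0//; lra.
have [N2 h2] := arch (x - b) ltac:(lra).
exists N2 => n /h2 h; rewrite /cutoff [X in _ * X]step_le0 ?mulr0//.
have -> : n%:R * (b - x) = - (n%:R * (x - b)) by ring.
lra.
Qed.

Lemma cutoff_supp a b n A : - A <= a -> b + 2 <= A -> forall x, A < `|x| -> cutoff a b n x = 0.
Proof.
move=> Aa bA x; rewrite ltr_normr => /orP[] h; rewrite cutoff_eq0//; apply/orP; [right|left]; lra.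
Qed.

Lemma cutoffs_supp a b c d : exists A, forall n x, A < `|x| -> cutoff a b n x =
  0 /\ cutoff c d n x = 0.
Proof.
exists (`|a| + `|b| + `|c| + `|d| + 2) => n x Ax.
have := ler_norm (- a); have := ler_norm b; have := ler_norm (- c); have := ler_norm d.
have := normr_ge0 a; have := normr_ge0 b; have := normr_ge0 c; have := normr_ge0 d.
rewrite !normrN => *.
by split; apply: (cutoff_supp _ _ _ Ax); lra.
Qed.

Lemma cutoff_cvg_ocrect (m : {measure set (R * R)%type -> \bar R}) a b c d :
  (forall A, (m (box (- A) A (- A) A) < +oo)%E) ->
  (\int[m]_z (tens (cutoff a b n) (cutoff c d n) z)%:E)%E @[n --> \oo] --> m (ocrect a b c d).
Proof.
move=> mfin; have [A A0] := cutoffs_supp a b c d.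
have sx n x : A < `|x| -> cutoff a b n x = 0 by case/(A0 n).
have sy n y : A < `|y| -> cutoff c d n y = 0 by case/(A0 n).
set D := box (- A) A (- A) A; have mD : measurable D by exact: measurable_box.
have mE := @measurable_ocrect R a b c d.
rewrite -[ocrect a b c d]setIT -(integral_indic m measurableT mE).
apply: (@dominated_cvg _ _ R m _ measurableT _ _ (fun z => (\1_D z)%:E)).
- move=> n; apply/measurable_EFinP; apply: continuous_measurable_prod.
  by apply: tens_cont; exact: smooth_cont (cutoff_smooth _ _ _).
- move=> [x y] _; apply: cvg_near_cst.
  have [N1 h1] := cutoff_ev a b x; have [N2 h2] := cutoff_ev c d y.
  exists (maxn N1 N2) => // n /=; rewrite geq_max => /andP[/h1 e1 /h2 e2].
  rewrite /tens /= e1 e2 indicE; congr (_%:E); rewrite -natrM mulnb; congr (_%:R).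
  congr nat_of_bool; apply/idP/idP.
    by move=> /andP[p q]; rewrite inE; split; rewrite /= in_itv.
  by rewrite inE => -[]; rewrite /= !in_itv/= => -> ->.
- by [].
- apply/integrableP; split; first by apply/measurable_EFinP; exact: measurable_indic.
  under eq_integral do rewrite gee0_abs//.
  by rewrite integral_indic// setIT; exact: mfin.
- move=> n z _; rewrite lee_fin indicE; case: (boolP (z \in D)) => zD.
    rewrite /tens ger0_norm; last exact: (mulr_ge0 (cutoff_ge0 _ _ _ _) (cutoff_ge0 _ _ _ _)).
    by apply: mulr_ile1; [exact: cutoff_ge0|exact: cutoff_ge0|exact: cutoff_le1|exact: cutoff_le1].
  rewrite (tens_eq0 (sx n) (sy n)) ?normr0//.
  move: zD; apply: contraNT; rewrite negb_or -!leNgt !ler_norml inE => /andP[h1 h2].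
  by split; rewrite /= in_itv.
Qed.

(** Products of cutoffs converge to indicators of half-open rectangles, a generating family stable
    under intersection. Tests of tensor form thus suffice, and their shifts and laplacians are
    explicit. *)
Lemma measure_test_unique (m1 m2 : {measure set (R * R)%type -> \bar R}) :
  (forall A, (m1 (box (- A) A (- A) A) < +oo)%E) ->
  (forall A, (m2 (box (- A) A (- A) A) < +oo)%E) ->
  (forall (f g : R -> R) A, smooth f -> smooth g ->
    (forall x, A < `|x| -> f x = 0) -> (forall x, A < `|x| -> g x = 0) ->
    (\int[m1]_z (tens f g z)%:E = \int[m2]_z (tens f g z)%:E)%E) ->
  forall E, measurable E -> m1 E = m2 E.
Proof.
move=> f1 f2 m12; apply: measure_rect_unique => a b c d.
  have c1 := cutoff_cvg_ocrect (a := a) (b := b) (c := c) (d := d) f1.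
  have c2 := cutoff_cvg_ocrect (a := a) (b := b) (c := c) (d := d) f2.
  apply: (cvg_unique (@ereal_hausdorff R) c1);
    suff -> : (fun n => \int[m1]_z (tens (cutoff a b n) (cutoff c d n) z)%:E)%E =
    (fun n => \int[m2]_z (tens (cutoff a b n) (cutoff c d n) z)%:E)%E by [].
  apply/funext => n; have [A A0] := cutoffs_supp a b c d.
  by apply: (m12 _ _ A) => [| |x /(A0 n)[]|x /(A0 n)[]]//; exact: cutoff_smooth.
pose A := `|a| + `|b| + `|c| + `|d|.
apply: le_lt_trans (f1 A); apply: le_measure; rewrite ?inE.
- exact: measurable_ocrect.
- exact: measurable_box.
have := ler_norm (- a); have := ler_norm b; have := ler_norm (- c); have := ler_norm d.
have := normr_ge0 a; have := normr_ge0 b; have := normr_ge0 c; have := normr_ge0 d.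
rewrite !normrN /A => *.
by move=> [x y] [] /=; rewrite !in_itv/= => /andP[? ?] /andP[? ?]; split; rewrite /= in_itv/=;
  apply/andP; split; lra.
Qed.

Lemma leb2_ocrect a b c d :
  leb2 (ocrect a b c d) = (Num.max 0 (b - a) * Num.max 0 (d - c))%:E.
Proof.
have leb_oc (p q : R) : lebesgue_measure (`]p, q]%classic : set R) = (Num.max 0 (q - p))%:E.
  rewrite lebesgue_measure_itv /= lte_fin; case: ltP => pq.
    by rewrite max_r ?EFinB// subr_ge0 ltW.
  by rewrite max_l// subr_le0.
apply: (etrans (@product_measure1E _ _ _ _ R lebesgue_measure lebesgue_measure `]a,
  b]%classic `]c, d]%classic
  (measurable_itv _) (measurable_itv _))).
exact: (f_equal2 mule (leb_oc a b) (leb_oc c d)).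
Qed.

Lemma leb2_translate (F : R * R -> \bar R) : measurable_fun setT F ->
  leb2.-integrable setT F -> leb2.-integrable setT (F \o @translate1 R) ->
  (\int[leb2]_z F (translate1 z) = \int[leb2]_z F z)%E.
Proof.
move=> mF iF iFt.
have mt : measurable_fun setT (@translate1 R : measurableTypeR R * measurableTypeR R -> R * R).
  exact: measurable_translate1.
have mi : measurable_fun setT (id : measurableTypeR R * measurableTypeR R -> R * R).
  exact: measurable_id.
have h1 := @integral_pushforward _ _ _ _ R _ mt leb2 setT F mF iFt measurableT.
(* The pushforward by the identity moves [leb2] from the copy [measurableTypeR R] of the line to the
   plane for which [measure_rect_unique] is stated. *)
have h2 := @integral_pushforward _ _ _ _ R _ mi leb2 setT F mF iF measurableT.
rewrite -[RHS]h2 -[LHS]h1; apply: eq_measure_integral.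
have E a b c d : @translate1 R @^-1` ocrect a b c d = ocrect (a - 1) (b - 1) c d.
  apply/seteqP; split => -[x y] [] /=; rewrite !in_itv/= => /andP[h3 h4] h5; split => //=.
    by rewrite in_itv/=; apply/andP; split; lra.
  by rewrite in_itv/=; apply/andP; split; lra.
move=> A mA _; apply: measure_rect_unique mA => a b c d.
  rewrite /= /pushforward E; apply: (etrans (leb2_ocrect _ _ _ _)).
  apply: (etrans _ (esym (leb2_ocrect _ _ _ _))).
  by rewrite (_ : b - 1 - (a - 1) = b - a); last ring.
rewrite /= /pushforward E [X in (X < _)%E](leb2_ocrect (a - 1) (b - 1) c d).
exact: ltry.
Qed.

End Cutoffs.

(** * Periodic subharmonic functions of linear growth *)

(** The integral is the difference of those of the positive and negative parts, and +oo - +oo is -oo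
    by convention; a finite value therefore forces both to be finite. *)
Lemma integrable_of_fin d (T : measurableType d) (R : realType) (m : {measure set T -> \bar R})
    (F : T -> \bar R) : measurable_fun setT F ->
  (\int[m]_z F z)%E \is a fin_num -> m.-integrable setT F.
Proof.
move=> mF; rewrite integralE => hfin.
have p0 : (0 <= \int[m]_z F^\+ z)%E by exact: integral_ge0.
have n0 : (0 <= \int[m]_z F^\- z)%E by exact: integral_ge0.
have [pf nf] : (\int[m]_z F^\+ z)%E \is a fin_num /\ (\int[m]_z F^\- z)%E \is a fin_num.
  by move: p0 n0 hfin; case: (integral m _ _) => [p| |]; case: (integral m _ _) => [q| |].
apply/integrableP; split; first exact: mF.
under eq_integral do rewrite -/((abse \o F) _) fune_abse.
rewrite ge0_integralD//; last 2 first.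
- exact: measurable_funepos.
- exact: measurable_funeneg.
by rewrite lte_add_pinfty// ltey_eq ?pf ?nf.
Qed.

Lemma der_local {R : realType} (f f' g g' : R -> R) (B : R) : der f f' -> der g g' ->
  (forall x, `|x| < B -> f x = g x) -> forall x, `|x| < B -> f' x = g' x.
Proof.
move=> df dg fg x xB.
have h : is_derive x 1 g (f' x).
  apply: near_eq_is_derive (df x).
  have : \forall t \near x, `|t| < B.
    have : (fun t : R => `|t|) @ x --> `|x| by apply: cvg_norm; exact: cvg_id.
    by move/(@cvgr_lt _ _ _ _ _ _); apply.
  by apply: filterS => t tB; rewrite fg.
by rewrite -(derive_val (is_derive := h)) -(derive_val (is_derive := dg x)).
Qed.

Section PeriodicSubharmonic.
Context {R : realType}.
Variables (v : R * R -> \bar R) (mu : {measure set (R * R)%type -> \bar R}).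
Hypothesis mu_compact : finite_on_compacts mu.
Hypothesis v_sub : subharmonic v.
Hypothesis v_riesz : riesz_measure v mu.
Hypothesis v_per : periodic1 v.
Implicit Types (f g w : R * R -> R) (A : R).

Lemma v_measurable : measurable_fun setT v.
Proof.
case: v_sub => _ lsc _ _.
have h := measurableT_comp (@oppe_measurable R setT) (lsc_measurable_prod lsc).
by apply: eq_measurable_fun h => z _ /=; rewrite oppeK.
Qed.

(** The other side of the Riesz identity is finite, [mu] being finite on the compact support; hence
    so is this integral. *)
Lemma riesz_fin phi : test_function phi -> leb2.-integrable setT (fun z =>
  v z * (laplacian phi z)%:E)%E.
Proof.
move=> tphi; have C2phi := test_function_C2 tphi.
have cphi := C2_cont C2phi.
have [A A0 phi0] := test_function_support tphi.
have csphi : csupp phi A by split=> // z /phi0[].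
apply: integrable_of_fin.
  apply: emeasurable_funM; first exact: v_measurable.
  apply/measurable_EFinP; apply: continuous_measurable_prod.
  by apply: cont_add; [exact: (C2_cont_xx C2phi)|exact: (C2_cont_yy C2phi)].
have := v_riesz tphi.
have : (\int[mu]_z (phi z)%:E)%E \is a fin_num.
  by apply: integrable_fin_num => //; exact: (csupp_integrable mu_compact csphi).
have p20 : 0 < (2 * pi)^-1 :> R by rewrite invr_gt0 mulr_gt0// pi_gt0.
rewrite -/leb2; move: (integral leb2 _ _) => x yfin E; move: yfin; rewrite -E;
  case: x {E} => [//| |].
  by rewrite gt0_muley ?lte_fin.
by rewrite gt0_muleNy ?lte_fin.
Qed.

(** Near the box the test function is x^2 / 2, with laplacian 1, so that [riesz_fin] speaks of [v]
    itself there. *)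
Lemma v_box_integrable A : 0 <= A -> leb2.-integrable (box (- A) A (- A) A) v.
Proof.
(* Equal to 1 for [|x| <= A + 2] and to 0 beyond A + 4; the margin gives an open neighbourhood of
   the box on which [der_local] reads off the derivatives. *)
move=> A0; pose th := plateau (- A - 3) (A + 3) : R -> R.
have thp : - A - 3 <= A + 3 by lra.
pose q x := (x * x) * (2^-1 * th x).
have sid : smooth (fun x : R => x) by move=> n; apply: (der_smooth (@der_id R)) => k; exact: Cn_cst.
have sth : smooth th by exact: plateau_smooth.
have sq : smooth q.
  move=> n; apply: Cn_mul; first by apply: Cn_mul; exact: sid.
  by apply: Cn_mul; [exact: Cn_cst|exact: sth].
have [q1 dq sq1] := smooth_der sq; have [q2 dq1 sq2] := smooth_der sq1.
have [th1 dth sth1] := smooth_der sth; have [th2 dth1 sth2] := smooth_der sth1.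
have th_1 x : `|x| < A + 1 -> th x = 1.
  rewrite ltr_norml => /andP[h1 h2]; apply: plateau_eq1; apply/andP; split; lra.
have th_0 x : A + 4 < `|x| -> th x = 0.
  rewrite ltr_normr => h; apply: plateau_eq0 => //; apply/orP.
  by case/orP: h => h; [right|left]; lra.
have dsq : der (fun x : R => x * x * 2^-1) (fun x => x).
  apply: der_eq; first exact: (der_mul (der_mul (@der_id R) (@der_id R)) (der_cst 2^-1)).
  by move=> x /=; field.
have q1E : forall x, `|x| < A + 1 -> q1 x = x.
  by apply: (der_local dq dsq) => x xA; rewrite /q th_1// mulr1.
have q2E := der_local dq1 (@der_id R) q1E.
have th1E := der_local dth (@der_cst R 1) th_1.
have th2E := der_local dth1 (@der_cst R 0) th1E.
have q_0 x : A + 4 < `|x| -> q x = 0 by move=> /th_0 E; rewrite /q E !mulr0.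
have tphi := tens_test sq sth q_0 th_0.
have := riesz_fin tphi; rewrite (tens_laplacian dq dq1 dth dth1) => h.
have mD : measurable (box (- A) A (- A) A) by exact: measurable_box.
have := @integrableS _ _ R leb2 _ _ _ measurableT mD (@subsetT _ _) h.
apply: (@eq_integrable _ _ R leb2 _ mD) => z; rewrite inE => -[/= h1 h2].
have z1 : `|z.1| < A + 1 by move: h1; rewrite in_itv/= -ler_norml => h1; lra.
have z2 : `|z.2| < A + 1 by move: h2; rewrite in_itv/= -ler_norml => h2; lra.
by rewrite /tens (q2E _ z1) (th_1 _ z2) (th2E _ z2) mulr0 addr0 mulr1 mule1.
Qed.

(* [v] is finite almost everywhere, and its integrals against compactly supported
   weights are linear in the weight once [-oo] is replaced by [0]. *)
Definition ureal z := fine (v z).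

(** Integrability of the product excludes, up to a null set, points where [v] is -oo and [w] is not
    0; where [w] vanishes both products are 0. *)
Lemma v_finite w A : csupp w A ->
  [/\ leb2.-integrable setT (fun z => v z * (w z)%:E)%E, leb2.-integrable setT (fun z =>
    (ureal z * w z)%:E) &
  (\int[leb2]_z (v z * (w z)%:E) = (\int[leb2]_z (ureal z * w z)%R)%:E)%E].
Proof.
move=> [cw w0].
have ivw : leb2.-integrable setT (fun z => v z * (w z)%:E)%E.
  pose D := box (- `|A|) `|A| (- `|A|) `|A|; have mD : measurable D by exact: measurable_box.
  have iv : leb2.-integrable D v by exact: v_box_integrable (normr_ge0 A).
  have [C C0 wC] := continuous_bounded_box (- `|A|) `|A| (- `|A|) `|A| cw.
  have : leb2.-integrable D (fun z => v z * (w z)%:E)%E.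
    apply: (@le_integrable _ _ R leb2 D mD _ _ _ _
      (@integrableZr _ _ R leb2 D mD C _ (integrable_abse iv))).
      apply: measurable_funTS; apply: emeasurable_funM; first exact: v_measurable.
      by apply/measurable_EFinP; exact: continuous_measurable_prod.
    move=> z Dz; rewrite /= abseM [leRHS]abseM abse_id lee_wpmul2l// lee_fin (ger0_norm C0).
    by case: z Dz => x y [/=]; rewrite !in_itv/=; exact: wC.
  rewrite integrable_mkcond//; congr (_.-integrable _ _).
  apply/funext => z; rewrite patchE; case: ifPn => //; rewrite notin_setE => zK.
  rewrite /= w0 ?mule0//; apply: contra_notT zK; rewrite negb_or -!leNgt => /andP[z1 z2].
  by split; rewrite /= in_itv/= -ler_norml (le_trans _ (ler_norm A)).
have muw : measurable_fun setT (fun z => (ureal z * w z)%:E).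
  apply/measurable_EFinP; apply: measurable_funM; last exact: continuous_measurable_prod.
  exact: (measurableT_comp (@fine_measurable R setT measurableT) v_measurable).
have iuw : leb2.-integrable setT (fun z => (ureal z * w z)%:E).
  apply: (@le_integrable _ _ R leb2 setT measurableT _ _ muw _ ivw) => z _.
  rewrite /ureal; case: (v z) => [r| |] /=; first by [].
    by rewrite mul0r normr0 abse_ge0.
  by rewrite mul0r normr0 abse_ge0.
split => //; rewrite /Rintegral fineK; last exact: (integrable_fin_num measurableT iuw).
apply: ae_eq_integral => //.
- exact: (measurable_int _ ivw).
have := @integrable_ae _ _ R leb2 setT measurableT _ ivw.
apply: filterS => z /(_ I) + _; rewrite /ureal; have := v_sub.
case=> /(_ z) + _ _ _; case: (v z) => [r _ _|//|_] /=; first by rewrite EFinM.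
rewrite mul0r; case: (ltgtP (w z) 0) => [w0z|w0z|->]; last by rewrite mule0.
  by rewrite lt0_mulNye ?lte_fin.
by rewrite gt0_mulNye ?lte_fin.
Qed.

Definition I w : R := \int[leb2]_z (ureal z * w z).

Lemma I_int w A : csupp w A -> leb2.-integrable setT (fun z => (ureal z * w z)%:E).
Proof. by case/v_finite. Qed.

Lemma csupp_add f g A : csupp f A -> csupp g A -> csupp (fun z => f z + g z) A.
Proof.
by move=> [cf f0] [cg g0]; split; [exact: cont_add|move=> z h; rewrite f0// g0// addr0].
Qed.

Lemma csupp_scale f (k : R) A : csupp f A -> csupp (fun z => k * f z) A.
Proof.
move=> [cf f0]; split; first by apply: cont_mul => //; exact: cont_cst.
by move=> z h; rewrite f0// mulr0.
Qed.

Lemma I_add f g A : csupp f A -> csupp g A -> I (fun z => f z + g z) = I f + I g.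
Proof.
move=> cf cg; rewrite /I -(@RintegralD _ _ R leb2 setT _ _ measurableT (I_int cf) (I_int cg)).
by apply: eq_Rintegral => z _; rewrite mulrDr.
Qed.

Lemma I_scale f (k : R) A : csupp f A -> I (fun z => k * f z) = k * I f.
Proof.
move=> cf; rewrite /I -(@RintegralZl _ _ R leb2 setT _ _ measurableT (I_int cf)).
by apply: eq_Rintegral => z _; rewrite mulrCA.
Qed.

Lemma I_shift f A : csupp f A -> I (shiftx f 1) = I f.
Proof.
move=> cf; have cf1 := csupp_shiftx 1 cf.
have E z : ureal z * shiftx f 1 z = ureal (translate1 z) * f (translate1 z).
  by rewrite /ureal v_per.
rewrite /I /Rintegral; congr fine; under eq_integral do rewrite E.
apply: (@leb2_translate R (fun z => (ureal z * f z)%:E)).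
- exact: (measurable_int _ (I_int cf)).
- exact: (I_int cf).
- have := I_int cf1; by under eq_fun do rewrite E.
Qed.

Lemma riesz_I phi : test_function phi -> \int[mu]_z phi z = (2 * pi)^-1 * I (laplacian phi).
Proof.
move=> tphi; have C2phi := test_function_C2 tphi.
have [A A0 phi0] := test_function_support tphi.
have cl : csupp (laplacian phi) A.
  split; first by apply: cont_add; [exact: (C2_cont_xx C2phi)|exact: (C2_cont_yy C2phi)].
  by move=> z /phi0[_ _ _ e1 e2]; rewrite /laplacian e1 e2 addr0.
have [_ _ E] := v_finite cl.
by have := v_riesz tphi; rewrite -/leb2 E => /esym h; rewrite /Rintegral h.
Qed.

Lemma mu_translation_invariant : translation_invariant mu.
Proof.
move=> E mE; apply: measure_test_unique mE; first exact: measurable_translate1.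
- move=> ? A; rewrite /= /pushforward.
  have -> : @translate1 R @^-1` box (- A) A (- A) A = box (- A - 1) (A - 1) (- A) A.
    apply/seteqP; split => -[x y] [] /=; rewrite !in_itv/= => /andP[h3 h4] h5; split => //=.
      by rewrite in_itv/=; apply/andP; split; lra.
    by rewrite in_itv/=; apply/andP; split; lra.
  exact: mu_compact (@compact_box _ _ _ _ _).
- by move=> A; exact: mu_compact (@compact_box _ _ _ _ _).
move=> ? f g A sf sg f0 g0; have tfg := tens_test sf sg f0 g0.
have csfg : csupp (tens f g) A by split; [apply: tens_cont; exact: smooth_cont|exact: tens_eq0].
have cs1 := csupp_shiftx 1 csfg.
apply: (etrans (@integral_pushforward _ _ _ _ R _ (@measurable_translate1 R) mu setT
  (EFin \o tens f g) _ _ _)) => //.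
- by apply/measurable_EFinP; exact: continuous_measurable_prod (proj1 csfg).
- exact: (csupp_integrable mu_compact cs1).
have f1z x : A + 1 < `|x| -> f (x + 1) = 0.
  by move=> xA; apply: f0; have := ler_normD (x + 1) (- 1); rewrite addrK normrN normr1; lra.
have g1z x : A + 1 < `|x| -> g x = 0 by move=> xA; apply: g0; lra.
have tfg1 : test_function (shiftx (tens f g) 1) := tens_test (smooth_shift 1 sf) sg f1z g1z.
have [f' df sf'] := smooth_der sf; have [f2 df' sf2] := smooth_der sf'.
have [g' dg sg'] := smooth_der sg; have [g2 dg' sg2] := smooth_der sg'.
have Lsh : laplacian (shiftx (tens f g) 1) = shiftx (laplacian (tens f g)) 1.
  have := tens_laplacian (der_shift 1 df) (der_shift 1 df') dg dg'.
  by rewrite (tens_laplacian df df' dg dg').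
have [B B0 phi0] := test_function_support tfg.
have C2phi := test_function_C2 tfg.
have cl : csupp (laplacian (tens f g)) B.
  split; first by apply: cont_add; [exact: (C2_cont_xx C2phi)|exact: (C2_cont_yy C2phi)].
  by move=> z /phi0[_ _ _ e1 e2]; rewrite /laplacian e1 e2 addr0.
have e1 := riesz_I tfg; have e2 := riesz_I tfg1.
rewrite -[LHS](fineK (integrable_fin_num measurableT (csupp_integrable mu_compact cs1))).
rewrite -[RHS](fineK (integrable_fin_num measurableT (csupp_integrable mu_compact csfg))).
congr (_%:E); apply: (etrans e2); apply: (etrans _ (esym e1)).
exact: (congr1 (fun u => (2 * pi)^-1 * u) (etrans (congr1 I Lsh) (I_shift cl))).
Qed.

Hypothesis v_growth : at_most_linear_growth v.

Lemma cmod_le (z : R * R) : cmod z <= `|z.1| + `|z.2|.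
Proof.
rewrite /cmod -(ger0_norm (addr_ge0 (normr_ge0 z.1) (normr_ge0 z.2))) -sqrtr_sqr.
rewrite ler_sqrt ?sqr_ge0// sqrrD !real_normK ?num_real//.
by rewrite [leRHS]addrAC lerDl mulrn_wge0// mulr_ge0.
Qed.

Lemma bump_bounded : exists2 B : R, 0 <= B & forall x, bump x <= B :> R.
Proof.
have c : continuous (fun z : R * R => bump z.1).
  exact: cont_comp (smooth_cont (@bump_smooth R)) (@cont_fst R).
have [B B0 h] := continuous_bounded_box (-1) 1 0 0 c; exists B => // x.
case: (leP 1 `|x|) => [/bump_eq0->//|x1].
apply: le_trans (ler_norm _) (h x 0 _ _); last by rewrite lexx.
by rewrite -ler_norml ltW.
Qed.

(** Equal to 1 on [[0, 1]]. The two jumps are 3 apart, an integer, so [v] cannot distinguish the two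
    halves of its second derivative. *)
Notation a := (plateau (- 1) 2 : R -> R).

Lemma a_eq0 x : 3 < `|x| -> a x = 0.
Proof.
rewrite ltr_normr => h; apply: plateau_eq0; first lra.
by apply/orP; case/orP: h => h; [right|left]; lra.
Qed.

Lemma bumpB_eq0 (s y : R) : 1 + `|s| < `|y| -> bump (y - s) = 0.
Proof.
by move=> h; rewrite bump_eq0//; have := ler_normD (y - s) s; rewrite subrK; lra.
Qed.

Lemma csupp_a_bump (s : R) : csupp (tens a (fun y => bump (y - s))) (4 + `|s|).
Proof.
have s0 := normr_ge0 s.
split.
  apply: tens_cont; apply: smooth_cont; first exact: plateau_smooth.
  exact: smooth_shift (@bump_smooth R).
by apply: tens_eq0 => x h; [apply: a_eq0|apply: bumpB_eq0]; lra.
Qed.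

(** One-sided, as the growth of [v] is; the weight is nonnegative. It vanishes outside a 6 by 2 box,
    of area 12. *)
Lemma I_a_bump_le : exists2 K : R, 0 <= K &
  forall s, I (tens a (fun y => bump (y - s))) <= K * (5 + `|s|).
Proof.
have [B B0 bB] := bump_bounded; have [C vC] := v_growth.
exists (`|C| * B * 12) => [|s]; first by rewrite !mulr_ge0.
have s0 := normr_ge0 s.
set w := tens a _; have cw : csupp w _ := csupp_a_bump s.
pose D := box (- 3) 3 (s - 1) (s + 1); have mD : measurable D by exact: measurable_box.
have -> : I w = \int[leb2]_(z in D) (ureal z * w z).
  rewrite /I [RHS]Rintegral_mkcond; apply: eq_Rintegral => z _; rewrite patchE; case: ifPn => //.
  rewrite notin_setE => zD; rewrite /w /tens.
  case: (ltP 3 `|z.1|) => [/a_eq0->|z1]; first by rewrite mul0r mulr0.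
  case: (leP 1 `|z.2 - s|) => [/bump_eq0->|z2]; first by rewrite !mulr0.
  exfalso; apply: zD; move: z1 z2; rewrite ler_norml ltr_norml => z1 /andP[z2 z3].
  by split; rewrite /= in_itv//=; apply/andP; split; lra.
have D12 : fine (leb2 D) = 12.
  by rewrite [X in fine X]leb2_box /=; [ring|lra|lra].
rewrite (_ : `|C| * B * 12 * (5 + `|s|) = `|C| * (5 + `|s|) * B * 12); last ring.
rewrite -[in leRHS]D12 -(@Rintegral_cst _ _ R leb2 D mD).
have iD : leb2.-integrable D (fun z => (ureal z * w z)%:E).
  exact: (@integrableS _ _ R leb2 _ _ _ measurableT mD (@subsetT _ _) (I_int cw)).
have ic : leb2.-integrable D (fun z => (`|C| * (5 + `|s|) * B)%:E).
  exact: (integrable_box _ _ _ _ (@cont_cst _ _ _)).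
apply: (@le_Rintegral _ _ R leb2 D _ _ mD iD ic) => z [] /=; rewrite !in_itv/= => z1 z2.
have w0 : 0 <= w z by rewrite mulr_ge0 ?bump_ge0// plateau_ge0//; lra.
have wB : w z <= B.
  apply: le_trans (_ : 1 * bump (z.2 - s) <= _); last by rewrite mul1r.
  rewrite ler_wpM2r ?bump_ge0// /plateau.
  by have := step_le1 (z.1 - -1); have := step_ge0 (z.1 - 2); lra.
(* 5 is 3 for the abscissa, 1 for the half-height of the box and 1 from the growth condition. [|C|]
   makes the bound nonnegative, so that it also covers the value 0 put in place of -oo. *)
have uC : ureal z <= `|C| * (5 + `|s|).
  have := vC z; rewrite /ureal; case: (v z) => [r|//|_] /=; last by rewrite mulr_ge0//; lra.
  rewrite lee_fin => h; apply: (le_trans h).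
  have cz : 0 <= cmod z by exact: sqrtr_ge0.
  apply: le_trans (_ : `|C| * (cmod z + 1) <= _).
    by rewrite ler_wpM2r ?ler_norm//; lra.
  rewrite ler_wpM2l//; have := cmod_le z.
  have : `|z.1| <= 3 by rewrite ler_norml.
  have : `|z.2| <= `|s| + 1.
    have := ler_norm s; have := ler_norm (- s); rewrite normrN ler_norml => h1 h2.
    by move/andP: z2 => [? ?]; apply/andP; split; lra.
  lra.
apply: le_trans (_ : `|C| * (5 + `|s|) * w z <= _); first by rewrite ler_wpM2r.
by rewrite ler_wpM2l// mulr_ge0//; lra.
Qed.

Lemma shiftxD f (d e : R) : shiftx (shiftx f d) e = shiftx f (d + e).
Proof. by apply/funext => z; rewrite /shiftx /= -addrA [e + d]addrC. Qed.

Lemma csupp_weaken f A B : csupp f A -> A <= B -> csupp f B.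
Proof.
move=> [cf f0] AB; split=> // z h; apply: f0.
by case/orP: h => h; rewrite (le_lt_trans AB h) ?orbT.
Qed.

Lemma tent_integral_le : exists2 K : R, 0 <= K &
  forall r, 0 <= r -> \int[mu]_z tens a (tent r) z <= K * (5 + r).
Proof.
have [K K0 IK] := I_a_bump_le.
have p20 : 0 < (2 * pi)^-1 :> R by rewrite invr_gt0 mulr_gt0// pi_gt0.
pose K1 := `|I (tens a (fun y => bump (y - 0)))|.
exists ((2 * pi)^-1 * (2 * K + 2 * K1)).
  by rewrite mulr_ge0 ?(ltW p20)// addr_ge0// mulr_ge0// normr_ge0.
move=> r r0; pose A := r + 5.
have [b1 db sb1] := smooth_der (@bump_smooth R).
have b1_0 : forall x, 1 < `|x| -> b1 x = 0.
  by apply: (der_vanish db) => x x1; rewrite bump_eq0// ltW.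
have da : der a (fun x => bump (x + 1) - bump (x - 2)).
  by have := @plateau_der R (-1) 2; rewrite opprK.
have da' : der (fun x => bump (x + 1) - bump (x - 2)) (fun x => b1 (x + 1) - b1 (x - 2)).
  exact: (der_add (der_shift 1 db) (der_opp (der_shift (- 2) db))).
have dt := second_diff_der r (@ramp_der R).
have dt' := second_diff_der r (@step_der R).
have t0 y : A < `|y| -> tent r y = 0 by move=> h; apply: tent_eq0 => //; rewrite /A in h; lra.
have a0 x : A < `|x| -> a x = 0 by move=> h; apply: a_eq0; rewrite /A in h; lra.
have ta : test_function (tens a (tent r)).
  by apply: (tens_test _ _ a0 t0);
    [exact: plateau_smooth|exact: smooth_second_diff (@ramp_smooth R)].
rewrite (riesz_I ta) -mulrA ler_wpM2l ?(ltW p20)//.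
pose W := tens b1 (tent r).
have cW : csupp W A.
  split; first by apply: tens_cont; [exact: smooth_cont|exact: der_cont dt].
  by apply: tens_eq0 => // x h; apply: b1_0; rewrite /A in h; lra.
have cW1 := csupp_shiftx 1 cW; have cW2 := csupp_shiftx (-2) cW.
rewrite normr1 in cW1; rewrite normrN ger0_norm// in cW2.
have cW1' : csupp (shiftx W 1) (A + 2) by apply: csupp_weaken cW1 _; lra.
have Lr : laplacian (tens a (tent r)) = fun z =>
  (shiftx W 1 z + (-1) * shiftx W (-2) z) +
  ((tens a (fun y => bump (y - - r)) z + tens a (fun y => bump (y - r)) z) +
   (-2) * tens a (fun y => bump (y - 0)) z).
  rewrite (tens_laplacian da da' dt dt'); apply/funext => z.
  by rewrite /W /shiftx /tens /tent /second_diff /= opprK subr0; ring.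
have cr := csupp_a_bump r; have crN := csupp_a_bump (- r); have c0 := csupp_a_bump 0.
rewrite normrN ger0_norm// in crN; rewrite ger0_norm// in cr; rewrite normr0 addr0 in c0.
have w1 := csupp_weaken cr (_ : 4 + r <= A + 2).
have w2 := csupp_weaken crN (_ : 4 + r <= A + 2).
have w3 := csupp_weaken c0 (_ : 4 <= A + 2).
have [e1 e2] : 4 + r <= A + 2 /\ 4 <= A + 2 by rewrite /A; split; lra.
have {}w1 := w1 e1; have {}w2 := w2 e1; have {}w3 := w3 e2.
(* Three unit shifts lead from -2 to 1. *)
have IW : I (shiftx W 1) = I (shiftx W (-2)).
  have cW3 := csupp_shiftx 1 cW2; have cW4 := csupp_shiftx 1 cW3.
  have := I_shift cW4; rewrite (I_shift cW3) (I_shift cW2) !shiftxD => <-.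
  by congr (I (shiftx W _)); ring.
rewrite Lr (I_add (csupp_add cW1' (csupp_scale (-1) cW2)) (csupp_add (csupp_add w2 w1)
  (csupp_scale (-2) w3))).
rewrite (I_add cW1' (csupp_scale (-1) cW2)) (I_scale (-1) cW2) IW.
rewrite (I_add (csupp_add w2 w1) (csupp_scale (-2) w3)) (I_add w2 w1) (I_scale (-2) w3).
have := IK r; have := IK (- r); rewrite normrN (ger0_norm r0).
have := ler_norm (- I (tens a (fun y => bump (y - 0)))); rewrite normrN -/K1.
(* The central bump contributes at most [2 * K1], whatever r is; it is absorbed into
   [2 * K1 * (5 + r)]. *)
have : 0 <= K1 * (4 + r) by rewrite mulr_ge0 ?normr_ge0//; lra.
rewrite mulrDr.
move: (I _) (I _) (I _) (I _) => i1 i2 i3 i4.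
lra.
Qed.

Lemma mu_strip_finite : (mu (slab 0 1) < +oo)%E.
Proof.
have [K K0 tK] := tent_integral_le.
pose E (n : nat) : set (R * R) := slab 0 1 `&` [set z | `|z.2| <= n%:R].
have mE n : measurable (E n).
  apply: measurableI; first exact: measurable_slab.
  have : measurable (setT `&` (snd : R * R -> R) @^-1` `[- n%:R, n%:R]%classic).
    by apply: measurable_snd => //; exact: measurable_itv.
  by rewrite setTI; congr measurable; apply/seteqP; split => z /=; rewrite in_itv/= ler_norml.
have UE : \bigcup_n E n = slab 0 1.
  apply/seteqP; split => [z [n _ []]//|z zS]; exists (Num.trunc `|z.2|).+1 => //; split => //=.
  by have /andP[_ /ltW] := truncn_itv (normr_ge0 z.2).
have Ele n : (mu (E n) <= (4 * K)%:E)%E.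
  (* On [E n] the tent is then at least r - n - 3 = n + 3, while 5 + r = 2n + 11 is at most 4 (n +
     3): the quotient is bounded by [4 * K] for every n. *)
  pose r : R := 2 * n%:R + 6; have n0 : 0 <= n%:R :> R by [].
  have r0 : 0 <= r by rewrite /r; lra.
  have csf : csupp (tens a (tent r)) (r + 5).
    split; first by apply: tens_cont; apply: smooth_cont;
      [exact: plateau_smooth|exact: smooth_second_diff (@ramp_smooth R)].
    by apply: tens_eq0 => x h; [apply: a_eq0|apply: tent_eq0]; lra.
  have f0 z : 0 <= tens a (tent r) z by rewrite mulr_ge0 ?tent_ge0// plateau_ge0//; lra.
  have mf : measurable_fun setT (EFin \o tens a (tent r)).
    by apply/measurable_EFinP; exact: continuous_measurable_prod (proj1 csf).
  have h1 : ((n%:R + 3)%:E * mu (E n) <= \int[mu]_z (tens a (tent r) z)%:E)%E.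
    rewrite -(integral_cst mu (mE n)).
    apply: (@le_trans _ _ (\int[mu]_(z in E n) (tens a (tent r) z)%:E)%E); last first.
      by apply: ge0_subset_integral => // z _; rewrite lee_fin.
    apply: ge0_le_integral => //.
    - by move=> z _; rewrite lee_fin; lra.
    - exact: measurable_funTS mf.
    - move=> z [[z1 z2] /= z3]; rewrite lee_fin /tens plateau_eq1 ?mul1r; last by apply/andP;
      split; lra.
      by have := tent_ge r z.2; rewrite /r; lra.
  have h2 : (\int[mu]_z (tens a (tent r) z)%:E <= (K * (5 + r))%:E)%E.
    rewrite -(fineK (integrable_fin_num measurableT (csupp_integrable mu_compact csf))) lee_fin.
    exact: tK.
  have h3 : K * (5 + r) <= (n%:R + 3) * (4 * K).
    by have := mulr_ge0 K0 n0; rewrite /r; nra.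
  have n3 : 0 < n%:R + 3 :> R by lra.
  rewrite -(@lee_pmul2l _ (n%:R + 3)%:E) ?lte_fin// -EFinM.
  by apply: (le_trans h1); apply: (le_trans h2); rewrite lee_fin.
have nd : {homo E : n m / (n <= m)%N >-> (n <= m)%O}.
  move=> n m nm; apply/subsetPset => z [zS /= zn]; split => //=.
  by apply: le_trans zn _; rewrite ler_nat.
have mU : measurable (\bigcup_n E n) by rewrite UE; exact: measurable_slab.
have := nondecreasing_cvg_mu (mu := mu) mE mU nd; rewrite UE => cv.
apply: (@le_lt_trans _ _ (4 * K)%:E); last exact: ltry.
rewrite -(cvg_lim (@ereal_hausdorff R) cv); apply: lime_le; first by apply/cvg_ex; eexists;
  exact: cv.
by apply: nearW => n; exact: Ele.
Qed.

End PeriodicSubharmonic.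

Theorem theorem7 (R : realType) (mu : {measure set (R * R) -> \bar R})
    (mu_compact : finite_on_compacts mu) :
  (exists v : R * R -> \bar R,
     [/\ subharmonic v, riesz_measure v mu, periodic1 v &
         at_most_linear_growth v])
  <->
  (translation_invariant mu /\
   (mu [set z : R * R | (0 <= z.1)%R /\ (z.1 < 1)%R] < +oo)%E).
Proof.
split=> [[v [v_sub v_riesz v_per v_growth]]|[mu_inv mu_fin]].
  split; first exact: (mu_translation_invariant mu_compact v_sub v_riesz v_per).
  have := mu_strip_finite mu_compact v_sub v_riesz v_per v_growth.
  by congr (mu _ < _)%E; apply/seteqP; split=> z; rewrite /slab /= ?add0r.
apply: (periodic_potential_exists mu_compact mu_inv).
exact: mu_fin.
Qed.
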